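(* Let $M$ be a closed smooth 3-manifold, let $\mu>0$ be a constant, and let $f\colon M\to\mathbb{R}$ be a smooth function with $f>0$ everywhere. Then there is no Riemannian metric $g$ on $M$ whose principal Ricci curvatures are, at every point $p\in M$, equal to $-\mu, f(p), f(p)$ (counted with multiplicity).
   Context: Closed means compact without boundary; manifolds are connected and nonempty. For a Riemannian manifold $(M,g)$ with Ricci tensor $\mathrm{Ric}$, let $\widehat{\mathrm{Ric}}\colon TM\to TM$ be the smooth bundle endomorphism defined by $g(\widehat{\mathrm{Ric}}_p(X),Y)=\mathrm{Ric}_p(X,Y)$ for all $p\in M$ and $X,Y\in T_pM$. The principal Ricci curvatures at $p$ are the eigenvalues of the self-adjoint map $\widehat{\mathrm{Ric}}_p$. Sign convention: $R(X,Y)Z=\nabla_X\nabla_YZ-\nabla_Y\nabla_XZ-\nabla_{[X,Y]}Z$, with $\mathrm{Ric}$ normalized as usual so that round spheres have positive Ricci curvature. *)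

(* Defs.v *)
From HB Require Import structures.
From mathcomp Require Import all_boot all_order all_algebra.
From mathcomp Require Import all_classical all_reals all_analysis.

Set Implicit Arguments.
Unset Strict Implicit.
Unset Printing Implicit Defensive.

Import Order.TTheory GRing.Theory Num.Theory.
Import numFieldNormedType.Exports.
Local Open Scope classical_set_scope.
Local Open Scope ring_scope.

Section Calculus.
Variables (R : realType) (n : nat).
Implicit Types (U : set 'rV[R]_n) (h : 'rV[R]_n -> R) (s : seq 'I_n).

Definition basis_vector (i : 'I_n) : 'rV[R]_n := delta_mx 0 i.

Definition partial (i : 'I_n) h : 'rV[R]_n -> R := 'D_(basis_vector i) h.

Definition iter_partial s h : 'rV[R]_n -> R := foldr partial h s.

(* C^oo on U: the partial derivatives of all orders exist and are continuous.
   Only used for U open. *)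
Definition smooth_on U h : Prop :=
  forall s, {within U, continuous (iter_partial s h)} /\
    forall i x, U x -> derivable (iter_partial s h) x (basis_vector i).

(* Vectors are rows, so the differential of F at x is v |-> v *m jac F x. *)
Definition jac (F : 'rV[R]_n -> 'rV[R]_n) (x : 'rV[R]_n) : 'M[R]_n :=
  \matrix_(i, j) partial i (fun y => F y 0 j) x.

End Calculus.

(* A smooth structure is given by a smooth atlas, not required to be maximal:
   an atlas and the maximal atlas it generates have the same smooth functions
   and the same smooth tensor fields.  The maps chart c and chart_inv c are
   total, but are only constrained on dom c and on its image.  Charts take
   values in open sets of R^n, so there is no boundary. *)
Record smooth_manifold (R : realType) (n : nat) := SmoothManifold {
  carrier :> topologicalType;
  manifold_hausdorff : hausdorff_space carrier;
  manifold_second_countable : @second_countable carrier;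
  manifold_connected : connected [set: carrier];
  manifold_nonempty : [set: carrier] !=set0;
  chart_index : Type;
  dom : chart_index -> set carrier;
  chart : chart_index -> carrier -> 'rV[R]_n;
  chart_inv : chart_index -> 'rV[R]_n -> carrier;
  dom_open : forall c, open (dom c);
  dom_cover : forall p, exists c, dom c p;
  chart_image_open : forall c, open (chart c @` dom c);
  chartK : forall c p, dom c p -> chart_inv c (chart c p) = p;
  chart_continuous : forall c, {within dom c, continuous (chart c)};
  chart_inv_continuous :
    forall c, {within chart c @` dom c, continuous (chart_inv c)};
  transition_smooth : forall c d (j : 'I_n),
    smooth_on (chart c @` (dom c `&` dom d))
              (fun x => chart d (chart_inv c x) 0 j)
}.

Section Manifold.
Variables (R : realType) (n : nat) (M : smooth_manifold R n).

Definition closed_manifold : Prop := compact [set: M].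

Definition chart_image (c : chart_index M) : set 'rV[R]_n := chart c @` dom c.

Definition transition (c d : chart_index M) (x : 'rV[R]_n) : 'rV[R]_n :=
  chart d (chart_inv c x).

Definition smooth_function (f : M -> R) : Prop :=
  forall c, smooth_on (chart_image c) (fun x => f (chart_inv c x)).

(* A smooth symmetric positive definite covariant 2-tensor field, given by its
   components: metric_coef g c x is the matrix of g(d/dx_i, d/dx_j), at the
   point with coordinates x, in the coordinate frame of the chart c. *)
Record riemannian_metric := RiemannianMetric {
  metric_coef : chart_index M -> 'rV[R]_n -> 'M[R]_n;
  metric_smooth : forall c i j,
    smooth_on (chart_image c) (fun x => metric_coef c x i j);
  metric_sym : forall c x, chart_image c x ->
    (metric_coef c x)^T = metric_coef c x;
  metric_posdef : forall c x, chart_image c x ->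
    forall v : 'rV[R]_n, v != 0 -> 0 < (v *m metric_coef c x *m v^T) 0 0;
  metric_change : forall c d x, (chart c @` (dom c `&` dom d)) x ->
    metric_coef c x = jac (transition c d) x
      *m metric_coef d (transition c d x) *m (jac (transition c d) x)^T
}.

End Manifold.

(* In this section G is the matrix of the metric in a chart, and vector fields
   are given by their components in the coordinate frame. *)
Section LocalCurvature.
Variables (R : realType) (n : nat) (G : 'rV[R]_n -> 'M[R]_n).
Implicit Types (X Y Z : 'rV[R]_n -> 'rV[R]_n) (x : 'rV[R]_n).

(* Gamma^k_ij of the Levi-Civita connection *)
Definition christoffel (k i j : 'I_n) x : R :=
  2^-1 * \sum_l invmx (G x) k l *
    (partial i (fun y => G y j l) x + partial j (fun y => G y i l) x
     - partial l (fun y => G y i j) x).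

Definition nabla X Y : 'rV[R]_n -> 'rV[R]_n := fun x =>
  \row_k (\sum_i X x 0 i * partial i (fun y => Y y 0 k) x
          + \sum_i \sum_j christoffel k i j x * X x 0 i * Y x 0 j).

Definition lie_bracket X Y : 'rV[R]_n -> 'rV[R]_n := fun x =>
  \row_k (\sum_i (X x 0 i * partial i (fun y => Y y 0 k) x
                  - Y x 0 i * partial i (fun y => X y 0 k) x)).

Definition riemann X Y Z : 'rV[R]_n -> 'rV[R]_n := fun x =>
  nabla X (nabla Y Z) x - nabla Y (nabla X Z) x
  - nabla (lie_bracket X Y) Z x.

Definition coord_field (i : 'I_n) : 'rV[R]_n -> 'rV[R]_n :=
  fun=> basis_vector R i.

(* Ric(Y, Z) is the trace of X |-> R(X, Y)Z, so that the unit n-sphere has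
   Ric = (n - 1) g. *)
Definition ricci x : 'M[R]_n :=
  \matrix_(j, k)
    \sum_i riemann (coord_field i) (coord_field j) (coord_field k) x 0 i.

(* The matrix, acting on row vectors, of the endomorphism associated to Ric:
   g(X *m ricci_endo, Y) = Ric(X, Y) reads ricci_endo x *m G x = ricci x. *)
Definition ricci_endo x : 'M[R]_n := ricci x *m invmx (G x).

End LocalCurvature.

(* s lists the eigenvalues, with multiplicity, of the Ricci endomorphism of the
   tangent space at p.  Its matrices in the various charts around p are
   similar, so they all have the same characteristic polynomial. *)
Definition principal_ricci_curvatures (R : realType) (n : nat)
    (M : smooth_manifold R n) (g : riemannian_metric M) (p : M) (s : seq R) :=
  forall c, dom c p ->
    char_poly (ricci_endo (metric_coef g c) (chart c p))
    = \prod_(l <- s) ('X - l%:P).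

(* Main.v *)
(* Let T be a local unit eigenvector for the eigenvalue - mu and w = 1 / (f + mu).
   The contracted Bianchi identity makes T geodesic and, with the Riccati equation,
   gives TTT w = 2 mu T w, so that TT (T w)^2 >= 4 mu (T w)^2; at a maximum point of
   (T w)^2 the left-hand side is nonpositive, hence T w = 0 everywhere.  Then every
   T-invariant global function rho satisfies TT |d rho|^2 >= mu |d rho|^2, so it is
   constant by the same argument.  Apply this to rho = |nabla (T (x) T)|^2, which is
   an affine function of the squared twist of the plane field orthogonal to T: the
   twist is constant, and the Codazzi equations then force f = 0.

   T is determined up to sign only, so the functions used are built from T (x) T,
   and no orientability is needed. *)
Require Import Defs.
From HB Require Import structures.
From mathcomp Require Import all_boot all_order all_algebra.
From mathcomp Require Import all_classical all_reals all_analysis.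
From mathcomp Require Import ring lra.
Set Implicit Arguments.
Unset Strict Implicit.
Unset Printing Implicit Defensive.
Import Order.TTheory GRing.Theory Num.Theory.
Import numFieldNormedType.Exports.
Local Open Scope classical_set_scope.
Local Open Scope ring_scope.

(** * Metric connections over a differential ring *)

(** Local geometry is computed in a commutative ring with commuting derivations, later the smooth
    functions on an open subset of R^3, so that tensor identities reduce to [ring]. T w = w div T
    says that w scales like area transverse to T, that is, like the determinant of a 2 by 2 Jacobi
    tensor J along T. In dimension three Ric determines the curvature, and the double eigenvalue
    gives all planes containing T the sectional curvature - mu / 2. Hence J'' = (mu / 2) J, and det
    J combines 1 and exp (+- sqrt (2 mu) t): this is the source of w''' = 2 mu w'. Once T w = 0, the
    shape operator A of T satisfies A^2 = mu / 2, and the differential v of a T-invariant function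
    obeys v'' = (mu / 2) v in a frame parallel along T; this gives the second inequality. The
    obstacle is that adapted frames exist only locally, up to rotations and signs, while the maximum
    principle needs functions on M. These are written in coordinates through T (x) T and compared on
    overlaps by transporting a frame. *)

Section DifferentialRing.
Variables (A : comPzRingType) (n : nat) (d : 'I_n -> {additive A -> A}).
Hypothesis dM : forall i a b, d i (a * b) = d i a * b + a * d i b.
Hypothesis dC : forall i j a, d i (d j a) = d j (d i a).

Lemma derivation1 i : d i 1 = 0.
Proof.
have := dM i 1 1; rewrite !mulr1 mul1r => /eqP.
by rewrite addrC -subr_eq subrr eq_sym => /eqP.
Qed.

Lemma derivation_nat i k : d i k%:R = 0.
Proof. by rewrite raddfMn derivation1 mul0rn. Qed.

Definition mx_partial p q i (M : 'M[A]_(p, q)) : 'M[A]_(p, q) := map_mx (d i) M.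

Lemma mx_partialM p q r i (M : 'M[A]_(p, q)) (N : 'M[A]_(q, r)) :
  mx_partial i (M *m N) = mx_partial i M *m N + M *m mx_partial i N.
Proof.
apply/matrixP => j k; rewrite !mxE raddf_sum -big_split /=.
by apply: eq_bigr => l _; rewrite dM !mxE.
Qed.

Lemma mx_partialD p q i (M N : 'M[A]_(p, q)) :
  mx_partial i (M + N) = mx_partial i M + mx_partial i N.
Proof. exact: map_mxD. Qed.

Lemma mx_partialC p q i j (M : 'M[A]_(p, q)) :
  mx_partial i (mx_partial j M) = mx_partial j (mx_partial i M).
Proof. by apply/matrixP => k l; rewrite !mxE. Qed.

Lemma mx_partial1 i : mx_partial i (1%:M : 'M[A]_n) = 0.
Proof. by apply/matrixP => j k; rewrite !mxE derivation_nat. Qed.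

Lemma mx_partial_tr p q i (M : 'M[A]_(p, q)) : mx_partial i M^T = (mx_partial i M)^T.
Proof. by rewrite /mx_partial map_trmx. Qed.

(* [G i] is the matrix of the connection along the i-th coordinate field, acting
   on row vectors: nabla_i Z = d_i Z + Z *m G i. *)
Definition curvature (G : 'I_n -> 'M[A]_n) i j : 'M[A]_n :=
  mx_partial i (G j) - mx_partial j (G i) + G j *m G i - G i *m G j.

Definition ricci_of (G : 'I_n -> 'M[A]_n) : 'M[A]_n :=
  \matrix_(j, k) \sum_i curvature G i j k i.

(** Here [w] is the same connection read in the frame [E]. The second derivatives of [E] drop out
    because the [d i] commute and the first derivatives cancel, so curvature is a tensor. *)
Lemma curvature_gauge (E : 'M[A]_n) (G w : 'I_n -> 'M[A]_n) :
  (forall i, w i *m E = mx_partial i E + E *m G i) ->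
  forall i j, curvature w i j *m E = E *m curvature G i j.
Proof.
move=> wE i j; rewrite /curvature.
have H k l : mx_partial k (w l) *m E = mx_partial k (mx_partial l E)
    + mx_partial k E *m G l + E *m mx_partial k (G l)
    - w l *m mx_partial k E.
  have := congr1 (mx_partial k) (wE l); rewrite mx_partialD !mx_partialM => e.
  by apply/eqP; rewrite -subr_eq opprK e addrA.
have K k l : w l *m w k *m E = w l *m mx_partial k E + mx_partial l E *m G k + E *m G l *m G k.
  by rewrite -mulmxA wE mulmxDr !mulmxA wE mulmxDl addrA.
rewrite !(mulmxDl, mulNmx) !H !K !(mulmxDr, mulmxN, mulmxA) (mx_partialC j i).
apply/matrixP => k l; rewrite !mxE; ring.
Qed.

Section Metric.
Variables (G Gi : 'M[A]_n) (half : A).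
Hypothesis Gsym : G^T = G.
Hypothesis GiG : Gi *m G = 1%:M.
Hypothesis half2 : half + half = 1.

Definition christoffel_mx i : 'M[A]_n := \matrix_(j, k)
  (half * \sum_l Gi k l * (d i (G j l) + d j (G i l) - d l (G i j))).

Let GS i j : G i j = G j i. Proof. by rewrite -{1}Gsym mxE. Qed.

Lemma GiS i j : Gi i j = Gi j i.
Proof.
have GGi : G *m Gi = 1%:M by exact: mulmx1C.
suff e : Gi^T = Gi by rewrite -{1}e mxE.
rewrite -[LHS]mulmx1 -GGi mulmxA -{1}Gsym -trmx_mul GGi.
by rewrite trmx1 mul1mx.
Qed.

Lemma christoffel_torsion_free i j k : christoffel_mx i j k = christoffel_mx j i k.
Proof.
rewrite !mxE; congr (_ * _); apply: eq_bigr => l _; congr (_ * _).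
by rewrite (GS i j) [d i _ + _]addrC.
Qed.

(** Lowering the upper index with [G] turns the symbol into half the Koszul sum; adding the
    transpose cancels four of the six derivatives and doubles the remaining one. *)
Lemma christoffel_metric i :
  mx_partial i G = christoffel_mx i *m G + G *m (christoffel_mx i)^T.
Proof.
have L j m : (christoffel_mx i *m G) j m
    = half * (d i (G j m) + d j (G i m) - d m (G i j)).
  rewrite mxE; under eq_bigr do rewrite mxE -mulrA mulr_suml.
  rewrite -mulr_sumr exchange_big /=; congr (_ * _).
  under eq_bigr => l _ do under eq_bigr => k _ do rewrite mulrAC [_ * G _ _]mulrC GiS.
  under eq_bigr => l _.
    under eq_bigr => k _ do rewrite (mulrC (G k m)).
    rewrite -mulr_suml.
    have -> : \sum_k Gi l k * G k m = (1%:M : 'M[A]_n) l m by rewrite -GiG mxE.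
    over.
  rewrite (bigD1 m)//= big1 ?addr0; first by rewrite mxE eqxx mul1r.
  by move=> l lm; rewrite mxE (negbTE lm) mul0r.
have -> : G *m (christoffel_mx i)^T = (christoffel_mx i *m G)^T by rewrite trmx_mul Gsym.
apply/matrixP => j m; rewrite mxE (mxE _ _ j m) [X in _ + X]mxE !L (GS m j).
rewrite -[LHS]mul1r -half2; ring.
Qed.

End Metric.

(** * Orthonormal frames and Cartan's structure equations *)

Section Frame.
Variables (G : 'M[A]_n) (C : 'I_n -> 'M[A]_n) (E : 'M[A]_n).
Hypothesis C_sym : forall i j k, C i j k = C j i k.
Hypothesis C_metric : forall i, mx_partial i G = C i *m G + G *m (C i)^T.
Hypothesis EGE : E *m G *m E^T = 1%:M.

Let Ei := G *m E^T.
Let EiE : Ei *m E = 1%:M. Proof. by apply: mulmx1C; rewrite mulmxA. Qed.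

(** The rows of [E] are an orthonormal frame, and nabla_i E_b is the sum over c of
    [connection_form i b c] E_c: the first index is a coordinate index, the other two are frame
    indices. [frame_connection] converts the first one as well. *)
Definition connection_form i : 'M[A]_n := (mx_partial i E + E *m C i) *m Ei.

Lemma connection_formE i : connection_form i *m E = mx_partial i E + E *m C i.
Proof. by rewrite -mulmxA EiE mulmx1. Qed.

Lemma connection_form_skew i : (connection_form i)^T = - connection_form i.
Proof.
move: (connection_form i) (connection_formE i) => w wE.
have e : mx_partial i (E *m G *m E^T) = 0 by rewrite EGE mx_partial1.
apply/eqP; rewrite -addr_eq0 addrC -e !mx_partialM mx_partial_tr C_metric.
have dE : mx_partial i E = w *m E - E *m C i by rewrite wE addrK.
rewrite dE linearB /= !trmx_mul !(mulmxBl, mulmxBr, mulmxDl, mulmxDr) !mulmxA.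
have -> : w *m E *m G *m E^T = w by rewrite -!mulmxA (mulmxA E) EGE mulmx1.
rewrite EGE mul1mx.
by rewrite !mulNmx (addrA (w - _)) subrK addrACA subrr addr0.
Qed.

Definition frame_partial a (h : A) : A := \sum_i E a i * d i h.

Let frame_partial_zmod a : zmod_morphism (frame_partial a).
Proof.
move=> f g; rewrite /frame_partial -sumrB; apply: eq_bigr => i _.
by rewrite raddfB mulrBr.
Qed.
HB.instance Definition _ a := GRing.isZmodMorphism.Build A A (frame_partial a)
  (frame_partial_zmod a).

Lemma frame_partialM a f g :
  frame_partial a (f * g) = frame_partial a f * g + f * frame_partial a g.
Proof.
rewrite /frame_partial mulr_suml mulr_sumr -big_split /=; apply: eq_bigr => i _.
by rewrite dM; ring.
Qed.

Definition frame_connection a : 'M[A]_n := \sum_i E a i *: connection_form i.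

Lemma frame_connection_skew a b c : frame_connection a b c = - frame_connection a c b.
Proof.
have : (frame_connection a)^T = - frame_connection a.
  rewrite /frame_connection linear_sum /= -sumrN; apply: eq_bigr => i _.
  by rewrite linearZ /= connection_form_skew scalerN.
by move/matrixP/(_ c b); rewrite !mxE.
Qed.

(** Since the connection is torsion-free, these are the structure coefficients of the frame:
    [E_a, E_b] is the sum over c of [frame_torsion a b c] E_c. *)
Definition frame_torsion a b c := frame_connection a b c - frame_connection b a c.

Lemma frame_connectionE a b i : (frame_connection a *m E) b i
  = frame_partial a (E b i) + \sum_j \sum_k E a j * E b k * C j k i.
Proof.
rewrite /frame_connection mulmx_suml summxE /frame_partial -big_split /=.
apply: eq_bigr => j _; rewrite -scalemxAl connection_formE !mxE mulrDr mulr_sumr.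
by congr (_ + _); apply: eq_bigr => k _; rewrite mulrA.
Qed.

Lemma frame_torsionE a b i : \sum_c frame_torsion a b c * E c i
  = frame_partial a (E b i) - frame_partial b (E a i).
Proof.
have -> : \sum_c frame_torsion a b c * E c i
    = (frame_connection a *m E) b i - (frame_connection b *m E) a i.
  rewrite !mxE -sumrB; apply: eq_bigr => c _; rewrite /frame_torsion mulrBl.
  by [].
rewrite !frame_connectionE exchange_big /=.
have -> : \sum_j \sum_k E b j * E a k * C j k i = \sum_j \sum_k E a k * E b j * C k j i.
  by apply: eq_bigr => j _; apply: eq_bigr => k _; rewrite (C_sym j) [E b j * _]mulrC.
by rewrite opprD addrACA subrr addr0.
Qed.

Lemma frame_bracket a b h : frame_partial a (frame_partial b h)
  - frame_partial b (frame_partial a h) = \sum_c frame_torsion a b c * frame_partial c h.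
Proof.
have L a' b' : frame_partial a' (frame_partial b' h) =
    \sum_i frame_partial a' (E b' i) * d i h
    + \sum_i \sum_j E a' i * E b' j * d i (d j h).
  rewrite [in LHS](_ : frame_partial b' h = \sum_i E b' i * d i h)// raddf_sum /=.
  under eq_bigr do rewrite frame_partialM.
  rewrite big_split /= exchange_big /=; congr (_ + _); apply: eq_bigr => i _.
  by rewrite mulr_sumr; apply: eq_bigr => j _; rewrite mulrCA mulrA.
rewrite !L [X in _ - (_ + X)]exchange_big /=.
have -> : \sum_j \sum_i E b i * E a j * d i (d j h) = \sum_i \sum_j E a i * E b j * d i (d j h).
  apply: eq_bigr => i _; apply: eq_bigr => j _.
  by rewrite dC [E b j * _]mulrC.
rewrite opprD addrACA subrr addr0 -sumrB.
under [RHS]eq_bigr do rewrite /frame_partial mulr_sumr.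
rewrite exchange_big /=; apply: eq_bigr => i _.
by rewrite -mulrBl -frame_torsionE mulr_suml; apply: eq_bigr => c _; rewrite mulrA.
Qed.

(** Cartan's second structure equation, with matrices acting on rows. The last sum is the
    contribution of nabla_[E_a, E_b], absent for coordinate fields. *)
Definition frame_curvature a b : 'M[A]_n :=
  map_mx (frame_partial a) (frame_connection b)
  - map_mx (frame_partial b) (frame_connection a)
  + frame_connection b *m frame_connection a
  - frame_connection a *m frame_connection b
  - \sum_c frame_torsion a b c *: frame_connection c.

Lemma frame_curvatureE a b :
  frame_curvature a b = \sum_i \sum_j (E a i * E b j) *: curvature connection_form i j.
Proof.
rewrite /frame_curvature; set w := connection_form.
have L a' b' : map_mx (frame_partial a') (frame_connection b') =
    \sum_j frame_partial a' (E b' j) *: w j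
    + \sum_i \sum_j (E a' i * E b' j) *: mx_partial i (w j).
  rewrite exchange_big -big_split /=; apply/matrixP => k l; rewrite mxE.
  rewrite /frame_connection summxE raddf_sum summxE; apply: eq_bigr => j _.
  rewrite !mxE /= frame_partialM summxE; congr (_ + _).
  by rewrite mulr_sumr; apply: eq_bigr => i _; rewrite !mxE mulrCA mulrA.
have M a' b' : frame_connection b' *m frame_connection a' =
    \sum_i \sum_j (E a' i * E b' j) *: (w j *m w i).
  rewrite exchange_big /= /frame_connection mulmx_suml; apply: eq_bigr => j _.
  rewrite mulmx_sumr; apply: eq_bigr => i _.
  by rewrite -scalemxAl -scalemxAr scalerA [E b' j * _]mulrC.
have T : \sum_c frame_torsion a b c *: frame_connection c =
    \sum_j frame_partial a (E b j) *: w j - \sum_j frame_partial b (E a j) *: w j.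
  under eq_bigr do rewrite /frame_connection scaler_sumr.
  rewrite exchange_big -sumrB /=; apply: eq_bigr => j _.
  rewrite -scalerBl -frame_torsionE scaler_suml.
  by apply: eq_bigr => c _; rewrite scalerA.
rewrite !L T (M a b).
have -> : frame_connection a *m frame_connection b =
    \sum_i \sum_j (E a i * E b j) *: (w i *m w j).
  by rewrite M exchange_big; apply: eq_bigr => i _; apply: eq_bigr => j _; rewrite mulrC.
have -> : \sum_i \sum_j (E b i * E a j) *: mx_partial i (w j) =
    \sum_i \sum_j (E a i * E b j) *: mx_partial j (w i).
  by rewrite exchange_big; apply: eq_bigr => i _; apply: eq_bigr => j _; rewrite mulrC.
under [RHS]eq_bigr do (under eq_bigr do rewrite /curvature !(scalerBr, scalerDr);
  rewrite sumrB big_split /= sumrB).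
rewrite sumrB big_split /= sumrB.
move: (\sum_j _ *: w j) (\sum_j _ *: w j) => X Y.
move: (\sum_i _) (\sum_i _) (\sum_i _) (\sum_i _) => x y z t.
apply/matrixP => k l; rewrite !mxE; ring.
Qed.

(** The trace in Ric pairs the first index of the curvature with the last one, which is dual to it,
    so it can be taken in any frame. *)
Lemma frame_ricci b c :
  (E *m ricci_of C *m E^T) b c = \sum_a frame_curvature a b c a.
Proof.
transitivity (\sum_i \sum_j E b j * (E *m curvature C i j) c i).
  rewrite !mxE; under eq_bigr do rewrite !mxE mulr_suml.
  under [RHS]eq_bigr do under eq_bigr do rewrite mxE mulr_sumr.
  rewrite exchange_big [RHS]exchange_big /=; apply: eq_bigr => j _.
  rewrite [RHS]exchange_big /=; apply: eq_bigr => k _.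
  rewrite !mxE mulr_sumr mulr_suml; apply: eq_bigr => i _.
  by rewrite -mulrA [_ * E c k]mulrC.
under [RHS]eq_bigr do rewrite frame_curvatureE summxE.
rewrite [RHS]exchange_big /=; apply: eq_bigr => i _.
under [RHS]eq_bigr do rewrite summxE.
rewrite [RHS]exchange_big /=; apply: eq_bigr => j _.
rewrite -(curvature_gauge connection_formE) mxE mulr_sumr; apply: eq_bigr => a _.
by rewrite [RHS]mxE; ring.
Qed.

End Frame.
End DifferentialRing.

Section CurvatureSymmetries.
Variables (A : comPzRingType) (n : nat) (d : 'I_n -> {additive A -> A}).
Hypothesis dM : forall i a b, d i (a * b) = d i a * b + a * d i b.
Hypothesis dC : forall i j a, d i (d j a) = d j (d i a).
Variable half : A.
Hypothesis half2 : half + half = 1.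

Lemma opp_eq_self_eq0 (x : A) : x = - x -> x = 0.
Proof.
move=> e; rewrite -[x]mul1r -half2 mulrDl {2}e; ring.
Qed.

Variables (G : 'M[A]_n) (C : 'I_n -> 'M[A]_n) (E : 'M[A]_n).
Hypothesis C_sym : forall i j k, C i j k = C j i k.
Hypothesis C_metric : forall i, mx_partial d i G = C i *m G + G *m (C i)^T.
Hypothesis EGE : E *m G *m E^T = 1%:M.

Let w := connection_form d G C E.

Lemma curvatureE (V : 'I_n -> 'M[A]_n) i j k l : curvature d V i j k l =
  d i (V j k l) - d j (V i k l) + \sum_m V j k m * V i m l - \sum_m V i k m * V j m l.
Proof. by rewrite !mxE. Qed.

Lemma curvature_antisym (V : 'I_n -> 'M[A]_n) i j : curvature d V i j = - curvature d V j i.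
Proof. by apply/matrixP => k l; rewrite [RHS]mxE !curvatureE; ring. Qed.

Lemma curvature_skew (V : 'I_n -> 'M[A]_n) i j : (forall k, (V k)^T = - V k) ->
  (curvature d V i j)^T = - curvature d V i j.
Proof.
move=> VT; have VE k a b : V k a b = - V k b a.
  by have /matrixP/(_ b a) := VT k; rewrite !mxE.
apply/matrixP => a b; rewrite [LHS]mxE [RHS]mxE !curvatureE.
rewrite (VE j b a) (VE i b a) (raddfN (d i)) (raddfN (d j)).
have S k l : \sum_m V k b m * V l m a = \sum_m V l a m * V k m b.
  by apply: eq_bigr => m _; rewrite (VE k b m) (VE l m a) mulrNN mulrC.
by rewrite !S; ring.
Qed.

Let wT k : (w k)^T = - w k. Proof. exact: connection_form_skew. Qed.

Lemma frame_curvature_skew a b c e :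
  frame_curvature d G C E a b c e = - frame_curvature d G C E a b e c.
Proof.
rewrite !(frame_curvatureE dM)// !summxE -sumrN; apply: eq_bigr => i _.
rewrite !summxE -sumrN; apply: eq_bigr => j _.
rewrite !mxE -mulrN; congr (_ * _).
by have /matrixP/(_ e c) := curvature_skew i j wT; rewrite !mxE.
Qed.

Lemma frame_curvature_antisym a b c e :
  frame_curvature d G C E a b c e = - frame_curvature d G C E b a c e.
Proof.
rewrite !(frame_curvatureE dM)// !summxE.
under eq_bigr do rewrite summxE; under [X in _ = - X]eq_bigr do rewrite summxE.
rewrite exchange_big -sumrN; apply: eq_bigr => i _; rewrite -sumrN; apply: eq_bigr => j _.
rewrite [LHS]mxE [X in _ = - X]mxE (curvature_antisym _ j i) [X in _ * X]mxE; ring.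
Qed.

(** The first Bianchi identity, traced, makes the antisymmetric part of Ric the trace of a curvature
    matrix, and in an orthonormal frame that matrix becomes skew. *)
Lemma ricci_of_sym : (ricci_of d C)^T = ricci_of d C.
Proof.
have EEi : E *m (G *m E^T) = 1%:M by rewrite mulmxA.
have EiE : (G *m E^T) *m E = 1%:M by exact: mulmx1C.
have tr0 i j : \tr (curvature d C i j) = 0.
  have := curvature_gauge dM dC (connection_formE d C EGE) i j => e.
  rewrite -[curvature d C i j]mul1mx -EiE -mulmxA -e mxtrace_mulC -mulmxA EEi mulmx1.
  apply: opp_eq_self_eq0; rewrite -{1}mxtrace_tr.
  by rewrite (curvature_skew i j wT) raddfN.
have bianchi i j k l :
    curvature d C i j k l + curvature d C j k i l + curvature d C k i j l = 0.
  have S a b e : \sum_m C a b m * C e m l = \sum_m C b a m * C e m l.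
    by apply: eq_bigr => m _; rewrite C_sym.
  rewrite !curvatureE (C_sym j i) (C_sym k i) (C_sym k j) (S k i) (S j i) (S k j).
  ring.
apply/matrixP => j k; rewrite mxE [LHS]mxE [RHS]mxE; apply/eqP; rewrite -subr_eq0 -sumrB.
apply/eqP/(etrans _ (tr0 j k)); apply: eq_bigr => i _.
have := bianchi i j k i; rewrite (curvature_antisym C k i) [X in _ + X = _]mxE => e.
by rewrite -[LHS]addr0 -[X in _ + X]e; ring.
Qed.

End CurvatureSymmetries.

(** * Contravariant 2-tensors and their covariant derivatives *)

Section Tensors.
Variables (A : comPzRingType) (n : nat) (d : 'I_n -> {additive A -> A}).
Hypothesis dM : forall i a b, d i (a * b) = d i a * b + a * d i b.

Definition gradient_form (Q : 'M[A]_n) (h : A) : A :=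
  \sum_i \sum_j Q i j * d i h * d j h.

(** The tensor [Q] is contravariant and [C i j k] stands for Gamma^k_ij. For symmetric [Q],
    [covariant_energy] is then |nabla Q|^2. *)
Definition covariant_derivative (C : 'I_n -> 'M[A]_n) (Q : 'M[A]_n) i : 'M[A]_n :=
  mx_partial d i Q + (C i)^T *m Q + Q *m C i.

Definition covariant_energy (C : 'I_n -> 'M[A]_n) (G Gi Q : 'M[A]_n) : A :=
  \sum_i \sum_j Gi i j *
    \tr (G *m covariant_derivative C Q i *m G *m covariant_derivative C Q j).

Lemma gradient_form_frame (E M : 'M[A]_n) h : gradient_form (E^T *m M *m E) h =
  \sum_a \sum_b M a b * frame_partial d E a h * frame_partial d E b h.
Proof.
transitivity (\sum_i \sum_j \sum_a \sum_b E a i * M a b * E b j * d i h * d j h).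
  apply: eq_bigr => i _; apply: eq_bigr => j _; rewrite mxE exchange_big !mulr_suml /=.
  apply: eq_bigr => b _; rewrite mxE !mulr_suml; apply: eq_bigr => a _.
  by rewrite mxE.
transitivity (\sum_a \sum_b \sum_i \sum_j E a i * M a b * E b j * d i h * d j h).
  under eq_bigr do rewrite exchange_big /=.
  rewrite exchange_big /=; apply: eq_bigr => a _.
  under eq_bigr do rewrite exchange_big /=.
  by rewrite exchange_big.
apply: eq_bigr => a _; apply: eq_bigr => b _.
rewrite /frame_partial -mulrA big_distrlr /= mulr_sumr; apply: eq_bigr => i _.
by rewrite mulr_sumr; apply: eq_bigr => j _; ring.
Qed.

Section FrameTensors.
Variables (G Gi : 'M[A]_n) (C : 'I_n -> 'M[A]_n) (E : 'M[A]_n).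
Hypothesis C_metric : forall i, mx_partial d i G = C i *m G + G *m (C i)^T.
Hypothesis EGE : E *m G *m E^T = 1%:M.
Hypothesis GiG : Gi *m G = 1%:M.

Lemma inverse_metric_frame : Gi = E^T *m E.
Proof.
have EiE : G *m E^T *m E = 1%:M by apply: mulmx1C; rewrite mulmxA.
by rewrite -[LHS]mulmx1 -EiE !mulmxA GiG mul1mx.
Qed.

Variable P : 'M[A]_n.
Hypothesis dP : forall i, mx_partial d i P = 0.

Let w := connection_form d G C E.

(** The frame components [P] are constant, so only the connection contributes, through a
    commutator. *)
Lemma covariant_derivative_frame i : covariant_derivative C (E^T *m P *m E) i =
  E^T *m (P *m w i - w i *m P) *m E.
Proof.
have wT : (w i)^T = - w i by exact: connection_form_skew.
have dE : mx_partial d i E = w i *m E - E *m C i.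
  by rewrite /w (connection_formE d C EGE) addrK.
move: (w i) wT dE => wi wT dE.
rewrite /covariant_derivative !(mx_partialM dM) mx_partial_tr dE dP mulmx0 addr0.
rewrite [(_ - _)^T]linearB /= !trmx_mul wT !(mulmxBl, mulmxBr, mulmxN, mulNmx, mulmxDl, mulmxDr, mulmxA).
move: (E^T *m w i *m P *m E) ((C i)^T *m _ *m _ *m _) (E^T *m P *m w i *m E) (_ *m C i).
move=> X Y Z T; apply/matrixP => k l; rewrite !mxE; ring.
Qed.

Lemma covariant_energy_frame : let B := frame_connection d G C E in
  covariant_energy C G Gi (E^T *m P *m E) =
  \sum_a \tr ((P *m B a - B a *m P) *m (P *m B a - B a *m P)).
Proof.
move=> B; pose k i := P *m w i - w i *m P.
have KB a : P *m B a - B a *m P = \sum_i E a i *: k i.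
  rewrite /B /frame_connection mulmx_sumr mulmx_suml -sumrB; apply: eq_bigr => i _.
  by rewrite -scalemxAl -scalemxAr -scalerBr.
rewrite /covariant_energy inverse_metric_frame.
have tk i j : \tr (G *m covariant_derivative C (E^T *m P *m E) i *m G
    *m covariant_derivative C (E^T *m P *m E) j) = \tr (k i *m k j).
  rewrite !covariant_derivative_frame -!/(k _) mxtrace_mulC.
  have -> : E^T *m k j *m E *m (G *m (E^T *m k i *m E) *m G)
      = E^T *m k j *m (E *m G *m E^T) *m k i *m E *m G by rewrite !mulmxA.
  rewrite EGE mulmx1 -!mulmxA mxtrace_mulC !mulmxA.
  have -> : k j *m k i *m E *m G *m E^T = k j *m k i *m (E *m G *m E^T) by rewrite !mulmxA.
  by rewrite EGE mulmx1 mxtrace_mulC.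
under eq_bigr do under eq_bigr do rewrite tk mxE mulr_suml.
under [RHS]eq_bigr => a _.
  rewrite KB mulmx_suml raddf_sum /=.
  under eq_bigr => i _ do rewrite mulmx_sumr raddf_sum /=.
  over.
rewrite [RHS]exchange_big /=; apply: eq_bigr => i _.
rewrite [RHS]exchange_big /=; apply: eq_bigr => j _; apply: eq_bigr => a _.
by rewrite mxE -scalemxAl -scalemxAr !mxtraceZ mulrA.
Qed.

End FrameTensors.
End Tensors.

Section Naturality.
Variables (A B : comPzRingType) (n : nat).
Variables (dA : 'I_n -> {additive A -> A}) (dB : 'I_n -> {additive B -> B}).
Variable phi : {rmorphism B -> A}.
Hypothesis phi_d : forall i b, dA i (phi b) = phi (dB i b).

Lemma map_mx_partial p q i (M : 'M[B]_(p, q)) :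
  map_mx phi (mx_partial dB i M) = mx_partial dA i (map_mx phi M).
Proof. by apply/matrixP => j k; rewrite !mxE phi_d. Qed.

Lemma map_curvature (C : 'I_n -> 'M[B]_n) i j :
  map_mx phi (curvature dB C i j) = curvature dA (fun i => map_mx phi (C i)) i j.
Proof. by rewrite /curvature !(map_mxB, map_mxD, map_mxM) !map_mx_partial. Qed.

Lemma map_ricci_of (C : 'I_n -> 'M[B]_n) :
  map_mx phi (ricci_of dB C) = ricci_of dA (fun i => map_mx phi (C i)).
Proof.
apply/matrixP => j k; rewrite mxE [X in phi X]mxE [RHS]mxE rmorph_sum.
by apply: eq_bigr => i _; rewrite -map_curvature [RHS]mxE.
Qed.

Lemma map_gradient_form Q h :
  phi (gradient_form dB Q h) = gradient_form dA (map_mx phi Q) (phi h).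
Proof.
rewrite /gradient_form rmorph_sum; apply: eq_bigr => i _; rewrite rmorph_sum.
by apply: eq_bigr => j _; rewrite !rmorphM !mxE -!phi_d.
Qed.

Lemma map_covariant_energy C G Gi Q : phi (covariant_energy dB C G Gi Q) =
  covariant_energy dA (fun i => map_mx phi (C i)) (map_mx phi G) (map_mx phi Gi) (map_mx phi Q).
Proof.
have H i : map_mx phi (covariant_derivative dB C Q i) =
    covariant_derivative dA (fun i => map_mx phi (C i)) (map_mx phi Q) i.
  by rewrite /covariant_derivative !(map_mxD, map_mxM) map_mx_partial map_trmx.
rewrite /covariant_energy rmorph_sum; apply: eq_bigr => i _; rewrite rmorph_sum.
apply: eq_bigr => j _; rewrite rmorphM mxE; congr (_ * _).
by rewrite -trace_map_mx !map_mxM !H.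
Qed.

End Naturality.

(** * Transport of frames between coordinate systems *)

Section Push.
Variables (A B : comPzRingType) (n : nat).
Variables (dA : 'I_n -> {additive A -> A}) (dB : 'I_n -> {additive B -> B}).
Hypothesis dAM : forall i a b, dA i (a * b) = dA i a * b + a * dA i b.
Hypothesis dBM : forall i a b, dB i (a * b) = dB i a * b + a * dB i b.
Hypothesis dAC : forall i j a, dA i (dA j a) = dA j (dA i a).
Hypothesis dBC : forall i j a, dB i (dB j a) = dB j (dB i a).
Variable half : A.
Hypothesis half2 : half + half = 1.
Variable phi : {rmorphism B -> A}.
Variables (J Ji : 'M[A]_n).
Hypothesis phi_d : forall i b, dA i (phi b) = \sum_j J i j * phi (dB j b).
Hypothesis J_closed : forall i j k, dA i (J j k) = dA j (J i k).
Hypothesis JiJ : Ji *m J = 1%:M.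

Variables (GA : 'M[A]_n) (CA : 'I_n -> 'M[A]_n).
Hypothesis CA_sym : forall i j k, CA i j k = CA j i k.
Hypothesis CA_metric : forall i, mx_partial dA i GA = CA i *m GA + GA *m (CA i)^T.
Variables (GB : 'M[B]_n) (CB : 'I_n -> 'M[B]_n) (EB : 'M[B]_n).
Hypothesis CB_sym : forall i j k, CB i j k = CB j i k.
Hypothesis CB_metric : forall i, mx_partial dB i GB = CB i *m GB + GB *m (CB i)^T.
Hypothesis EBGE : EB *m GB *m EB^T = 1%:M.
Hypothesis G_change : GA = J *m map_mx phi GB *m J^T.

Definition push_frame := map_mx phi EB *m Ji.
Let EA := push_frame.

Lemma push_frameJ : EA *m J = map_mx phi EB.
Proof. by rewrite -mulmxA JiJ mulmx1. Qed.

Lemma push_frame_orthonormal : EA *m GA *m EA^T = 1%:M.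
Proof.
rewrite G_change.
have -> : EA *m (J *m map_mx phi GB *m J^T) *m EA^T
   = (EA *m J) *m map_mx phi GB *m (EA *m J)^T by rewrite (trmx_mul EA J) !mulmxA.
by rewrite push_frameJ map_trmx -!map_mxM EBGE map_scalar_mx rmorph1.
Qed.

Lemma push_frame_partial a b :
  frame_partial dA EA a (phi b) = phi (frame_partial dB EB a b).
Proof.
rewrite /frame_partial rmorph_sum.
under eq_bigr do rewrite phi_d mulr_sumr.
rewrite exchange_big /=; apply: eq_bigr => j _; rewrite rmorphM.
have /matrixP/(_ a j) := push_frameJ; rewrite mxE [RHS]mxE => <-.
by rewrite mulr_suml; apply: eq_bigr => i _; rewrite mulrA.
Qed.

Let TA := frame_torsion dA GA CA EA.
Let TB := frame_torsion dB GB CB EB.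

(** The structure coefficients are determined by the brackets of the frame fields. Passing to the
    other coordinates brings in derivatives of [J], which cancel because [J_closed] makes them
    symmetric. *)
Lemma push_frame_torsion a b c : TA a b c = phi (TB a b c).
Proof.
have EAGA := push_frame_orthonormal.
have EA_reg (x y : 'I_n -> A) :
    (forall i, \sum_c x c * map_mx phi EB c i = \sum_c y c * map_mx phi EB c i) -> x =1 y.
  move=> xy e; have : (\row_c x c) *m map_mx phi EB = (\row_c y c) *m map_mx phi EB.
    apply/rowP => i; rewrite !mxE.
    by under eq_bigr do rewrite mxE; under [RHS]eq_bigr do rewrite mxE.
  move/(congr1 (mulmx^~ (map_mx phi (GB *m EB^T)))); rewrite -!mulmxA -!map_mxM mulmxA EBGE.
  by rewrite map_scalar_mx rmorph1 !mulmx1 => /rowP/(_ e); rewrite !mxE.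
apply: (EA_reg (TA a b) (fun c => phi (TB a b c))) => i.
have EJ c' i' : phi (EB c' i') = \sum_j EA c' j * J j i'.
  by have /matrixP/(_ c' i') := push_frameJ; rewrite mxE [RHS]mxE => <-.
transitivity (\sum_j (\sum_c TA a b c * EA c j) * J j i).
  under eq_bigr do rewrite mxE EJ mulr_sumr.
  rewrite exchange_big /=; apply: eq_bigr => j _; rewrite mulr_suml.
  by apply: eq_bigr => c' _; rewrite mulrA.
under eq_bigr do rewrite (frame_torsionE _ _ EAGA)// mulrBl.
transitivity (phi (\sum_c TB a b c * EB c i)); last first.
  by rewrite rmorph_sum; apply: eq_bigr => c' _; rewrite rmorphM mxE.
rewrite (frame_torsionE _ _ EBGE)// rmorphB -!push_frame_partial.
have EJd a' b' : frame_partial dA EA a' (phi (EB b' i)) =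
    \sum_j frame_partial dA EA a' (EA b' j) * J j i
    + \sum_j EA b' j * frame_partial dA EA a' (J j i).
  by rewrite EJ raddf_sum -big_split /=; apply: eq_bigr => j _; rewrite (frame_partialM dAM).
rewrite !EJd sumrB.
have -> : \sum_j EA a j * frame_partial dA EA b (J j i)
   = \sum_j EA b j * frame_partial dA EA a (J j i).
  rewrite /frame_partial.
  under eq_bigr do rewrite mulr_sumr.
  under [RHS]eq_bigr do rewrite mulr_sumr.
  rewrite exchange_big /=; apply: eq_bigr => j _; apply: eq_bigr => k _.
  by rewrite J_closed mulrCA.
ring.
Qed.

(** Uniqueness of the Levi-Civita connection, in place of a transformation law for Christoffel
    symbols: the difference [X] of the two sides is skew in its last two indices by metric
    compatibility and symmetric in its first two by equality of the structure coefficients.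
    Alternating these swaps six times shows that [X] is its own opposite. *)
Lemma push_frame_connection a :
  frame_connection dA GA CA EA a = map_mx phi (frame_connection dB GB CB EB a).
Proof.
have EAGA := push_frame_orthonormal.
pose X a b c := frame_connection dA GA CA EA a b c - phi (frame_connection dB GB CB EB a b c).
have Xskew a' b c : X a' b c = - X a' c b.
  rewrite /X (frame_connection_skew dAM CA_metric EAGA) (frame_connection_skew dBM CB_metric EBGE).
  by rewrite rmorphN; ring.
have Xsym a' b c : X a' b c = X b a' c.
  have := push_frame_torsion a' b c; rewrite /TA /TB /frame_torsion rmorphB /X.
  move: (frame_connection dA _ _ _ _ _ _) (frame_connection dA _ _ _ _ _ _).
  move: (phi _) (phi _) => x y u v e.
  have -> : u - x = v - y - ((v - u) - (y - x)) by ring.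
  by rewrite e subrr subr0.
apply/matrixP => b c; rewrite [RHS]mxE; apply/eqP; rewrite -subr_eq0; apply/eqP.
apply: (opp_eq_self_eq0 half2).
rewrite -/(X a b c) {1}Xskew (Xsym a c b) (Xskew c a b) (Xsym c b a).
by rewrite (Xskew b c a) (Xsym b a c) opprK.
Qed.

Lemma push_frame_curvature a b :
  frame_curvature dA GA CA EA a b = map_mx phi (frame_curvature dB GB CB EB a b).
Proof.
have L a' (M : 'M[B]_n) : map_mx (frame_partial dA EA a') (map_mx phi M)
    = map_mx phi (map_mx (frame_partial dB EB a') M).
  by apply/matrixP => i j; rewrite !mxE push_frame_partial.
rewrite /frame_curvature !push_frame_connection !L !(map_mxB, map_mxD, map_mxM).
congr (_ - _); apply/matrixP => i j; rewrite [RHS]mxE !summxE. rewrite (raddf_sum phi) /=.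
apply: eq_bigr => c _; rewrite push_frame_connection [LHS]mxE [X in phi X]mxE rmorphM.
by rewrite [X in _ * X = _]mxE; congr (_ * _); exact: push_frame_torsion.
Qed.

Lemma push_frame_ricci : EA *m ricci_of dA CA *m EA^T
  = map_mx phi (EB *m ricci_of dB CB *m EB^T).
Proof.
have EAGA := push_frame_orthonormal.
apply/matrixP => b c; rewrite (frame_ricci dAM dAC CA_sym EAGA) [RHS]mxE.
rewrite (frame_ricci dBM dBC CB_sym EBGE) rmorph_sum; apply: eq_bigr => a _.
by rewrite push_frame_curvature mxE.
Qed.

End Push.

(** * Adapted frames *)

(* D1, D2, D3 is an orthonormal frame with D3 = T, and K = mu / 2.  The connection
   is nabla_{D_i} T = p_i D1 + q_i D2 and nabla_{D_i} D1 = r_i D2 - p_i T.  The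
   principal Ricci curvatures f, f, - 2 K amount to sectional curvatures f + K for
   the plane of D1, D2 and - K for the planes containing T. *)
Section AdaptedFrame.
Variables (A : comPzRingType) (D1 D2 D3 : {additive A -> A}).
Variables (p1 p2 p3 q1 q2 q3 r1 r2 r3 f K : A).
Hypothesis D1M : forall a b, D1 (a * b) = D1 a * b + a * D1 b.
Hypothesis D2M : forall a b, D2 (a * b) = D2 a * b + a * D2 b.
Hypothesis D3M : forall a b, D3 (a * b) = D3 a * b + a * D3 b.
Hypothesis D1K : D1 K = 0.
Hypothesis D2K : D2 K = 0.
Hypothesis D3K : D3 K = 0.

Let T12 (x1 x2 x3 : A) : A := - r1 * x1 - r2 * x2 + (p2 - q1) * x3.
Let T13 (x1 x2 x3 : A) : A := p1 * x1 + (q1 - r3) * x2 + p3 * x3.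
Let T23 (x1 x2 x3 : A) : A := (p2 + r3) * x1 + q2 * x2 + q3 * x3.

Hypothesis D12 : forall a, D1 (D2 a) - D2 (D1 a) = T12 (D1 a) (D2 a) (D3 a).
Hypothesis D13 : forall a, D1 (D3 a) - D3 (D1 a) = T13 (D1 a) (D2 a) (D3 a).
Hypothesis D23 : forall a, D2 (D3 a) - D3 (D2 a) = T23 (D1 a) (D2 a) (D3 a).

Hypothesis RP12 : D1 p2 - D2 p1 - q2 * r1 + q1 * r2 - T12 p1 p2 p3 = 0.
Hypothesis RP13 : D1 p3 - D3 p1 - q3 * r1 + q1 * r3 - T13 p1 p2 p3 = - K.
Hypothesis RP23 : D2 p3 - D3 p2 - q3 * r2 + q2 * r3 - T23 p1 p2 p3 = 0.
Hypothesis RQ12 : D1 q2 - D2 q1 + p2 * r1 - p1 * r2 - T12 q1 q2 q3 = 0.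
Hypothesis RQ13 : D1 q3 - D3 q1 + p3 * r1 - p1 * r3 - T13 q1 q2 q3 = 0.
Hypothesis RQ23 : D2 q3 - D3 q2 + p3 * r2 - p2 * r3 - T23 q1 q2 q3 = - K.
Hypothesis RR12 : D1 r2 - D2 r1 + p1 * q2 - p2 * q1 - T12 r1 r2 r3 = - (f + K).
Hypothesis RR13 : D1 r3 - D3 r1 + p1 * q3 - p3 * q1 - T13 r1 r2 r3 = 0.
Hypothesis RR23 : D2 r3 - D3 r2 + p2 * q3 - p3 * q2 - T23 r1 r2 r3 = 0.

Let eP12 : D1 p2 = D2 p1 + q2 * r1 - q1 * r2 + T12 p1 p2 p3.
Proof. by apply/eqP; rewrite -subr_eq0 -[X in _ == X]RP12; apply/eqP; ring. Qed.
Let eP13 : D1 p3 = D3 p1 + q3 * r1 - q1 * r3 + T13 p1 p2 p3 - K.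
Proof. by rewrite -RP13; ring. Qed.
Let eP23 : D2 p3 = D3 p2 + q3 * r2 - q2 * r3 + T23 p1 p2 p3.
Proof. by apply/eqP; rewrite -subr_eq0 -[X in _ == X]RP23; apply/eqP; ring. Qed.
Let eQ12 : D1 q2 = D2 q1 - p2 * r1 + p1 * r2 + T12 q1 q2 q3.
Proof. by apply/eqP; rewrite -subr_eq0 -[X in _ == X]RQ12; apply/eqP; ring. Qed.
Let eQ13 : D1 q3 = D3 q1 - p3 * r1 + p1 * r3 + T13 q1 q2 q3.
Proof. by apply/eqP; rewrite -subr_eq0 -[X in _ == X]RQ13; apply/eqP; ring. Qed.
Let eQ23 : D2 q3 = D3 q2 - p3 * r2 + p2 * r3 + T23 q1 q2 q3 - K.
Proof. by rewrite -RQ23; ring. Qed.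
Let eR12 : D1 r2 = D2 r1 - p1 * q2 + p2 * q1 + T12 r1 r2 r3 - (f + K).
Proof. by rewrite -RR12; ring. Qed.
Let eR13 : D1 r3 = D3 r1 - p1 * q3 + p3 * q1 + T13 r1 r2 r3.
Proof. by apply/eqP; rewrite -subr_eq0 -[X in _ == X]RR13; apply/eqP; ring. Qed.
Let eR23 : D2 r3 = D3 r2 - p2 * q3 + p3 * q2 + T23 r1 r2 r3.
Proof. by apply/eqP; rewrite -subr_eq0 -[X in _ == X]RR23; apply/eqP; ring. Qed.

(* Applied to p, q and r, this gives the second Bianchi identity. *)
Let cyc a1 a2 a3 : D1 (D2 a3 - D3 a2) - D2 (D1 a3 - D3 a1) + D3 (D1 a2 - D2 a1)
  = T12 (D1 a3) (D2 a3) (D3 a3) - T13 (D1 a2) (D2 a2) (D3 a2)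
    + T23 (D1 a1) (D2 a1) (D3 a1).
Proof. by rewrite -D12 -D13 -D23 (raddfB D1) (raddfB D2) (raddfB D3); ring. Qed.

Let DE := (raddfD D1, raddfD D2, raddfD D3, raddfN D1, raddfN D2, raddfN D3,
  D1M, D2M, D3M, D1K, D2K, D3K).

(** Second Bianchi identity for [p]: the curvature components entering it are the constants 0 and
    [- K], so no derivative of [f] appears, and what remains is [q3] times [f + K + K], the
    difference of the two sectional curvatures. This is f + mu, which is invertible, so T is
    geodesic. *)
Let bianchi_q3 : - ((f + K + K) * q3) = 0.
Proof.
have := cyc p1 p2 p3.
(* Replacing these differences by the structure equations before differentiating them keeps second
   derivatives from appearing. *)
have -> : D2 p3 - D3 p2 = q3 * r2 - q2 * r3 + T23 p1 p2 p3 by rewrite eP23; ring.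
have -> : D1 p3 - D3 p1 = q3 * r1 - q1 * r3 + T13 p1 p2 p3 - K by rewrite eP13; ring.
have -> : D1 p2 - D2 p1 = q2 * r1 - q1 * r2 + T12 p1 p2 p3 by rewrite eP12; ring.
move/eqP; rewrite -subr_eq0 => /eqP e; rewrite -[RHS]e.
rewrite /T12 /T13 /T23 !DE ?(eP12,eP13,eP23,eQ12,eQ13,eQ23,eR12,eR13,eR23).
rewrite /T12 /T13 /T23.
ring.
Qed.

Let bianchi_p3 : (f + K + K) * p3 = 0.
Proof.
have := cyc q1 q2 q3.
have -> : D2 q3 - D3 q2 = - p3 * r2 + p2 * r3 + T23 q1 q2 q3 - K by rewrite eQ23; ring.
have -> : D1 q3 - D3 q1 = - p3 * r1 + p1 * r3 + T13 q1 q2 q3 by rewrite eQ13; ring.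
have -> : D1 q2 - D2 q1 = - p2 * r1 + p1 * r2 + T12 q1 q2 q3 by rewrite eQ12; ring.
move/eqP; rewrite -subr_eq0 => /eqP e; rewrite -[RHS]e.
rewrite /T12 /T13 /T23 !DE ?(eP12,eP13,eP23,eQ12,eQ13,eQ23,eR12,eR13,eR23).
rewrite /T12 /T13 /T23.
ring.
Qed.

Variable w : A.
Hypothesis fw : (f + K + K) * w = 1.

Lemma geodesic_p : p3 = 0.
Proof. by rewrite -[p3]mul1r -fw mulrAC bianchi_p3 mul0r. Qed.

Lemma geodesic_q : q3 = 0.
Proof.
by apply/oppr_inj; rewrite -[q3]mul1r -fw oppr0 -[RHS](mul0r w) -bianchi_q3; ring.
Qed.

(** Divergence of T, the trace of its shape operator. *)
Let a := p1 + q2.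

(** Second Bianchi identity for [r]. It is the conservation law div ((f + mu) T) = 0, which [D3w]
    restates for w. *)
Let D3f : D3 f = - (f + K + K) * a.
Proof.
have := cyc r1 r2 r3.
have -> : D2 r3 - D3 r2 = - p2 * q3 + p3 * q2 + T23 r1 r2 r3 by rewrite eR23; ring.
have -> : D1 r3 - D3 r1 = - p1 * q3 + p3 * q1 + T13 r1 r2 r3 by rewrite eR13; ring.
have -> : D1 r2 - D2 r1 = - p1 * q2 + p2 * q1 + T12 r1 r2 r3 - (f + K) by rewrite eR12; ring.
move/eqP; rewrite -subr_eq0 => /eqP e; apply/eqP; rewrite -subr_eq0.
rewrite -[X in _ == X]oppr0 -[X in _ == - X]e; apply/eqP.
rewrite /T12 /T13 /T23 !DE ?(eP12,eP13,eP23,eQ12,eQ13,eQ23,eR12,eR13,eR23).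
rewrite /T12 /T13 /T23 !geodesic_p !geodesic_q /a ?raddf0.
ring.
Qed.

(** With A the matrix of rows (p1, q1) and (p2, q2), this and the next three facts are the entries
    of the Riccati equation A' = K - A^2 along T, corrected by the rotation [r3] of D1, D2 in their
    plane. *)
Let D3p1 : D3 p1 = q1 * r3 - p1 * p1 - q1 * p2 + r3 * p2 + K.
Proof.
have := eP13; rewrite /T13 geodesic_p geodesic_q raddf0 => e.
by apply/eqP; rewrite -subr_eq0 [X in _ == X]e; apply/eqP; ring. Qed.

Let D3p2 : D3 p2 = q2 * r3 - (p2 + r3) * p1 - q2 * p2.
Proof.
have := eP23; rewrite /T23 geodesic_p geodesic_q raddf0 => e.
by apply/eqP; rewrite -subr_eq0 [X in _ == X]e; apply/eqP; ring. Qed.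

Let D3q1 : D3 q1 = - p1 * r3 - p1 * q1 - (q1 - r3) * q2.
Proof.
have := eQ13; rewrite /T13 geodesic_p geodesic_q raddf0 => e.
by apply/eqP; rewrite -subr_eq0 [X in _ == X]e; apply/eqP; ring. Qed.

Let D3q2 : D3 q2 = - p2 * r3 - (p2 + r3) * q1 - q2 * q2 + K.
Proof.
have := eQ23; rewrite /T23 geodesic_p geodesic_q raddf0 => e.
by apply/eqP; rewrite -subr_eq0 [X in _ == X]e; apply/eqP; ring. Qed.

Let D3w : D3 w = a * w.
Proof.
have e : D3 ((f + K + K) * w) = 0.
  have e1 : D3 1 = 0.
    have := D3M 1 1; rewrite !mulr1 mul1r => /eqP.
    by rewrite addrC -subr_eq subrr eq_sym => /eqP.
  by rewrite fw.
move: e; rewrite D3M !DE D3f => e.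
have -> : D3 w = (f + K + K) * w * D3 w by rewrite fw mul1r.
have -> : a * w = (f + K + K) * w * a * w by rewrite fw mul1r.
apply/eqP; rewrite -subr_eq0; apply/eqP; rewrite -[RHS](mulr0 w) -[in RHS]e; ring.
Qed.

(** For derivatives along T, the Riccati equation gives successively w'' = 2 (K + det A) w and w'''
    = 4 K w'; the right-hand side is 2 w''^2 + 2 w' w'''. *)
Lemma hessian_Dw :
  D3 (D3 (D3 w ^+ 2)) = 2%:R * D3 (D3 w) ^+ 2 + 8%:R * K * D3 w ^+ 2.
Proof.
have -> : D3 w = a * w by exact: D3w.
rewrite !expr2 /a !DE ?D3w ?D3p1 ?D3p2 ?D3q1 ?D3q2 !DE ?D3w ?D3p1 ?D3p2 ?D3q1 ?D3q2.
rewrite /a; ring.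
Qed.

(* As T w = (p1 + q2) w, the shape operator of the plane field orthogonal to T is
   now trace-free, and the Riccati equation makes its square equal to K. *)
Hypothesis Dw0 : D3 w = 0.
Variable half : A.
Hypothesis half2 : 2%:R * half = 1.

Let double_eq0 (x : A) : 2%:R * x = 0 -> x = 0.
Proof. by move=> e; rewrite -[x]mul1r -half2 mulrAC e mul0r. Qed.

Let q2E : q2 = - p1.
Proof.
apply/eqP; rewrite eq_sym -subr_eq0 -[X in _ == X](mulr0 (- (f + K + K))) -Dw0 D3w.
have -> : - (f + K + K) * (a * w) = - ((f + K + K) * w * a) by ring.
by rewrite fw mul1r /a; apply/eqP; ring.
Qed.

Let KE : K = p1 * p1 + p2 * q1.
Proof.
have : D3 (p1 + q2) = 0 by rewrite q2E subrr raddf0.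
rewrite !DE D3p1 D3q2 q2E => e.
apply/eqP; rewrite -subr_eq0; apply/eqP/double_eq0.
by rewrite -[RHS]e; ring.
Qed.

(** As A is trace-free with A^2 = K, the energy is 4 K + 2 (q1 - p2)^2. The Riccati equation leaves
    only the rotation [r3], which preserves the skew part q1 - p2. *)
Lemma flow_invariant_energy :
  D3 (2%:R * (p1 ^+ 2 + p2 ^+ 2 + p3 ^+ 2 + q1 ^+ 2 + q2 ^+ 2 + q3 ^+ 2)) = 0.
Proof.
rewrite mulr_natl raddfMn geodesic_p geodesic_q !expr2.
rewrite q2E !DE D3p1 D3p2 D3q1 q2E raddf0 KE; ring.
Qed.

Section Hessian.
Variable rho : A.
Hypothesis D3rho : D3 rho = 0.

Let D31 : D3 (D1 rho) = - (p1 * D1 rho + (q1 - r3) * D2 rho).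
Proof.
apply/oppr_inj; rewrite opprK; have := D13 rho; rewrite /T13 D3rho raddf0 => e.
by rewrite -[LHS]add0r e; ring.
Qed.

Let D32 : D3 (D2 rho) = - ((p2 + r3) * D1 rho + q2 * D2 rho).
Proof.
apply/oppr_inj; rewrite opprK; have := D23 rho; rewrite /T23 D3rho raddf0 => e.
by rewrite -[LHS]add0r e; ring.
Qed.

(** The differential of [rho] is invariant under the flow of T. Hence, up to the rotation [r3], v =
    (D1 rho, D2 rho) satisfies v' = - A v and v'' = A^2 v = K v. The last two squares add up to |A
    v|^2 = |v'|^2. *)
Lemma hessian_grad_norm :
  let s := D1 rho ^+ 2 + D2 rho ^+ 2 + D3 rho ^+ 2 in
  D3 (D3 s) = 2%:R * (K * s + (p1 * D1 rho + q1 * D2 rho) ^+ 2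
                      + (p2 * D1 rho + q2 * D2 rho) ^+ 2).
Proof.
rewrite /= D3rho !expr2 mul0r addr0.
rewrite !DE ?D31 ?D32 !DE ?D31 ?D32 ?D3p1 ?D3p2 ?D3q1 ?D3q2 ?D3rho !q2E ?DE ?D3p1 KE.
ring.
Qed.
End Hessian.

Hypothesis reduced : forall x : A, x ^+ 2 = 0 -> x = 0.
(* sg is the skew part, and (X, Y) the trace-free symmetric part, of the shape
   operator.  When sg is constant the Codazzi equations say that (X, Y) has
   constant length and rotates with twice the connection form r, so the plane
   field orthogonal to T is flat. *)
Let sg := q1 - p2.
Let X := 2%:R * p1.
Let Y := p2 + q1.
Variable mi : A.
Hypothesis mK : (4%:R * K + sg ^+ 2) * mi = 1.

Let rho := 2%:R * (p1 ^+ 2 + p2 ^+ 2 + p3 ^+ 2 + q1 ^+ 2 + q2 ^+ 2 + q3 ^+ 2).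
Hypothesis D1rho : D1 rho = 0.
Hypothesis D2rho : D2 rho = 0.

Section SigmaConstant.
Variable D : {additive A -> A}.
Hypothesis DM : forall a b, D (a * b) = D a * b + a * D b.
Hypothesis DK : D K = 0.
Hypothesis Drho : D rho = 0.

(** From rho = 4 K + 2 sg^2 one gets only sg D sg = 0, and [sg] may vanish somewhere.
    Differentiating once more and multiplying by (D sg)^2 gives (D sg)^4 = 0, and the ring is
    reduced. *)
Lemma derivation_twist : D sg = 0.
Proof.
have e : sg * D sg = 0.
  have : D (rho - 4%:R * K) = 0.
    by rewrite (raddfB D) Drho mulr_natl raddfMn DK mul0rn subr0.
  have -> : rho - 4%:R * K = (sg * sg) *+ 2.
    by rewrite /rho geodesic_p geodesic_q KE q2E /sg; ring.
  rewrite raddfMn DM => e.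
  by do 2! apply: double_eq0; rewrite -[RHS]e; ring.
have : D (sg * D sg) = 0 by rewrite e raddf0.
rewrite DM => e2.
have e3 : (D sg ^+ 2) ^+ 2 = 0.
  rewrite -[RHS](mulr0 (D sg ^+ 2)) -[in RHS]e2.
  by rewrite mulrDr addrC mulrA [_ ^+ 2 * sg]mulrC expr2 [sg * _]mulrA e !mul0r add0r.
exact/reduced/reduced.
Qed.
End SigmaConstant.

Let D1s : D1 sg = 0. Proof. by apply: derivation_twist. Qed.
Let D2s : D2 sg = 0. Proof. by apply: derivation_twist. Qed.

Let m : A := 4%:R * K + sg ^+ 2.
Let mE : m = X ^+ 2 + Y ^+ 2.
Proof. by rewrite /m KE /X /Y /sg; ring. Qed.

Let mI (x : A) : m * x = 0 -> x = 0.
Proof. by move=> e; rewrite -[x]mul1r -mK mulrAC -/m e mul0r. Qed.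

Let DXY (D : {additive A -> A}) :
  (forall a b, D (a * b) = D a * b + a * D b) -> D K = 0 -> D sg = 0 ->
  X * D X + Y * D Y = 0.
Proof.
move=> DM DK Ds.
have : D m = 0.
  by rewrite /m expr2 mulr_natl raddfD raddfMn DK DM Ds mul0rn mulr0 mul0r !addr0.
rewrite mE !expr2 raddfD !DM => e.
by apply: double_eq0; rewrite -[RHS]e; ring.
Qed.

(** [RP12] and, for the next fact, [RQ12] are the Codazzi equations. Constancy of [sg] lets the
    derivatives of [q1] be replaced by those of [p2], so that the equations involve the derivatives
    of X and Y alone. *)
Let codazzi1 : D1 Y - D2 X + 2%:R * (X * r1 + Y * r2) = 0.
Proof.
have := RP12; rewrite /T12 => e.
have s1 : D1 q1 = D1 p2 by apply/eqP; rewrite -subr_eq0 -raddfB D1s.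
rewrite -[RHS](mulr0 2%:R) -[in RHS]e /X /Y mulr_natl raddfMn !DE s1 geodesic_p q2E; ring.
Qed.

Let codazzi2 : D1 X + D2 Y - 2%:R * (Y * r1 - X * r2) = 0.
Proof.
have := RQ12; rewrite /T12 => e.
have s2 : D2 q1 = D2 p2 by apply/eqP; rewrite -subr_eq0 -raddfB D2s.
rewrite -[RHS](mulr0 (- 2%:R)) -[in RHS]e /X /Y mulr_natl raddfMn !DE s2 geodesic_q q2E !DE; ring.
Qed.

(** Up to the factor [m], the squared length of (X, Y), [N1] and [N2] measure how far the angle of
    (X, Y) is from turning with twice the connection form [r]. *)
Let N1 := Y * D1 X - X * D1 Y - 2%:R * m * r1.
Let N2 := Y * D2 X - X * D2 Y - 2%:R * m * r2.

Let rot (D : {additive A -> A}) r : X * D X + Y * D Y = 0 ->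
  Y * D X - X * D Y - 2%:R * m * r = 0 ->
  D X = 2%:R * r * Y /\ D Y = - 2%:R * r * X.
Proof.
move=> e1 e2; split; apply/eqP; rewrite -subr_eq0; apply/eqP/mI.
  transitivity (X * (X * D X + Y * D Y)
      + Y * (Y * D X - X * D Y - 2%:R * m * r)); first by rewrite mE; ring.
  by rewrite e1 e2 !mulr0 addr0.
transitivity (Y * (X * D X + Y * D Y)
    - X * (Y * D X - X * D Y - 2%:R * m * r)); first by rewrite mE; ring.
by rewrite e1 e2 !mulr0 subr0.
Qed.

Let c1 := D1 Y - D2 X + 2%:R * (X * r1 + Y * r2).
Let c2 := D1 X + D2 Y - 2%:R * (Y * r1 - X * r2).

Let N1_0 : N1 = 0.
Proof.
have e1 := DXY D1M D1K D1s; have e2 := DXY D2M D2K D2s.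
apply: mI.
(* The Codazzi equations and the constancy of X^2 + Y^2 along D1 and D2 form a linear system for the
   four derivatives of X and Y, with determinant [m] up to sign; this combination solves it. *)
transitivity (X * (- m * c1 + Y * (X * D1 X + Y * D1 Y) - X * (X * D2 X + Y * D2 Y))
  + Y * (m * c2 - X * (X * D1 X + Y * D1 Y) - Y * (X * D2 X + Y * D2 Y))).
  by rewrite /N1 /c1 /c2 mE; ring.
by rewrite e1 e2 /c1 /c2 codazzi1 codazzi2; ring.
Qed.

Let N2_0 : N2 = 0.
Proof.
have e1 := DXY D1M D1K D1s; have e2 := DXY D2M D2K D2s.
apply: mI.
transitivity (Y * (- m * c1 + Y * (X * D1 X + Y * D1 Y) - X * (X * D2 X + Y * D2 Y))
  - X * (m * c2 - X * (X * D1 X + Y * D1 Y) - Y * (X * D2 X + Y * D2 Y))).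
  by rewrite /N2 /c1 /c2 mE; ring.
by rewrite e1 e2 /c1 /c2 codazzi1 codazzi2; ring.
Qed.

Let D3X : D3 X = 2%:R * r3 * Y.
Proof.
rewrite /X mulr_natl raddfMn D3p1 /Y; move: KE => ->; ring.
Qed.

Let D3Y : D3 Y = - 2%:R * r3 * X.
Proof. by rewrite /Y !DE D3p2 D3q1 q2E /X; ring. Qed.

(** By now (X, Y) is parallel for the connection form 2 r, so the commutator of D1 and D2 applied to
    X and Y shows that the curvature of [r] annihilates this vector, whose squared length [m] is
    invertible. *)
Lemma leaf_curvature_eq0 : f = 0.
Proof.
have [D1X D1Y] := rot (DXY D1M D1K D1s) N1_0.
have [D2X D2Y] := rot (DXY D2M D2K D2s) N2_0.
have D2n (D : {additive A -> A}) x : D (2%:R * x) = 2%:R * D x.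
  by rewrite !mulr_natl raddfMn.
have D1n x y : D1 (2%:R * x * y) = 2%:R * (D1 x * y + x * D1 y).
  by rewrite -mulrA D2n D1M.
have D2n' x y : D2 (2%:R * x * y) = 2%:R * (D2 x * y + x * D2 y).
  by rewrite -mulrA D2n D2M.
(* Gauss equation: det A = - K cancels the [K] of the sectional curvature, so the curvature of [r]
   is f up to sign. *)
have RRE : D1 r2 - D2 r1 - T12 r1 r2 r3 = - f.
  have -> : D1 r2 - D2 r1 - T12 r1 r2 r3 = - (f + K) - (p1 * q2 - p2 * q1).
    by rewrite -RR12; ring.
  by rewrite q2E; move: KE => ->; ring.
have fY : f * Y = 0.
  apply/oppr_inj; rewrite oppr0 -mulNr -RRE.
  have := D12 X; rewrite D2X D1X D3X D1n D2n' D1Y D2Y /T12 => /eqP.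
  rewrite -subr_eq0 => /eqP e.
  by apply: double_eq0; rewrite -[RHS]e; ring.
have fX : f * X = 0.
  apply/oppr_inj; rewrite oppr0 -mulNr -RRE.
  have := D12 Y.
  have -> : D2 Y = 2%:R * r2 * (- X) by rewrite D2Y; ring.
  have -> : D1 Y = 2%:R * r1 * (- X) by rewrite D1Y; ring.
  rewrite D3Y D1n D2n' (raddfN D1) (raddfN D2) D1X D2X /T12 => /eqP.
  rewrite -subr_eq0 => /eqP e.
  by apply: double_eq0; apply/oppr_inj; rewrite oppr0 -[RHS]e; ring.
apply: mI; rewrite mE.
have -> : (X ^+ 2 + Y ^+ 2) * f = X * (f * X) + Y * (f * Y) by ring.
by rewrite fX fY !mulr0 addr0.
Qed.

End AdaptedFrame.

Definition o0 : 'I_3 := @Ordinal 3 0 isT.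
Definition o1 : 'I_3 := @Ordinal 3 1 isT.
Definition o2 : 'I_3 := @Ordinal 3 2 isT.

Lemma sum3 (V : nmodType) (F : 'I_3 -> V) : \sum_i F i = F o0 + F o1 + F o2.
Proof.
rewrite !big_ord_recr big_ord0 /= add0r.
by congr (_ + _ + _); congr F; apply: val_inj.
Qed.

Lemma ord3P (P : 'I_3 -> Prop) : P o0 -> P o1 -> P o2 -> forall i, P i.
Proof.
move=> P0 P1 P2 [[|[|[|//]]] i3].
- by rewrite (_ : Ordinal i3 = o0)//; exact: val_inj.
- by rewrite (_ : Ordinal i3 = o1)//; exact: val_inj.
- by rewrite (_ : Ordinal i3 = o2)//; exact: val_inj.
Qed.

Definition diag3 (A : pzRingType) (a b c : A) : 'M[A]_3 :=
  diag_mx (\row_j (if j == o0 then a else if j == o1 then b else c)).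

Lemma diag3E (A : pzRingType) (a b c : A) : [/\ diag3 a b c o0 o0 = a,
  diag3 a b c o1 o1 = b, diag3 a b c o2 o2 = c &
  forall i j, i != j -> diag3 a b c i j = 0].
Proof.
by split=> [|||i j /negbTE ij]; rewrite !mxE /= ?mulr1n// ij mulr0n.
Qed.

(** * Curvature in a frame diagonalizing Ric, in dimension three *)

Section Bridge.
Variables (A : comPzRingType) (d : 'I_3 -> {additive A -> A}).
Hypothesis dM : forall i a b, d i (a * b) = d i a * b + a * d i b.
Hypothesis dC : forall i j a, d i (d j a) = d j (d i a).
Variable half : A.
Hypothesis half2 : half + half = 1.
Variables (G Gi : 'M[A]_3) (C : 'I_3 -> 'M[A]_3) (E : 'M[A]_3).
Hypothesis C_sym : forall i j k, C i j k = C j i k.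
Hypothesis C_metric : forall i, mx_partial d i G = C i *m G + G *m (C i)^T.
Hypothesis GiG : Gi *m G = 1%:M.
Hypothesis EGE : E *m G *m E^T = 1%:M.
Variables (f K w : A).
Hypothesis dK : forall i, d i K = 0.
Hypothesis Ric : E *m ricci_of d C *m E^T = diag3 f f (- (K + K)).
Hypothesis fw : (f + K + K) * w = 1.
Hypothesis reduced : forall x : A, x ^+ 2 = 0 -> x = 0.

Let D a : {additive A -> A} := frame_partial d E a.
Let B := frame_connection d G C E.
Let R := frame_curvature d G C E.

Let DM a x y : D a (x * y) = D a x * y + x * D a y.
Proof. exact: frame_partialM. Qed.

Let DK a : D a K = 0.
Proof. by rewrite /D /= /frame_partial big1// => i _; rewrite dK mulr0. Qed.

Let p a := B a o2 o0.
Let q a := B a o2 o1.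
Let r a := B a o0 o1.

Let Bskew a b c : B a b c = - B a c b.
Proof. exact: (frame_connection_skew dM C_metric EGE). Qed.
Let B20 a : B a o0 o2 = - p a. Proof. exact: Bskew. Qed.
Let B21 a : B a o1 o2 = - q a. Proof. exact: Bskew. Qed.
Let B10 a : B a o1 o0 = - r a. Proof. exact: Bskew. Qed.
Let Bd a b : B a b b = 0.
Proof. by apply: (opp_eq_self_eq0 half2); exact: Bskew. Qed.
Let BE := (B20, B21, B10, Bd).

Let bracket a b h : D a (D b h) - D b (D a h) =
  (B a b o0 - B b a o0) * D o0 h + (B a b o1 - B b a o1) * D o1 h
  + (B a b o2 - B b a o2) * D o2 h.
Proof. by rewrite /D /= (frame_bracket dM dC C_sym EGE) sum3. Qed.

Let RE a b i j : R a b i j = D a (B b i j) - D b (B a i j)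
  + (B b i o0 * B a o0 j + B b i o1 * B a o1 j + B b i o2 * B a o2 j)
  - (B a i o0 * B b o0 j + B a i o1 * B b o1 j + B a i o2 * B b o2 j)
  - ((B a b o0 - B b a o0) * B o0 i j + (B a b o1 - B b a o1) * B o1 i j
  + (B a b o2 - B b a o2) * B o2 i j).
Proof. by rewrite /R /frame_curvature !mxE summxE !sum3 !mxE. Qed.

Let Rskew a b c e : R a b c e = - R a b e c.
Proof. exact: (frame_curvature_skew dM C_sym C_metric EGE). Qed.
Let Ranti a b c e : R a b c e = - R b a c e.
Proof. exact: (frame_curvature_antisym dM C_sym EGE). Qed.
Let Rd a b c : R a b c c = 0.
Proof. by apply: (opp_eq_self_eq0 half2); exact: Rskew. Qed.
Let Rdd a c e : R a a c e = 0.
Proof. by apply: (opp_eq_self_eq0 half2); exact: Ranti. Qed.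

Let S b c : diag3 f f (- (K + K)) b c = R o0 b c o0 + R o1 b c o1 + R o2 b c o2.
Proof. by rewrite -Ric (frame_ricci dM dC C_sym EGE) sum3. Qed.

Let double0 (x : A) : x + x = 0 -> x = 0.
Proof. by move=> e; rewrite -[x]mul1r -half2 mulrDl -mulrDr e mulr0. Qed.

Let S_entries : [/\ f = R o1 o0 o0 o1 + R o2 o0 o0 o2, f = R o0 o1 o1 o0 + R o2 o1 o1 o2
  & - (K + K) = R o0 o2 o2 o0 + R o1 o2 o2 o1].
Proof.
have [d0 d1 d2 _] := diag3E f f (- (K + K)).
have := S o0 o0; have := S o1 o1; have := S o2 o2.
by rewrite d0 d1 d2 !Rd !add0r !addr0 => -> -> ->.
Qed.

(** In dimension three two of these three terms vanish by skew-symmetry, so every off-diagonal entry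
    of Ric is a single curvature component up to sign. This yields the six vanishing components
    below. *)
Let off b c : b != c -> R o0 b c o0 + R o1 b c o1 + R o2 b c o2 = 0.
Proof. by rewrite -S; have [_ _ _] := diag3E f f (- (K + K)); apply. Qed.

Let RP12 : R o0 o1 o2 o0 = 0.
Proof. by rewrite -[RHS](@off o1 o2)// Rd Rdd !addr0. Qed.
Let RP23 : R o1 o2 o2 o0 = 0.
Proof. by rewrite Ranti Rskew opprK -[RHS](@off o1 o0)// Rd Rdd !add0r. Qed.
Let RQ12 : R o0 o1 o2 o1 = 0.
Proof. by rewrite Ranti -[LHS]addr0 -[RHS]oppr0 -[in RHS](@off o0 o2)// Rdd Rd !addr0 add0r. Qed.
Let RQ13 : R o0 o2 o2 o1 = 0.
Proof. by rewrite Ranti Rskew opprK -[RHS](@off o0 o1)// Rdd Rd !add0r. Qed.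
Let RR13 : R o0 o2 o0 o1 = 0.
Proof. by rewrite Rskew -[RHS]oppr0 -[in RHS](@off o2 o1)// Rdd Rd !addr0. Qed.
Let RR23 : R o1 o2 o0 o1 = 0.
Proof. by rewrite -[RHS](@off o2 o0)// Rdd Rd !addr0 add0r. Qed.

(** Effect of the double eigenvalue: each of the two entries [f] is the sectional curvature of the
    plane [o0], [o1] plus that of one plane containing the axis, so the latter two agree. The third
    entry then makes both equal to [- K]. *)
Let RPQ : R o0 o2 o2 o0 = R o1 o2 o2 o1.
Proof.
have [] := S_entries.
rewrite (Ranti o1 o0) (Rskew o0 o1 o0) opprK (Ranti o2 o0) (Rskew o0 o2 o0) opprK.
rewrite (Ranti o2 o1) (Rskew o1 o2 o1) opprK => -> /addrI + _.
by [].
Qed.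

Let RP13 : R o0 o2 o2 o0 = - K.
Proof.
apply/eqP; rewrite -subr_eq0; apply/eqP/double0.
by have [_ _] := S_entries; rewrite -RPQ => e; rewrite addrACA -e; ring.
Qed.
Let RQ23 : R o1 o2 o2 o1 = - K. Proof. by rewrite -RPQ RP13. Qed.
Let RR12 : R o0 o1 o0 o1 = - (f + K).
Proof.
have [_ e _] := S_entries; rewrite Rskew [in RHS]e.
by rewrite (Ranti o2 o1) (Rskew o1 o2 o1) opprK RQ23 subrK.
Qed.

Let half2' : 2%:R * half = 1. Proof. by rewrite mulr_natl mulr2n. Qed.

Let br01 h : D o0 (D o1 h) - D o1 (D o0 h)
  = - r o0 * D o0 h - r o1 * D o1 h + (p o1 - q o0) * D o2 h.
Proof. by rewrite bracket !BE /p /q /r; ring. Qed.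
Let br02 h : D o0 (D o2 h) - D o2 (D o0 h)
  = p o0 * D o0 h + (q o0 - r o2) * D o1 h + p o2 * D o2 h.
Proof. by rewrite bracket !BE /p /q /r; ring. Qed.
Let br12 h : D o1 (D o2 h) - D o2 (D o1 h)
  = (p o1 + r o2) * D o0 h + q o1 * D o1 h + q o2 * D o2 h.
Proof. by rewrite bracket !BE /p /q /r; ring. Qed.

Let eRP12 : D o0 (p o1) - D o1 (p o0) - q o1 * r o0 + q o0 * r o1
  - (- r o0 * p o0 - r o1 * p o1 + (p o1 - q o0) * p o2) = 0.
Proof. by rewrite -RP12 RE !BE /p /q /r; ring. Qed.
Let eRP13 : D o0 (p o2) - D o2 (p o0) - q o2 * r o0 + q o0 * r o2
  - (p o0 * p o0 + (q o0 - r o2) * p o1 + p o2 * p o2) = - K.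
Proof. by rewrite -RP13 RE !BE /p /q /r; ring. Qed.
Let eRP23 : D o1 (p o2) - D o2 (p o1) - q o2 * r o1 + q o1 * r o2
  - ((p o1 + r o2) * p o0 + q o1 * p o1 + q o2 * p o2) = 0.
Proof. by rewrite -RP23 RE !BE /p /q /r; ring. Qed.
Let eRQ12 : D o0 (q o1) - D o1 (q o0) + p o1 * r o0 - p o0 * r o1
  - (- r o0 * q o0 - r o1 * q o1 + (p o1 - q o0) * q o2) = 0.
Proof. by rewrite -RQ12 RE !BE /p /q /r; ring. Qed.
Let eRQ13 : D o0 (q o2) - D o2 (q o0) + p o2 * r o0 - p o0 * r o2
  - (p o0 * q o0 + (q o0 - r o2) * q o1 + p o2 * q o2) = 0.
Proof. by rewrite -RQ13 RE !BE /p /q /r; ring. Qed.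
Let eRQ23 : D o1 (q o2) - D o2 (q o1) + p o2 * r o1 - p o1 * r o2
  - ((p o1 + r o2) * q o0 + q o1 * q o1 + q o2 * q o2) = - K.
Proof. by rewrite -RQ23 RE !BE /p /q /r; ring. Qed.
Let eRR12 : D o0 (r o1) - D o1 (r o0) + p o0 * q o1 - p o1 * q o0
  - (- r o0 * r o0 - r o1 * r o1 + (p o1 - q o0) * r o2) = - (f + K).
Proof. by rewrite -RR12 RE !BE /p /q /r; ring. Qed.
Let eRR13 : D o0 (r o2) - D o2 (r o0) + p o0 * q o2 - p o2 * q o0
  - (p o0 * r o0 + (q o0 - r o2) * r o1 + p o2 * r o2) = 0.
Proof. by rewrite -RR13 RE !BE /p /q /r; ring. Qed.
Let eRR23 : D o1 (r o2) - D o2 (r o1) + p o1 * q o2 - p o2 * q o1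
  - ((p o1 + r o2) * r o0 + q o1 * r o1 + q o2 * r o2) = 0.
Proof. by rewrite -RR23 RE !BE /p /q /r; ring. Qed.

Local Notation in_frame L := (L A (D o0) (D o1) (D o2) (p o0) (p o1) (p o2)
  (q o0) (q o1) (q o2) (r o0) (r o1) (r o2) f K (DM o0) (DM o1) (DM o2)
  (DK o0) (DK o1) (DK o2) br01 br02 br12 eRP12 eRP13 eRP23 eRQ12 eRQ13 eRQ23
  eRR12 eRR13 eRR23 w fw).

Lemma hessian_frame_w : D o2 (D o2 (D o2 w ^+ 2))
  = 2%:R * D o2 (D o2 w) ^+ 2 + 8%:R * K * D o2 w ^+ 2.
Proof. exact: (in_frame (@hessian_Dw)). Qed.

Let energy := 2%:R * (p o0 ^+ 2 + p o1 ^+ 2 + p o2 ^+ 2 + q o0 ^+ 2 + q o1 ^+ 2 + q o2 ^+ 2).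

Let Q := E^T *m diag3 0 0 1 *m E.

Lemma covariant_energyE : covariant_energy d C G Gi Q = energy.
Proof.
rewrite (covariant_energy_frame dM C_metric EGE GiG); last first.
  move=> i; apply/matrixP => j k; rewrite !mxE.
  case: (j == k); last by rewrite mulr0n raddf0.
  by rewrite mulr1n; do ?case: ifP => _; rewrite ?raddf0 ?(derivation1 dM).
pose e (j : 'I_3) : A := if j == o0 then 0 else if j == o1 then 0 else 1.
have KE a i j : (diag3 0 0 1 *m B a - B a *m diag3 0 0 1) i j = (e i - e j) * B a i j.
  move: (B a) => Ba; rewrite /diag3 mul_diag_mx mul_mx_diag !mxE /e.
  by case: (i == o0); case: (i == o1); case: (j == o0); case: (j == o1) => /=; ring.
rewrite sum3 /mxtrace !sum3 -/B.
rewrite !(mxE _ _ o0 o0) !(mxE _ _ o1 o1) !(mxE _ _ o2 o2) !sum3 !KE /e /= !BE.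
rewrite /energy /p /q /r; ring.
Qed.

Lemma gradient_formE h : gradient_form d Q h = D o2 h ^+ 2.
Proof.
rewrite gradient_form_frame !sum3 !mxE /= !(mulr1n, mulr0n) /D /=; ring.
Qed.

Lemma gradient_norm_frame h :
  gradient_form d Gi h = D o0 h ^+ 2 + D o1 h ^+ 2 + D o2 h ^+ 2.
Proof.
rewrite (inverse_metric_frame EGE GiG) -[E^T]mulmx1 gradient_form_frame !sum3 !mxE /=.
rewrite !(mulr1n, mulr0n) /D /=; ring.
Qed.

Hypothesis Dw0 : D o2 w = 0.

Lemma covariant_energy_flow_invariant : D o2 (covariant_energy d C G Gi Q) = 0.
Proof. by rewrite covariant_energyE; exact: (in_frame (@flow_invariant_energy) Dw0 half2'). Qed.

Lemma hessian_frame_norm h : D o2 h = 0 ->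
  exists x y, D o2 (D o2 (gradient_form d Gi h))
    = 2%:R * (K * gradient_form d Gi h + x ^+ 2 + y ^+ 2).
Proof.
move=> Dh; rewrite gradient_norm_frame.
have /= -> := in_frame (@hessian_grad_norm) Dw0 half2' Dh.
by eexists; eexists; reflexivity.
Qed.

Lemma scalar_curvature_eq0 mi : (4%:R * K + (q o0 - p o1) ^+ 2) * mi = 1 ->
  (forall a, D a (covariant_energy d C G Gi Q) = 0) -> f = 0.
Proof.
rewrite covariant_energyE => mK De.
exact: (in_frame (@leaf_curvature_eq0) Dw0 half2' reduced mK (De o0) (De o1)).
Qed.

End Bridge.

(** * Smooth functions on open sets of R^n *)

Section Analysis.
Variables (R : realType) (n : nat).
Implicit Types (h : 'rV[R]_n -> R) (x v : 'rV[R]_n).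
Local Notation e_ := (@basis_vector R n).

Lemma derivable_line h x v (t : R) : derivable h (t *: v + x) v ->
  is_derive t 1 (fun s => h (s *: v + x)) ('D_v h (t *: v + x)).
Proof.
move=> dh; have e : (fun k : R => k^-1 *: (((fun s => h (s *: v + x)) \o shift t) (k *: 1)
    - h (t *: v + x))) =
  (fun k => k^-1 *: ((h \o shift (t *: v + x)) (k *: v) - h (t *: v + x))).
  apply/funext => k /=; congr (_ *: (h _ - _)).
  by rewrite [k *: 1]mulr1 scalerDl addrA.
by apply: DeriveDef; rewrite /derivable /derive e.
Qed.

(** The coordinates substituted for [t] have either sign, hence the bounds by absolute values and
    the three cases. *)
Lemma line_mvt h x v (t : R) :
  (forall s : R, `|s| <= `|t| -> derivable h (s *: v + x) v) ->
  exists2 s : R, `|s| <= `|t| & h (t *: v + x) - h x = t * 'D_v h (s *: v + x).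
Proof.
move=> dh; pose g (s : R) := h (s *: v + x).
have dg (s : R) : `|s| <= `|t| -> is_derive s 1 g ('D_v h (s *: v + x)).
  by move=> /dh /derivable_line.
have g0 : h x = g 0 by rewrite /g scale0r add0r.
have cg (a b : R) : (forall s : R, s \in `[a, b] -> `|s| <= `|t|) -> {within `[a, b], continuous g}.
  move=> ab; by apply: derivable_within_continuous => s /ab /dg [].
have [t0|t0|<-] := ltgtP 0 t.
- have H (s : R) : s \in `[0, t] -> `|s| <= `|t|.
    by rewrite in_itv /= => /andP[ts s0]; rewrite ger0_norm// gtr0_norm// lerN2.
  have [s sI e] := @MVT R g (fun s => 'D_v h (s *: v + x)) 0 t t0
    (fun s sI => dg s (H s (subset_itv_oo_cc sI))) (cg _ _ H).
  exists s; first exact/H/subset_itv_oo_cc.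
  rewrite g0 -/(g t) e; ring.
- have H (s : R) : s \in `[t, 0] -> `|s| <= `|t|.
    by rewrite in_itv /= => /andP[ts s0]; rewrite ler0_norm// ltr0_norm// lerN2.
  have [s sI e] := @MVT R g (fun s => 'D_v h (s *: v + x)) t 0 t0
    (fun s sI => dg s (H s (subset_itv_oo_cc sI))) (cg _ _ H).
  exists s; first exact/H/subset_itv_oo_cc.
  rewrite g0 -/(g t); apply/oppr_inj; rewrite opprB e; ring.
- by exists 0; rewrite ?normr0// scale0r add0r subrr mul0r.
Qed.

Lemma mx_norm_le v (d : R) : 0 <= d -> (`|v| <= d) = [forall i, `|v 0 i| <= d].
Proof.
move=> d0; rewrite [`|v|]mx_normrE; apply/bigmax_leP/forallP => [[_ H] i|H].
  exact: (H (0, i)).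
by split => // -[j i] _ /=; rewrite (ord1 j) H.
Qed.

Lemma mx_norm_ge v i : `|v 0 i| <= `|v|.
Proof. by move: (lexx `|v|); rewrite {1}mx_norm_le// => /forallP. Qed.

Definition row_combination (c : 'I_n -> R) v : R := \sum_i v 0 i * c i.

Lemma row_combination_is_linear c : linear (row_combination c).
Proof.
move=> a u v; rewrite /row_combination scaler_sumr -big_split /=; apply: eq_bigr => i _.
by rewrite !mxE mulrDl -mulrA.
Qed.
HB.instance Definition _ c := GRing.isLinear.Build R 'rV[R]_n R _
  (row_combination c) (row_combination_is_linear c).

Lemma row_combination_continuous c : continuous (row_combination c).
Proof.
apply: continuous_big => [|i _ x]; first exact: add_continuous.
apply: (@continuousM _ _ (fun v : 'rV[R]_n => v 0 i) (cst (c i))).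
exact: (@coord_continuous R 1 n 0 i x).
exact: cst_continuous.
Qed.

(** The increment is split into steps parallel to the axes, each controlled by the mean value
    theorem and the continuity of one partial derivative. *)
Lemma differentiable_of_partial h x :
  (\forall y \near x, forall i, derivable h y (e_ i)) ->
  (forall i, {for x, continuous (partial i h)}) ->
  differentiable h x /\ 'd h x = row_combination (fun i => partial i h x) :> (_ -> _).
Proof.
move=> dh ch; pose L := row_combination (fun i => partial i h x).
pose V : normedModType R := 'rV[R]_n; pose W : normedModType R := R.
suff H : (h : V -> W) \o shift x = cst (h x : W) + (L : V -> W) +o_ (0 : V) id.
  have e := @diff_unique _ V W h L x (@row_combination_continuous _) H.
  split => //; apply/diff_locallyP; rewrite e; split => //.
  exact: row_combination_continuous.
apply/eqaddoP => e e0.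
(* Dividing by [n.+1] covers n = 0; the n steps together cost at most n d |v| <= e |v|. *)
pose d := e / n.+1%:R; have d0 : 0 < d by rewrite divr_gt0.
have A : \forall y \near x, forall i, `|partial i h x - partial i h y| <= d.
  apply: (@filter_forall _ _
    (fun i => [set y | `|partial i h x - partial i h y| <= d]) (nbhs x)) => i.
  exact: (cvgrPdist_le _ _).1 (ch i) d d0.
have [r /= r0 Br] := (nbhs_ballP x _).1 (filterI dh A).
near=> v.
have vr : `|v| < r.
  near: v; apply/(nbhs_ballP (0 : V)); exists r => // y.
  by rewrite -ball_normE /ball_ /= sub0r normrN.
(* [w k] keeps the first k coordinates of [v]. For the sup norm all points on these steps stay
   within |v| of the origin. *)
pose w k : 'rV[R]_n := \row_j (if (j < k)%N then v 0 j else 0).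
have w0 : w 0%N = 0 by apply/rowP => j; rewrite !mxE.
have wn : w n = v by apply/rowP => j; rewrite !mxE ltn_ord.
have step (k : 'I_n) : `|h (w k.+1 + x) - h (w k + x) - v 0 k * partial k h x| <= d * `|v|.
  have Bs (s : R) : `|s| <= `|v 0 k| -> ball x r (s *: e_ k + (w k + x)).
    move=> sv; rewrite -ball_normE /ball_ /= addrA -[_ - (_ + x)]opprB normrN addrK.
    apply: le_lt_trans vr; rewrite mx_norm_le//; apply/forallP => j; rewrite !mxE eqxx /=.
    have [->|kj] := eqVneq j k; rewrite ?ltnn ?mulr1 ?mulr0 ?addr0 ?add0r.
      exact: le_trans sv (mx_norm_ge _ _).
    by case: ifP => _; rewrite ?normr0// mx_norm_ge.
  have -> : w k.+1 + x = v 0 k *: e_ k + (w k + x).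
    rewrite addrA; congr (_ + _); apply/rowP => j; rewrite !mxE eqxx ltnS /=.
    have [->|kj] := eqVneq j k; rewrite ?leqnn ?ltnn ?mulr1 ?mulr0 ?addr0 ?add0r//.
    by rewrite leq_eqVlt val_eqE (negbTE kj).
  have [s sv ->] := @line_mvt h (w k + x) (e_ k) (v 0 k)
    (fun s sv => (Br _ (Bs s sv)).1 k).
  rewrite -mulrBr normrM mulrC distrC ler_pM//; last exact: mx_norm_ge.
  exact: (Br _ (Bs s sv)).2 k.
have -> : (h \o shift x - (cst (h x) + L)) v =
    \sum_(k < n) (h (w k.+1 + x) - h (w k + x) - v 0 k * partial k h x).
  rewrite sumrB -(big_mkord xpredT (fun k => h (w k.+1 + x) - h (w k + x))).
  by rewrite telescope_sumr// wn w0 add0r /= opprD addrA.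
rewrite (le_trans (ler_norm_sum _ _ _))//.
rewrite (le_trans (ler_sum _ (fun k _ => step k)))//.
rewrite sumr_const card_ord -[X in X <= _]mulr_natr mulrAC ler_wpM2r//.
rewrite /d -mulrA ler_piMr ?(ltW e0)// mulrC ler_pdivrMr ?mul1r ?ler_nat//.
Unshelve. all: by end_near. Qed.

Variable U : set 'rV[R]_n.
Hypothesis Uo : open U.

Lemma smooth_on_differentiable h x : smooth_on U h -> U x ->
  differentiable h x /\ 'd h x = row_combination (fun i => partial i h x) :> (_ -> _).
Proof.
move=> sh Ux; have nU : \forall y \near x, U y by exact: open_nbhs_nbhs.
apply: differentiable_of_partial.
  by apply: filterS nU => y Uy i; exact: ((sh [::]).2 i y Uy).
move=> i; have [c _] := sh [:: i].
move: c; rewrite continuous_open_subspace// => /(_ x); apply; exact: mem_set.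
Qed.

Lemma smooth_on_derive_row h x v : smooth_on U h -> U x ->
  'D_v h x = \sum_i v 0 i * partial i h x.
Proof.
by move=> sh Ux; have [dh e] := smooth_on_differentiable sh Ux; rewrite deriveE// e.
Qed.

Lemma smooth_on_curve h (g : R -> 'rV[R]_n) (t : R) : smooth_on U h -> U (g t) ->
  (forall j, derivable (fun s => g s 0 j) t 1) ->
  is_derive t 1 (h \o g) (\sum_j 'D_1 (fun s => g s 0 j) t * partial j h (g t)).
Proof.
move=> sh Ugt dg; have [dh e] := smooth_on_differentiable sh Ugt.
have dg1 : derivable g t 1 by apply/derivable_mxP => i j; rewrite (ord1 i).
have dgt : differentiable g t by exact/derivable1_diffP.
have dhg : differentiable (h \o g) t by exact: differentiable_comp.
apply: DeriveDef; first exact/derivable1_diffP.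
rewrite deriveE// diff_comp//= e /row_combination -deriveE// derive_mx//.
by apply: eq_bigr => j _; rewrite mxE.
Qed.

End Analysis.

(** * Symmetry of second partial derivatives *)

Section Schwarz.
Variables (R : realType) (n : nat) (U : set 'rV[R]_n).
Hypothesis Uo : open U.
Implicit Types (h : 'rV[R]_n -> R) (x v : 'rV[R]_n).
Local Notation e_ := (@basis_vector R n).

Lemma is_derive_translate h x v c : derivable h (x + c) v ->
  is_derive x v (fun y => h (y + c)) ('D_v h (x + c)).
Proof.
move=> dh; have e : (fun k : R => k^-1 *: (((fun y => h (y + c)) \o shift x) (k *: v)
    - h (x + c))) =
  (fun k => k^-1 *: ((h \o shift (x + c)) (k *: v) - h (x + c))).
  by apply/funext => k /=; rewrite addrA.
by apply: DeriveDef; rewrite /derivable /derive e.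
Qed.

Lemma iter_partial_rcons s i h :
  iter_partial (rcons s i) h = iter_partial s (partial i h).
Proof. by rewrite /iter_partial -cats1 foldr_cat. Qed.

Lemma smooth_on_partial i h : smooth_on U h -> smooth_on U (partial i h).
Proof. by move=> sh s; rewrite -iter_partial_rcons; exact: sh. Qed.

Lemma smooth_on_derivable i h x : smooth_on U h -> U x -> derivable h x (e_ i).
Proof. by move=> sh Ux; exact: (sh [::]).2. Qed.

Lemma smooth_on_continuous h x : smooth_on U h -> U x -> {for x, continuous h}.
Proof.
move=> sh Ux; have [c _] := sh [::].
move: c; rewrite continuous_open_subspace// => /(_ x); apply; exact: mem_set.
Qed.

Lemma norm_basis_vector i : `|e_ i| <= 1.
Proof.
rewrite mx_norm_le//; apply/forallP => j; rewrite mxE eqxx /=.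
by case: eqP; rewrite ?normr1 ?normr0.
Qed.

(** Mean value theorem in direction i for [phi], a difference in direction j, then in direction j
    for [partial i h]. The left-hand side is symmetric in i and j up to the order of its terms. *)
Lemma second_difference h x i j (t : R) : 0 <= t -> smooth_on U h ->
    (forall y, `|y - x| <= t *+ 2 -> U y) ->
  exists2 y, `|y - x| <= t *+ 2 &
  h (t *: e_ i + x + t *: e_ j) - h (t *: e_ i + x) - h (x + t *: e_ j) + h x
  = t * (t * partial j (partial i h) y).
Proof.
move=> t0 sh Bx.
have ne (s s' : R) : `|s| <= t -> `|s'| <= t -> `|s *: e_ i + s' *: e_ j| <= t *+ 2.
  move=> st st'; rewrite (le_trans (ler_normD _ _))// !normrZ mulr2n lerD//.
    by rewrite (le_trans _ st)// ler_piMr// norm_basis_vector.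
  by rewrite (le_trans _ st')// ler_piMr// norm_basis_vector.
have Us (s s' : R) : `|s| <= t -> `|s'| <= t -> `|s *: e_ i + x + s' *: e_ j - x| <= t *+ 2.
  by move=> st st'; rewrite addrAC addrK ne.
have tt : `|t| = t by rewrite ger0_norm.
have t00 : `|0 : R| <= t by rewrite normr0.
pose phi y := h (y + t *: e_ j) - h y.
have dphi (s : R) : `|s| <= `|t| -> is_derive (s *: e_ i + x) (e_ i) phi
    (partial i h (s *: e_ i + x + t *: e_ j) - partial i h (s *: e_ i + x)).
  rewrite tt => st; apply: is_deriveB.
    apply: is_derive_translate; apply: smooth_on_derivable => //.
    by apply/Bx/Us => //; rewrite tt.
  apply: derivableP; apply: smooth_on_derivable => //.
  by apply: Bx; have := Us s 0 st t00; rewrite scale0r addr0.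
have [s st e] := line_mvt (fun s st => @ex_derive _ _ _ _ _ _ _ (dphi s st)).
have -> : h (t *: e_ i + x + t *: e_ j) - h (t *: e_ i + x) - h (x + t *: e_ j) + h x
    = phi (t *: e_ i + x) - phi x by rewrite /phi; ring.
rewrite e (@derive_val _ _ _ _ _ _ _ (dphi s st)).
have := @line_mvt _ _ (partial i h) (s *: e_ i + x) (e_ j) t.
rewrite tt => H.
have [|s' st' e'] := H.
  move=> s' st'; apply: smooth_on_derivable; first exact: smooth_on_partial.
  by apply: Bx; rewrite [s' *: _ + _]addrC Us// -tt.
rewrite [s *: _ + x + _]addrC e'.
by exists (s' *: e_ j + (s *: e_ i + x)) => //; rewrite [s' *: _ + _]addrC Us// -tt.
Qed.

(** The two orders of differentiation produce different mean value points; by continuity it is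
    enough that both can be taken arbitrarily close to x. *)
Lemma eq_of_common_values (a b : 'rV[R]_n -> R) x :
  {for x, continuous a} -> {for x, continuous b} ->
  (forall r, 0 < r -> exists y z, [/\ ball x r y, ball x r z & a y = b z]) ->
  a x = b x.
Proof.
move=> ca cb H; apply/eqP; rewrite -subr_eq0 -normr_le0; apply/ler_addgt0Pr => e e0.
have e20 : 0 < e / 2 by rewrite divr_gt0.
have A : \forall y \near x, `|a x - a y| <= e / 2.
  exact: (cvgrPdist_le _ _).1 ca (e / 2) e20.
have B : \forall y \near x, `|b x - b y| <= e / 2.
  exact: (cvgrPdist_le _ _).1 cb (e / 2) e20.
have [r /= r0 Br] := (nbhs_ballP x _).1 (filterI A B).
have [y [z [/Br[H1 _] /Br[_ H2] ab]]] := H r r0.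
have -> : a x - b x = (a x - a y) - (b x - b z) by rewrite ab; ring.
by rewrite add0r (le_trans (ler_normB _ _))// [leRHS]splitr lerD.
Qed.

Lemma partialC h x i j : smooth_on U h -> U x ->
  partial i (partial j h) x = partial j (partial i h) x.
Proof.
move=> sh Ux; apply: eq_of_common_values.
- exact: smooth_on_continuous (smooth_on_partial _ (smooth_on_partial _ sh)) Ux.
- exact: smooth_on_continuous (smooth_on_partial _ (smooth_on_partial _ sh)) Ux.
move=> r r0.
have [d /= d0 Bd] := (nbhs_ballP x _).1 (open_nbhs_nbhs (conj Uo Ux)).
(* Points within 2 t of x then lie in both balls, since 2 t is half the smaller radius. *)
pose t := Num.min r d / 4.
have rd0 : 0 < Num.min r d by rewrite lt_min r0.
have t0 : 0 < t by rewrite divr_gt0.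
have mr : Num.min r d <= r by rewrite ge_min lexx.
have md : Num.min r d <= d by rewrite ge_min lexx orbT.
have near y : `|y - x| <= t *+ 2 -> ball x (Num.min r d) y.
  move=> yx; rewrite -ball_normE /ball_ /= distrC (le_lt_trans yx)// /t.
  by rewrite -mulr_natr; lra.
have BU y : `|y - x| <= t *+ 2 -> U y.
  by move=> /near /(le_ball md)/Bd.
have [y1 ny1 e1] := second_difference i j (ltW t0) sh BU.
have [y2 ny2 e2] := second_difference j i (ltW t0) sh BU.
exists y2, y1; split; [exact: le_ball mr _ (near _ ny2)|
  exact: le_ball mr _ (near _ ny1)|].
apply: (mulfI (lt0r_neq0 t0)); apply: (mulfI (lt0r_neq0 t0)).
apply: etrans (esym e2) (etrans _ e1).
rewrite [x + t *: e_ j]addrC [x + t *: e_ i]addrC.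
have -> : t *: e_ j + x + t *: e_ i = t *: e_ i + x + t *: e_ j.
  by rewrite addrC addrA addrAC.
ring.
Qed.

End Schwarz.

(** * First and second order conditions at a maximum *)

Section LocalMaximum.
Variables (R : realType) (n : nat) (U : set 'rV[R]_n).
Hypothesis Uo : open U.
Variables (h : 'rV[R]_n -> R) (x : 'rV[R]_n).
Hypothesis hU : smooth_on U h.
Hypothesis Ux : U x.
Hypothesis hmax : forall y, U y -> h y <= h x.

Let near_line (v : 'rV[R]_n) : \forall t \near (0 : R), U (t *: v + x).
Proof.
have c : {for (0 : R), continuous (fun t : R => t *: v + x)}.
  by apply: cvgD; [exact: scalel_continuous|exact: cvg_cst].
by apply: c; rewrite scale0r add0r; apply: open_nbhs_nbhs.
Qed.

Let is_derive_line (v : 'rV[R]_n) (t : R) : U (t *: v + x) ->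
  is_derive t 1 (fun t => h (t *: v + x)) ('D_v h (t *: v + x)).
Proof.
move=> Ut; apply: derivable_line; apply: diff_derivable.
exact: (smooth_on_differentiable Uo hU Ut).1.
Qed.

Lemma derive_at_max v : 'D_v h x = 0.
Proof.
have [d /= d0 Bd] := (nbhs_ballP (0 : R) _).1 (near_line v).
have dU (t : R) : t \in `](- d), d[ -> U (t *: v + x).
  rewrite in_itv /= => td; apply: Bd.
  by rewrite -ball_normE /ball_ /= sub0r normrN ltr_norml.
have d00 : (0 : R) \in `](- d), d[ by rewrite in_itv /= oppr_lt0 d0.
have U0 := dU 0 d00.
have [_ <-] : is_derive (0 : R) 1 (fun t : R => h (t *: v + x)) 0.
  apply: (@derive1_at_max _ _ (- d) d) => //.
  - by rewrite (le_trans (y := 0))// ?oppr_le0 ltW.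
  - by move=> t /dU /is_derive_line [].
  - by move=> t /dU Ut; rewrite scale0r add0r hmax.
by have [_ ->] := is_derive_line U0; rewrite scale0r add0r.
Qed.

Lemma partial_at_max i : partial i h x = 0.
Proof. exact: derive_at_max. Qed.

(** Otherwise the derivative [G] of h along the line, which vanishes at 0, has the positive
    derivative [c] there. It is then positive for small t > 0, and the mean value theorem produces a
    value above the maximum. *)
Lemma hessian_at_max (v : 'rV[R]_n) :
  \sum_i \sum_j v 0 i * v 0 j * partial i (partial j h) x <= 0.
Proof.
rewrite leNgt; apply/negP; set c := (X in 0 < X) => c0.
pose G (t : R) := \sum_j v 0 j * partial j h (t *: v + x).
have GE (t : R) : U (t *: v + x) -> 'D_v h (t *: v + x) = G t.
  by move=> Ut; rewrite (smooth_on_derive_row Uo).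
have U0 : U ((0 : R) *: v + x) by rewrite scale0r add0r.
have G0 : G 0 = 0 by rewrite -(GE _ U0) scale0r add0r derive_at_max.
have dG : is_derive (0 : R) 1 G c.
  rewrite (_ : G = \sum_j (fun t : R => v 0 j * partial j h (t *: v + x))); last first.
    by apply/funext => t; rewrite fct_sumE.
  rewrite /c exchange_big /=; apply: is_derive_sum => j.
  apply: is_derive_eq.
    apply: is_deriveM; apply: derivable_line; apply: diff_derivable.
    by apply: (smooth_on_differentiable Uo _ U0).1; apply: smooth_on_partial.
  rewrite /= (smooth_on_derive_row Uo v (smooth_on_partial j hU) U0).
  rewrite /= scaler0 addr0 scale0r add0r scaler_sumr; apply: eq_bigr => i _.
  by rewrite -[LHS]/(v 0 j * _) mulrCA mulrA.
have cG : (fun t : R => t^-1 * G t) @ 0^' --> c.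
  have [dG1 <-] := dG.
  have -> : (fun t : R => t^-1 * G t) =
      (fun k : R => k^-1 *: ((G \o shift 0) (k *: 1) - G 0)); last exact: dG1.
  by apply/funext => t /=; rewrite G0 subr0 addr0 [_%:A]mulr1.
have pos : nbhs (0 : R) [set t | t != 0 -> 0 < t^-1 * G t].
  exact: (cvgr_gt c cG 0 c0).
have [d /= d0 Bd] := (nbhs_ballP (0 : R) _).1 (filterI (near_line v) pos).
have t0 : 0 < d / 2 by rewrite divr_gt0.
have td (t : R) : 0 <= t -> t <= d / 2 -> ball (0 : R) d t.
  move=> ? ?; rewrite -ball_normE /ball_ /= sub0r normrN ger0_norm//.
  by apply: le_lt_trans (_ : d / 2 < d) => //; rewrite gtr_pMr// invf_lt1// ltr1n.
have dU (t : R) : 0 <= t -> t <= d / 2 -> U (t *: v + x).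
  by move=> t1 t2; have [] := Bd _ (td _ t1 t2).
have [||s] := @MVT R (fun t : R => h (t *: v + x)) (fun t => 'D_v h (t *: v + x)) _ _ t0.
- by move=> s; rewrite in_itv /= => /andP[s0 s1]; apply/is_derive_line/dU; exact: ltW.
- apply: derivable_within_continuous => s; rewrite in_itv /= => /andP[s0 s1].
  by have [] := is_derive_line (dU s s0 s1).
rewrite in_itv /= => /andP[s0 s1] e.
have Us := dU _ (ltW s0) (ltW s1).
have [_ /(_ (lt0r_neq0 s0))] := Bd _ (td _ (ltW s0) (ltW s1)).
rewrite pmulr_rgt0 ?invr_gt0// -GE// => Gs.
have := hmax (dU _ (ltW t0) (lexx _)).
by rewrite leNgt -subr_gt0; move: e; rewrite scale0r add0r => ->; rewrite mulr_gt0// subr0.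
Qed.

End LocalMaximum.

(** * Closure properties of smooth functions *)

Section SmoothClosure.
Variables (R : realType) (n : nat).
Implicit Types (U V : set 'rV[R]_n) (h : 'rV[R]_n -> R) (x v : 'rV[R]_n).
Local Notation e_ := (@basis_vector R n).

Lemma is_derive_lineP h x v d :
  is_derive x v h d <-> is_derive (0 : R) 1 (fun s => h (s *: v + x)) d.
Proof.
have e : (fun k : R => k^-1 *: (((fun s : R => h (s *: v + x)) \o shift 0) (k *: 1)
    - h (0 *: v + x))) =
  (fun k => k^-1 *: ((h \o shift x) (k *: v) - h x)).
  by apply/funext => k /=; rewrite [k *: 1]mulr1 scale0r add0r addr0.
split=> -[d1 d2]; split; move: d1 d2; by rewrite /derivable /derive e.
Qed.

Lemma is_derive_comp1 (g : R -> R) h x v a b :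
  is_derive (h x) 1 g a -> is_derive x v h b -> is_derive x v (g \o h) (a * b).
Proof.
move=> dg /is_derive_lineP dh; apply/is_derive_lineP.
by apply: (@is_derive1_comp _ g (fun s => h (s *: v + x))); rewrite ?scale0r ?add0r.
Qed.

(* The derivative of such a function is again one, and they are all continuous:
   this gives smoothness without a formula for higher derivatives. *)
Inductive smooth_expr U : ('rV[R]_n -> R) -> Prop :=
| SmoothBase h of smooth_on U h : smooth_expr U h
| SmoothCst c : smooth_expr U (fun=> c)
| SmoothAdd f g of smooth_expr U f & smooth_expr U g : smooth_expr U (f \+ g)
| SmoothMul f g of smooth_expr U f & smooth_expr U g : smooth_expr U (f \* g)
| SmoothInv h of smooth_expr U h & (forall x, U x -> h x != 0) :
    smooth_expr U (fun x => (h x)^-1)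
| SmoothSqrt h of smooth_expr U h & (forall x, U x -> 0 < h x) :
    smooth_expr U (fun x => Num.sqrt (h x))
| SmoothComp V (phi : 'rV[R]_n -> 'rV[R]_n) h of open V & smooth_on V h
    & (forall j, smooth_on U (fun x => phi x 0 j)) & (forall x, U x -> V (phi x)) :
    smooth_expr U (h \o phi).

Lemma smooth_expr_sum U (I : Type) (s : seq I) (F : I -> 'rV[R]_n -> R) :
  (forall i, smooth_expr U (F i)) -> smooth_expr U (fun x => \sum_(i <- s) F i x).
Proof.
move=> sF; elim: s => [|i s IH].
  by rewrite (_ : (fun=> _) = fun=> 0); [exact: SmoothCst|apply/funext => x; rewrite big_nil].
rewrite (_ : (fun=> _) = F i \+ (fun x => \sum_(i <- s) F i x)).
  exact: SmoothAdd.
by apply/funext => x; rewrite big_cons.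
Qed.

Variable U : set 'rV[R]_n.
Hypothesis Uo : open U.

Lemma smooth_expr_partial f : smooth_expr U f -> forall i, exists2 f', smooth_expr U f' &
  forall x, U x -> is_derive x (e_ i) f (f' x).
Proof.
elim=> {f}[h sh|c|f g sf IHf sg IHg|f g sf IHf sg IHg|h sh IHh h0|h sh IHh h0
    |V phi h Vo sh sphi UV] i.
- exists (partial i h); first by apply/SmoothBase/smooth_on_partial.
  by move=> x Ux; apply/derivableP; exact: smooth_on_derivable sh Ux.
- by exists (fun=> 0); [exact: SmoothCst|move=> x _; exact: is_derive_cst].
- have [f' sf' df] := IHf i; have [g' sg' dg] := IHg i.
  exists (f' \+ g'); first exact: SmoothAdd.
  by move=> x Ux; apply: is_deriveD; [exact: df|exact: dg].
- have [f' sf' df] := IHf i; have [g' sg' dg] := IHg i.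
  exists ((f \* g') \+ (g \* f')); first by apply: SmoothAdd; exact: SmoothMul.
  move=> x Ux; apply: is_deriveM; [exact: df|exact: dg].
- have [h' sh' dh] := IHh i.
  exists ((fun=> -1) \* (((fun x => (h x)^-1) \* (fun x => (h x)^-1)) \* h')).
    by do ! [exact: SmoothCst|exact: SmoothInv|apply: SmoothMul|exact: sh'].
  move=> x Ux; have -> : ((fun=> -1) \* (((fun x => (h x)^-1) \* (fun x => (h x)^-1)) \* h')) x
      = - (h x) ^- 2 * h' x by rewrite /= expr2 invfM; ring.
  have [d1 <-] := dh _ Ux; split; first exact: derivableV (h0 _ Ux) d1.
  by rewrite deriveV// h0.
- have [h' sh' dh] := IHh i.
  exists ((fun=> 2^-1) \* ((fun x => (Num.sqrt (h x))^-1) \* h')).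
    apply: SmoothMul; first exact: SmoothCst.
    apply: SmoothMul => //; apply: SmoothInv; first exact: SmoothSqrt.
    by move=> x Ux; rewrite gt_eqF// sqrtr_gt0 h0.
  move=> x Ux; have := is_derive_comp1 (is_derive1_sqrt (h0 _ Ux)) (dh _ Ux).
  by rewrite invfM -mulrA.
- exists (fun x => \sum_j (partial i (fun y => phi y 0 j) \* (partial j h \o phi)) x).
    apply: smooth_expr_sum => j; apply: SmoothMul.
      exact/SmoothBase/smooth_on_partial.
    exact: SmoothComp Vo (smooth_on_partial j sh) sphi UV.
  move=> x Ux; apply/is_derive_lineP.
  have dphi j := (is_derive_lineP _ _ _ _).1 (derivableP (@smooth_on_derivable _ _ _ i _ _ (sphi j) Ux)).
  have := @smooth_on_curve _ _ V Vo h (fun s : R => phi (s *: e_ i + x)) 0 sh.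
  rewrite scale0r add0r => /(_ (UV _ Ux) (fun j => @ex_derive _ _ _ _ _ _ _ (dphi j))).
  move=> H; apply: (is_derive_eq H); apply: eq_bigr => j _ /=.
  by rewrite (@derive_val _ _ _ _ _ _ _ (dphi j)).
Qed.

Lemma smooth_components_continuous (phi : 'rV[R]_n -> 'rV[R]_n) x :
  (forall j, smooth_on U (fun x => phi x 0 j)) -> U x -> {for x, continuous phi}.
Proof.
move=> sphi Ux.
have H e : 0 < e -> \forall y \near x, `|phi x - phi y| <= e.
  move=> e0; have Hj : \forall y \near x, forall j, `|phi x 0 j - phi y 0 j| <= e.
    apply: (@filter_forall _ _ (fun j => [set y | `|phi x 0 j - phi y 0 j| <= e])
      (nbhs x)) => j.
    exact: ((cvgrPdist_le _ _).1 (smooth_on_continuous Uo (sphi j) Ux) e e0).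
  apply: filterS Hj => y Hy; rewrite mx_norm_le ?(ltW e0)//.
  by apply/forallP => j; rewrite !mxE.
exact: ((@cvgrPdist_le _ _ _ (nbhs x) _ phi (phi x)).2 H).
Qed.

Lemma smooth_expr_continuous f x : smooth_expr U f -> U x -> {for x, continuous f}.
Proof.
move=> sf Ux; elim: sf => {f}[h sh|c|f g sf IHf sg IHg|f g sf IHf sg IHg|h sh IHh h0|h sh IHh h0
    |V phi h Vo sh sphi UV].
- exact: smooth_on_continuous sh Ux.
- exact: cst_continuous.
- exact: continuousD.
- exact: continuousM.
- by apply: continuousV => //; exact: h0.
- by apply: continuous_comp => //; exact: sqrt_continuous.
- apply: (@continuous_comp _ _ _ phi h x); last exact: smooth_on_continuous sh (UV _ Ux).
  exact: smooth_components_continuous.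
Qed.

Lemma eq_on_near (f g : 'rV[R]_n -> R) x : (forall y, U y -> f y = g y) -> U x ->
  {near x, f =1 g}.
Proof.
by move=> fg Ux; apply: filterS fg _; exact: open_nbhs_nbhs.
Qed.

Lemma smooth_expr_smooth f : smooth_expr U f -> smooth_on U f.
Proof.
move=> sf s.
(* The iterated partial derivatives agree with an expression of the class on U only; as U is open,
   this is enough to differentiate again. *)
have [f' sf' e] : exists2 f', smooth_expr U f' & forall x, U x -> f' x = iter_partial s f x.
  elim: s => [|i s [f' sf' e]]; first by exists f.
  have [f'' sf'' e'] := smooth_expr_partial sf' i.
  exists f'' => // x Ux; have [_ <-] := e' _ Ux.
  exact: near_eq_derive (eq_on_near e Ux).
split.
  rewrite continuous_open_subspace// => x /set_mem Ux.
  have := smooth_expr_continuous sf' Ux.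
  rewrite /prop_for /continuous_at (e _ Ux) => H; apply: cvg_trans H.
  apply: (@near_eq_cvg _ _ (nbhs x) _ f' (iter_partial s f)).
  exact: eq_on_near e Ux.
move=> i x Ux; have [f'' _ /(_ _ Ux)[d _]] := smooth_expr_partial sf' i.
exact: near_eq_derivable (eq_on_near e Ux) d.
Qed.

End SmoothClosure.

(** * The ring of smooth functions on an open set *)

Record open_domain (R : realType) (n : nat) := OpenDomain {
  domain_set :> 'rV[R]_n -> Prop;
  domain_open : open (domain_set : set 'rV[R]_n)
}.

(* Extending by zero makes equality of functions on the domain Leibniz equality. *)
Record smf (R : realType) (n : nat) (D : open_domain R n) := Smf {
  smf_val :> 'rV[R]_n -> R;
  smfP : smooth_on D smf_val /\ forall x, ~ D x -> smf_val x = 0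
}.

HB.instance Definition _ R n (D : open_domain R n) := gen_eqMixin (smf D).
HB.instance Definition _ R n (D : open_domain R n) := gen_choiceMixin (smf D).

Section Smf.
Variables (R : realType) (n : nat) (D : open_domain R n).
Implicit Types (f g : smf D).
Let Do := @domain_open R n D.

Lemma smf_smooth f : smooth_on D f. Proof. by case: (smfP f). Qed.

Lemma smf_out f x : ~ D x -> f x = 0. Proof. by case: (smfP f) => _; apply. Qed.

Lemma smf_eq f g : (forall x, D x -> f x = g x) -> f = g.
Proof.
move=> fg; have e : smf_val f = smf_val g.
  apply/funext => x; have [Dx|Dx] := pselect (D x); first exact: fg.
  by rewrite !smf_out.
case: f e {fg} => f fP; case: g => g gP /= e; move: fP; rewrite e => fP.
by congr Smf; exact: Prop_irrelevance.
Qed.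

Lemma smooth_on_eq (h k : 'rV[R]_n -> R) :
  (forall x, D x -> h x = k x) -> smooth_on D h -> smooth_on D k.
Proof.
move=> hk sh s.
have e x : D x -> iter_partial s h x = iter_partial s k x.
  elim: s x => [|i s IH] x Dx; first exact: hk.
  exact: near_eq_derive (eq_on_near Do IH Dx).
have [c d] := sh s; split.
  move: c; rewrite !continuous_open_subspace// => c x /[dup] /c + /set_mem Dx.
  rewrite /prop_for /continuous_at (e _ Dx) => H; apply: cvg_trans H.
  apply: (@near_eq_cvg _ _ (nbhs x) _ (iter_partial s h) (iter_partial s k)).
  exact: eq_on_near e Dx.
move=> i x Dx; exact: near_eq_derivable (eq_on_near Do e Dx) (d i x Dx).
Qed.

Definition restrict_to (h : 'rV[R]_n -> R) : 'rV[R]_n -> R :=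
  fun x => if `[< D x >] then h x else 0.

Lemma restrict_toE h x : D x -> restrict_to h x = h x.
Proof. by rewrite /restrict_to; case: asboolP. Qed.

Lemma restrict_toP h : smooth_on D h ->
  smooth_on D (restrict_to h) /\ forall x, ~ D x -> restrict_to h x = 0.
Proof.
move=> sh; split; last by move=> x; rewrite /restrict_to; case: asboolP.
by apply: smooth_on_eq sh => x Dx; rewrite restrict_toE.
Qed.

(* Opaque witnesses keep unification from unfolding the ring operations. *)
Fact smf_exists h : smooth_on D h -> {f : smf D | forall x, D x -> f x = h x}.
Proof. by move=> sh; exists (Smf (restrict_toP sh)) => x; exact: restrict_toE. Qed.

Definition mk_smf h (sh : smooth_on D h) : smf D := sval (smf_exists sh).

Lemma mk_smfE h (sh : smooth_on D h) x : D x -> mk_smf sh x = h x.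
Proof. exact: (svalP (smf_exists sh)). Qed.

Let base f := SmoothBase (smf_smooth f).

Fact smf_cst_exists c : {f : smf D | forall x, D x -> f x = c}.
Proof.
exact: (smf_exists (smooth_expr_smooth Do (SmoothCst D c))).
Qed.
Definition smf_cst (c : R) : smf D := sval (smf_cst_exists c).

Fact smf_add_exists f g : {k : smf D | forall x, D x -> k x = f x + g x}.
Proof.
exact: (smf_exists (smooth_expr_smooth Do (SmoothAdd (base f) (base g)))).
Qed.
Definition smf_add f g := sval (smf_add_exists f g).

Fact smf_mul_exists f g : {k : smf D | forall x, D x -> k x = f x * g x}.
Proof.
exact: (smf_exists (smooth_expr_smooth Do (SmoothMul (base f) (base g)))).
Qed.
Definition smf_mul f g := sval (smf_mul_exists f g).

Definition smf_opp f := smf_mul (smf_cst (-1)) f.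

Lemma smf_addE f g x : smf_add f g x = f x + g x.
Proof.
have [Dx|Dx] := pselect (D x); first exact: (svalP (smf_add_exists f g)).
by rewrite !smf_out// addr0.
Qed.

Lemma smf_mulE f g x : smf_mul f g x = f x * g x.
Proof.
have [Dx|Dx] := pselect (D x); first exact: (svalP (smf_mul_exists f g)).
by rewrite !smf_out// mulr0.
Qed.

Lemma smf_cstE c x : D x -> smf_cst c x = c.
Proof. exact: (svalP (smf_cst_exists c)). Qed.

Let smf_opp0 : left_inverse (smf_cst 0) smf_opp smf_add.
Proof.
by move=> f; apply: smf_eq => x Dx; rewrite smf_addE smf_mulE !smf_cstE// mulN1r addNr.
Qed.

Let smf_addA : associative smf_add.
Proof. by move=> f g h; apply: smf_eq => x Dx; rewrite !smf_addE addrA. Qed.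
Let smf_addC : commutative smf_add.
Proof. by move=> f g; apply: smf_eq => x Dx; rewrite !smf_addE addrC. Qed.
Let smf_add0 : left_id (smf_cst 0) smf_add.
Proof. by move=> f; apply: smf_eq => x Dx; rewrite smf_addE smf_cstE// add0r. Qed.

HB.instance Definition _ := GRing.isZmodule.Build (smf D)
  smf_addA smf_addC smf_add0 smf_opp0.

Let smf_mulA : associative smf_mul.
Proof. by move=> f g h; apply: smf_eq => x Dx; rewrite !smf_mulE mulrA. Qed.
Let smf_mulC : commutative smf_mul.
Proof. by move=> f g; apply: smf_eq => x Dx; rewrite !smf_mulE mulrC. Qed.
Let smf_mul1 : left_id (smf_cst 1) smf_mul.
Proof. by move=> f; apply: smf_eq => x Dx; rewrite smf_mulE smf_cstE// mul1r. Qed.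
Let smf_mulD : left_distributive smf_mul +%R.
Proof.
by move=> f g h; apply: smf_eq => x Dx; rewrite smf_mulE !smf_addE !smf_mulE mulrDl.
Qed.

HB.instance Definition _ := GRing.Zmodule_isComPzRing.Build (smf D)
  smf_mulA smf_mulC smf_mul1 smf_mulD.

Lemma smf_valD f g x : (f + g) x = f x + g x. Proof. exact: smf_addE. Qed.
Lemma smf_valM f g x : (f * g) x = f x * g x. Proof. exact: smf_mulE. Qed.
Lemma smf_val0 x : (0 : smf D) x = 0.
Proof. by have [Dx|Dx] := pselect (D x); [exact: smf_cstE|exact: smf_out]. Qed.
Lemma smf_val1 x : D x -> (1 : smf D) x = 1. Proof. exact: smf_cstE. Qed.
Lemma smf_valN f x : (- f) x = - f x.
Proof. by apply/eqP; rewrite -addr_eq0 -smf_valD addNr smf_val0. Qed.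
Lemma smf_valB f g x : (f - g) x = f x - g x.
Proof. by rewrite smf_valD smf_valN. Qed.
Lemma smf_val_sum (I : Type) (s : seq I) (P : pred I) (F : I -> smf D) x :
  (\sum_(i <- s | P i) F i) x = \sum_(i <- s | P i) F i x.
Proof.
apply: (big_morph (fun f : smf D => f x)) => [f g|]; [exact: smf_valD|exact: smf_val0].
Qed.
Lemma smf_valX f k x : D x -> (f ^+ k) x = f x ^+ k.
Proof.
by move=> Dx; elim: k => [|k IH]; rewrite ?smf_val1// !exprS smf_valM IH.
Qed.

Definition smf_eval x & D x : smf D -> R := fun f => f x.

Section Eval.
Variables (x : 'rV[R]_n) (Dx : D x).

Let eval_zmod : zmod_morphism (smf_eval Dx).
Proof. by move=> f g; exact: smf_valB. Qed.
Let eval_monoid : monoid_morphism (smf_eval Dx).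
Proof. by split=> [|f g]; [exact: smf_val1|exact: smf_valM]. Qed.

HB.instance Definition _ := GRing.isZmodMorphism.Build (smf D) R (smf_eval Dx) eval_zmod.
HB.instance Definition _ := GRing.isMonoidMorphism.Build (smf D) R (smf_eval Dx) eval_monoid.
End Eval.

Let cst_zmod : zmod_morphism smf_cst.
Proof.
by move=> a b; apply: smf_eq => x Dx; rewrite smf_valB !smf_cstE.
Qed.
Let cst_monoid : monoid_morphism smf_cst.
Proof.
by split=> [|a b]; apply: smf_eq => x Dx; rewrite ?smf_valM !smf_cstE ?smf_val1.
Qed.
HB.instance Definition _ := GRing.isZmodMorphism.Build R (smf D) smf_cst cst_zmod.
HB.instance Definition _ := GRing.isMonoidMorphism.Build R (smf D) smf_cst cst_monoid.

Fact smf_partial_exists i f : {k : smf D | forall x, D x -> k x = partial i f x}.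
Proof. exact: (smf_exists (smooth_on_partial i (smf_smooth f))). Qed.
Definition smf_partial (i : 'I_n) f : smf D := sval (smf_partial_exists i f).

Lemma smf_partialE i f x : D x -> smf_partial i f x = partial i f x.
Proof. exact: (svalP (smf_partial_exists i f)). Qed.

Lemma smf_derivable i f x : D x -> derivable f x (basis_vector R i).
Proof. exact/smooth_on_derivable/smf_smooth. Qed.

Section Partial.
Variable i : 'I_n.

Lemma smf_partial_eq f h x : (forall y, D y -> f y = h y) -> D x ->
  smf_partial i f x = partial i h x.
Proof.
move=> fh Dx; rewrite smf_partialE//; apply: near_eq_derive.
exact: (eq_on_near Do) fh Dx.
Qed.

Let partial_zmod : zmod_morphism (smf_partial i).
Proof.
move=> f g; apply: smf_eq => x Dx; rewrite smf_valB !smf_partialE//.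
have <- : partial i (smf_val f - smf_val g) x = partial i f x - partial i g x.
  exact: (@deriveB _ _ _ (smf_val f) (smf_val g) x _
    (@smf_derivable i f _ Dx) (@smf_derivable i g _ Dx)).
apply: near_eq_derive; apply: (eq_on_near Do) Dx => y Dy.
exact: smf_valB.
Qed.
HB.instance Definition _ := GRing.isZmodMorphism.Build (smf D) (smf D)
  (smf_partial i) partial_zmod.

Lemma smf_partialM f g :
  smf_partial i (f * g) = smf_partial i f * g + f * smf_partial i g.
Proof.
apply: smf_eq => x Dx; rewrite smf_valD !smf_valM !smf_partialE//.
have <- : partial i (smf_val f * smf_val g) x = partial i f x * g x + f x * partial i g x.
  rewrite addrC [X in _ + X]mulrC.
  exact: (@deriveM _ _ (smf_val f) (smf_val g) x _
    (@smf_derivable i f _ Dx) (@smf_derivable i g _ Dx)).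
apply: near_eq_derive; apply: (eq_on_near Do) Dx => y Dy.
exact: smf_valM.
Qed.

Lemma smf_partial_cst c : smf_partial i (smf_cst c) = 0.
Proof.
apply: smf_eq => x Dx; rewrite smf_val0.
by rewrite (smf_partial_eq (h := fun=> c))//; [exact: derive_cst|exact: smf_cstE].
Qed.
End Partial.

Lemma smf_partialC i j f :
  smf_partial i (smf_partial j f) = smf_partial j (smf_partial i f).
Proof.
apply: smf_eq => x Dx.
have e k l := @smf_partial_eq k _ (partial l f) x (@smf_partialE l f) Dx.
apply: etrans (e i j) (etrans _ (esym (e j i))).
exact: (@partialC R n D Do f x i j (smf_smooth f) Dx).
Qed.

Lemma smf_inverse f : (forall x, D x -> f x != 0) -> exists g : smf D, f * g = 1.
Proof.
move=> f0; exists (mk_smf (smooth_expr_smooth Do (SmoothInv (base f) f0))).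
apply: smf_eq => x Dx; rewrite smf_valM smf_val1// mk_smfE// divff//.
exact: f0.
Qed.

Lemma smf_sqrt f : (forall x, D x -> 0 < f x) ->
  exists2 g : smf D, g ^+ 2 = f & forall x, D x -> g x = Num.sqrt (f x).
Proof.
move=> f0; exists (mk_smf (smooth_expr_smooth Do (SmoothSqrt (base f) f0))).
  apply: smf_eq => x Dx; rewrite smf_valX// mk_smfE// sqr_sqrtr//.
  exact/ltW/f0.
by move=> x Dx; rewrite mk_smfE.
Qed.

Lemma smf_reduced f : f ^+ 2 = 0 -> f = 0.
Proof.
move=> f0; apply: smf_eq => x Dx; rewrite smf_val0.
by apply/eqP; rewrite -sqrf_eq0 -smf_valX// f0 smf_val0.
Qed.

End Smf.

(** * Pullback and restriction of smooth functions *)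

Section Pullback.
Variables (R : realType) (n : nat) (D E : open_domain R n).

Record smooth_map := SmoothMap {
  smap_val :> 'rV[R]_n -> 'rV[R]_n;
  smap_smooth : forall j, smooth_on D (fun x => smap_val x 0 j);
  smap_maps : forall x, D x -> E (smap_val x)
}.
Variable phi : smooth_map.

Fact pullback_exists (f : smf E) : {k : smf D | forall x, D x -> k x = f (phi x)}.
Proof.
exact: (smf_exists (smooth_expr_smooth (@domain_open R n D)
  (SmoothComp (@domain_open R n E) (smf_smooth f) (smap_smooth phi) (@smap_maps phi)))).
Qed.
Definition pullback (f : smf E) : smf D := sval (pullback_exists f).

Lemma pullbackE f x : D x -> pullback f x = f (phi x).
Proof. exact: (svalP (pullback_exists f)). Qed.

Let pull_zmod : zmod_morphism pullback.
Proof.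
move=> f g; apply: smf_eq => x Dx; rewrite smf_valB !pullbackE//.
exact: smf_valB.
Qed.
Let pull_monoid : monoid_morphism pullback.
Proof.
split=> [|f g]; apply: smf_eq => x Dx.
  by rewrite smf_val1// pullbackE// smf_val1//; exact: smap_maps.
rewrite smf_valM !pullbackE//.
exact: smf_valM.
Qed.
HB.instance Definition _ := GRing.isZmodMorphism.Build (smf E) (smf D) pullback pull_zmod.
HB.instance Definition _ := GRing.isMonoidMorphism.Build (smf E) (smf D) pullback pull_monoid.

Definition smap_coord j : smf D := mk_smf (smap_smooth phi j).

Lemma smap_partialE i j x : D x ->
  smf_partial i (smap_coord j) x = partial i (fun y => phi y 0 j) x.
Proof.
exact: (@smf_partial_eq _ _ _ i _ (fun y => phi y 0 j) x
  (@mk_smfE _ _ _ _ (smap_smooth phi j))).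
Qed.

Lemma smf_partial_pullback i f : smf_partial i (pullback f) =
  \sum_j smf_partial i (smap_coord j) * pullback (smf_partial j f).
Proof.
apply: smf_eq => x Dx; rewrite smf_val_sum; apply: etrans (@smf_partial_eq _ _ _ i _ (f \o phi) x (@pullbackE f) Dx) _.
under eq_bigr => j _ do rewrite smf_valM (smap_partialE i j Dx) (pullbackE _ Dx)
  (smf_partialE _ _ (smap_maps phi Dx)).
have Ex := smap_maps phi Dx.
have dphi j := (is_derive_lineP _ _ _ _).1
  (derivableP (@smooth_on_derivable _ _ _ i _ _ (smap_smooth phi j) Dx)).
have := @smooth_on_curve _ _ E (@domain_open R n E) f
   (fun s : R => phi (s *: basis_vector R i + x)) 0 (smf_smooth f).
rewrite scale0r add0r => /(_ Ex (fun j => @ex_derive _ _ _ _ _ _ _ (dphi j))) H.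
have [_ H'] := (is_derive_lineP (f \o phi) x (basis_vector R i) _).2 H.
apply: etrans H' _.
apply: eq_bigr => j _; congr (_ * _).
exact: (@derive_val _ _ _ _ _ _ _ (dphi j)).
Qed.

End Pullback.

Section Restriction.
Variables (R : realType) (n : nat) (D E : open_domain R n).
Hypothesis DE : D `<=` E.

Lemma smooth_on_sub (h : 'rV[R]_n -> R) : smooth_on E h -> smooth_on D h.
Proof.
move=> sh s; have [c d] := sh s; split; last by move=> i x /DE; exact: d.
exact: continuous_subspaceW DE c.
Qed.

Fact smf_res_exists (f : smf E) : {k : smf D | forall x, D x -> k x = f x}.
Proof. exact: (smf_exists (smooth_on_sub (smf_smooth f))). Qed.
Definition smf_res (f : smf E) : smf D := sval (smf_res_exists f).

Lemma smf_resE f x : D x -> smf_res f x = f x.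
Proof. exact: (svalP (smf_res_exists f)). Qed.

Let res_zmod : zmod_morphism smf_res.
Proof.
move=> f g; apply: smf_eq => x Dx; rewrite smf_valB !smf_resE//.
exact: smf_valB.
Qed.
Let res_monoid : monoid_morphism smf_res.
Proof.
split=> [|f g]; apply: smf_eq => x Dx.
  by rewrite smf_val1// smf_resE// smf_val1//; exact: DE.
rewrite smf_valM !smf_resE//.
exact: smf_valM.
Qed.
HB.instance Definition _ := GRing.isZmodMorphism.Build (smf E) (smf D) smf_res res_zmod.
HB.instance Definition _ := GRing.isMonoidMorphism.Build (smf E) (smf D) smf_res res_monoid.

Lemma smf_partial_res i f : smf_partial i (smf_res f) = smf_res (smf_partial i f).
Proof.
apply: smf_eq => x Dx; apply: etrans (@smf_partial_eq _ _ _ i _ f x (@smf_resE f) Dx) _.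
by rewrite smf_resE// smf_partialE//; exact: DE.
Qed.

Lemma smf_res_cst c : smf_res (smf_cst E c) = smf_cst D c.
Proof. by apply: smf_eq => x Dx; rewrite smf_resE// !smf_cstE//; exact: DE. Qed.

End Restriction.

(** * Existence of adapted frames *)

Section RealMatrices.
Variable R : realType.

Lemma mulmx_tr_eq0 m n (N : 'M[R]_(m, n)) : N *m N^T = 0 -> N = 0.
Proof.
move=> NN; apply/matrixP => i j; rewrite mxE.
have /matrixP/(_ i i) := NN; rewrite !mxE.
under eq_bigr do rewrite mxE -expr2.
move/eqP; rewrite psumr_eq0; last by move=> k _; exact: sqr_ge0.
by move/allP/(_ j); rewrite mem_index_enum sqrf_eq0 => /(_ isT)/eqP.
Qed.

(** Cayley-Hamilton gives only (S + mu) (S - f)^2 = 0. The product N of the two factors is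
    symmetric, because they commute, so that N N^T = 0 and hence N = 0. The trace is read off the
    coefficient of X^2. *)
Lemma char_poly_double_root (S : 'M[R]_3) (mu f : R) : S^T = S ->
  char_poly S = \prod_(l <- [:: - mu; f; f]) ('X - l%:P) ->
  (S - f%:M) *m (S + mu%:M) = 0 /\ \tr S = 2 * f - mu.
Proof.
rewrite !big_cons big_nil mulr1 => Ssym cS; split.
  have := Cayley_Hamilton S; rewrite cS !rmorphM !rmorphB /= horner_mx_X !horner_mx_C => e.
  have C : (S - f%:M) *m (S + mu%:M) = (S + mu%:M) *m (S - f%:M).
    rewrite !(mulmxDl, mulmxDr, mulNmx, mulmxN, mul_scalar_mx, mul_mx_scalar).
    by move: (S *m S) => SS; apply/matrixP => i j; rewrite !mxE; ring.
  apply: mulmx_tr_eq0.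
  have -> : ((S - f%:M) *m (S + mu%:M))^T = (S + mu%:M) *m (S - f%:M).
    by rewrite trmx_mul; congr (_ *m _); apply/matrixP => i j;
      rewrite !mxE -[in LHS]Ssym mxE eq_sym.
  have e' : (S + mu%:M) *m ((S - f%:M) *m (S - f%:M)) = 0.
    rewrite -[RHS]e; congr (_ *m _); apply/matrixP => i j; rewrite !mxE.
    by rewrite mulNrn opprK.
  move: (S - f%:M) (S + mu%:M) C e' => a b C e'.
  by rewrite C -!mulmxA (mulmxA a b a) C -!mulmxA e' mulmx0.
have := @char_poly_trace _ 3 S isT; rewrite cS /=.
have -> : ('X - (- mu)%:P) * (('X - f%:P) * ('X - f%:P)) =
   'X^3 + (mu - 2 * f)%:P * 'X^2 + (f ^+ 2 - 2 * mu * f)%:P * 'X + (mu * f ^+ 2)%:P :> {poly R}.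
  rewrite !(polyCD, polyCM, polyCN) ; ring.
rewrite !coefD !coefCM !coefXn coefX coefC /= => e; lra.
Qed.

End RealMatrices.

(** * Householder reflections *)

Section Reflection.
Variables (A : comPzRingType) (n : nat) (k : 'I_n) (T : 'rV[A]_n) (a : A).
Hypothesis TT : T *m T^T = 1%:M.
Hypothesis aT : a * (1 - T 0 k) = 1.

Let e : 'rV[A]_n := delta_mx 0 k.
Let u := T - e.

(** Since |u|^2 = 2 (1 - T_k), the scalar [a] is 2 / |u|^2, and this is the reflection exchanging
    the unit vector [T] with the k-th basis vector. It is smooth wherever T_k differs from 1. *)
Definition reflection : 'M[A]_n := 1%:M - a *: (u^T *m u).

Let mulre (v : 'rV[A]_n) : v *m e^T = (v 0 k)%:M.
Proof.
by rewrite /e trmx_delta -colE; apply/matrixP => i j; rewrite !mxE !ord1 eqxx mulr1n.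
Qed.

Let mul_eu : e *m u^T = (T 0 k - 1)%:M.
Proof.
have -> : e *m u^T = (u *m e^T)^T by rewrite trmx_mul trmxK.
by rewrite mulre tr_scalar_mx !mxE !eqxx.
Qed.

Let mul_uu : u *m u^T = (2%:R * (1 - T 0 k))%:M.
Proof.
have eT : e *m T^T = (T 0 k)%:M by rewrite -[LHS]trmxK trmx_mul trmxK mulre tr_scalar_mx.
have ee : e *m e^T = 1%:M by rewrite mulre mxE !eqxx.
have -> : u^T = T^T - e^T by rewrite /u linearB.
rewrite /u !(mulmxBl, mulmxBr) TT ee mulre eT.
by apply/matrixP => i j; rewrite !ord1 !mxE eqxx !mulr1n; ring.
Qed.

Lemma reflection_sym : reflection^T = reflection.
Proof.
rewrite /reflection linearB /= tr_scalar_mx linearZ /=.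
by rewrite trmx_mul trmxK.
Qed.

Lemma reflection_involutive : reflection *m reflection = 1%:M.
Proof.
have UU : u^T *m u *m (u^T *m u) = (2%:R * (1 - T 0 k)) *: (u^T *m u).
  by rewrite mulmxA -(mulmxA u^T) mul_uu mul_mx_scalar -scalemxAl.
rewrite /reflection; move: (u^T *m u) UU => U UU.
rewrite !(mulmxBl, mulmxBr) !mul1mx mulmx1 -scalemxAl -scalemxAr UU !scalerA.
have e2 : a * a * (2%:R * (1 - T 0 k)) = a + a.
  have -> : a * a * (2%:R * (1 - T 0 k)) = (a + a) * (a * (1 - T 0 k)) by ring.
  by rewrite aT mulr1.
by rewrite e2; apply/matrixP => i j; rewrite !mxE; ring.
Qed.

Lemma mul_delta_reflection : e *m reflection = T.
Proof.
rewrite /reflection mulmxBr mulmx1 -scalemxAr mulmxA mul_eu mul_scalar_mx scalerA.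
have -> : a * (T 0 k - 1) = - 1 by rewrite -[in RHS]aT; ring.
by rewrite scaleN1r opprK /u addrC subrK.
Qed.

Lemma mul_reflection : T *m reflection = e.
Proof. by rewrite -mul_delta_reflection -mulmxA reflection_involutive mulmx1. Qed.

End Reflection.

Section GramSchmidt.
Variables (A : comPzRingType) (G : 'M[A]_3).
Hypothesis Gsym : G^T = G.

(* The last row is the cross product of the first two rows of G. *)
Definition orthogonal_basis : 'M[A]_3 := \matrix_(i, j)
  if i == o0 then (if j == o0 then 1 else 0)
  else if i == o1 then
    (if j == o0 then - G o0 o1 else if j == o1 then G o0 o0 else 0)
  else if j == o0 then G o0 o1 * G o1 o2 - G o0 o2 * G o1 o1
  else if j == o1 then G o0 o2 * G o0 o1 - G o0 o0 * G o1 o2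
  else G o0 o0 * G o1 o1 - G o0 o1 ^+ 2.

Lemma orthogonal_basisP i j : i != j ->
  (orthogonal_basis *m G *m orthogonal_basis^T) i j = 0.
Proof.
have GS a b : G a b = G b a by rewrite -{1}Gsym mxE.
move: i j; apply: ord3P; apply: ord3P => // _;
 by rewrite !mxE !sum3 !mxE !sum3 !mxE /= (GS o1 o0) (GS o2 o0) (GS o2 o1); ring.
Qed.

End GramSchmidt.

Section SmoothFrames.
Variables (R : realType) (D : open_domain R 3).

Definition eval_mx m n x (Dx : D x) (M : 'M[smf D]_(m, n)) : 'M[R]_(m, n) :=
  map_mx (smf_eval Dx) M.

Lemma mx_smfP m n (M N : 'M[smf D]_(m, n)) :
  (forall x (Dx : D x), eval_mx Dx M = eval_mx Dx N) -> M = N.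
Proof.
move=> MN; apply/matrixP => i j; apply: smf_eq => x Dx.
by have /matrixP/(_ i j) := MN x Dx; rewrite !mxE.
Qed.

Lemma eval_mxM m n p x (Dx : D x) (M : 'M[smf D]_(m, n)) (N : 'M[smf D]_(n, p)) :
  eval_mx Dx (M *m N) = eval_mx Dx M *m eval_mx Dx N.
Proof. exact: map_mxM. Qed.

Lemma eval_mx_tr m n x (Dx : D x) (M : 'M[smf D]_(m, n)) :
  eval_mx Dx M^T = (eval_mx Dx M)^T.
Proof. by rewrite /eval_mx map_trmx. Qed.

Lemma eval_mxE m n x (Dx : D x) (M : 'M[smf D]_(m, n)) i j : eval_mx Dx M i j = M i j x.
Proof. by rewrite mxE. Qed.

Lemma eval_mx_scalar n x (Dx : D x) (a : smf D) :
  eval_mx Dx (scalar_mx a) = (a x)%:M :> 'M[R]_n.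
Proof. exact: map_scalar_mx. Qed.

Lemma smf_inverse_sqrt (f : smf D) : (forall x, D x -> 0 < f x) ->
  exists2 u : smf D, u ^+ 2 * f = 1 & forall x, D x -> 0 < u x.
Proof.
move=> f0; have [t tf tE] := smf_sqrt f0.
have t0 x : D x -> 0 < t x by move=> Dx; rewrite tE// sqrtr_gt0 f0.
have [u tu] := smf_inverse (fun x Dx => lt0r_neq0 (t0 x Dx)).
exists u; first by rewrite -tf -exprMn mulrC tu expr1n.
move=> x Dx; rewrite -(pmulr_rgt0 _ (t0 x Dx)) -smf_valM tu smf_val1//.
Qed.

(** The rows of [orthogonal_basis] only have to be normalized. Each has a positive squared length
    because one of its entries does not vanish: 1, then [G o0 o0], then a 2 by 2 minor, whose
    positivity follows from that of [s o1]. *)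
Lemma orthonormal_frame_exists (G : 'M[smf D]_3) : G^T = G ->
  (forall x (Dx : D x) (v : 'rV[R]_3), v != 0 -> 0 < (v *m eval_mx Dx G *m v^T) 0 0) ->
  exists E : 'M[smf D]_3, E *m G *m E^T = 1%:M.
Proof.
move=> Gsym Gpos; set V := orthogonal_basis G.
pose s i := (V *m G *m V^T) i i.
have GS a b : G a b = G b a by rewrite -{1}Gsym mxE.
have sE x (Dx : D x) i : s i x = (row i (eval_mx Dx V) *m eval_mx Dx G
    *m (row i (eval_mx Dx V))^T) 0 0.
  have -> : s i x = (eval_mx Dx V *m eval_mx Dx G *m (eval_mx Dx V)^T) i i.
    by rewrite -eval_mx_tr -!eval_mxM eval_mxE.
  rewrite -row_mul; move: (_ *m eval_mx Dx G) => X.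
  by rewrite !mxE; apply: eq_bigr => k _; rewrite !mxE.
have nz x (Dx : D x) i j : V i j x != 0 -> 0 < s i x.
  move=> Vx; rewrite sE; apply: Gpos; apply: contraNneq Vx => e.
  by have /rowP/(_ j) := e; rewrite [LHS]mxE [LHS]eval_mxE [RHS]mxE => ->.
have s0 x : D x -> 0 < s o0 x.
  by move=> Dx; apply: (nz x Dx o0 o0); rewrite mxE /= smf_val1// oner_neq0.
have s0E : s o0 = G o0 o0.
  by rewrite /s !mxE !sum3 !mxE !sum3 !mxE /=; ring.
have s1 x : D x -> 0 < s o1 x.
  by move=> Dx; apply: (nz x Dx o1 o1); rewrite mxE /= -s0E lt0r_neq0// s0.
have s1E : s o1 = G o0 o0 * (G o0 o0 * G o1 o1 - G o0 o1 ^+ 2).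
  by rewrite /s !mxE !sum3 !mxE !sum3 !mxE /= (GS o1 o0); ring.
have s2 x : D x -> 0 < s o2 x.
  move=> Dx; apply: (nz x Dx o2 o2); rewrite mxE /= lt0r_neq0//.
  by move: (s1 x Dx); rewrite s1E smf_valM pmulr_rgt0// -s0E s0.
have sp i x : D x -> 0 < s i x by move: i; apply: ord3P => ?; [exact: s0|exact: s1|exact: s2].
have us i : {u : smf D | u ^+ 2 * s i = 1}.
  by apply: cid; have [u us _] := smf_inverse_sqrt (sp i); exists u.
exists (diag_mx (\row_i sval (us i)) *m V).
rewrite trmx_mul tr_diag_mx !mulmxA.
have -> : diag_mx (\row_i sval (us i)) *m V *m G *m V^T = diag_mx (\row_i sval (us i)) *m (V *m G *m V^T).
  by rewrite !mulmxA.
have -> : V *m G *m V^T = diag_mx (\row_i s i).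
  apply/matrixP => i j; rewrite [RHS]mxE; have [<-|ij] := eqVneq i j.
    by rewrite mulr1n [RHS]mxE.
  by rewrite mulr0n; exact: orthogonal_basisP.
rewrite !mulmx_diag; apply/matrixP => i j; rewrite !mxE; case: eqP => [_|//].
by rewrite !mulr1n mulrAC -expr2 (svalP (us i)).
Qed.

End SmoothFrames.

Section AdaptedFrame.
Variable R : realType.
Implicit Types D : open_domain R 3.

Lemma char_poly_conj n (e e' A : 'M[R]_n) : e *m e' = 1%:M ->
  char_poly (e *m A *m e') = char_poly A.
Proof.
move=> ee'; rewrite /char_poly /char_poly_mx.
have pe : map_mx polyC e *m map_mx polyC e' = 1%:M by rewrite -map_mxM ee' map_scalar_mx.
have -> : 'X%:M - map_mx polyC (e *m A *m e')
    = map_mx polyC e *m ('X%:M - map_mx polyC A) *m map_mx polyC e'.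
  rewrite mulmxBr mulmxBl !map_mxM; congr (_ - _).
  by rewrite mul_mx_scalar -scalemxAl pe scalemx1.
by rewrite !det_mulmx mulrAC -det_mulmx pe det1 mul1r.
Qed.

Section PositiveDomain.
Variables (D : open_domain R 3) (h : smf D).

Lemma open_positive_domain : open [set x | D x /\ 0 < h x].
Proof.
rewrite openE => x [Dx hx]; have Do := @domain_open _ _ D.
have ch : {for x, continuous h} := smooth_on_continuous Do (smf_smooth h) Dx.
have nD : nbhs x D by exact: open_nbhs_nbhs.
have nh : nbhs x [set y | 0 < h y] by exact: (cvgr_gt (h x) ch 0 hx).
by apply: filterS (filterI nD nh).
Qed.

Definition positive_domain : open_domain R 3 := OpenDomain open_positive_domain.

Lemma positive_domain_sub : positive_domain `<=` D.
Proof. by move=> x []. Qed.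

End PositiveDomain.

Lemma smf_res_comp (D1 D2 D3 : open_domain R 3) (s12 : D1 `<=` D2) (s23 : D2 `<=` D3)
    (s13 : D1 `<=` D3) (h : smf D3) : smf_res s12 (smf_res s23 h) = smf_res s13 h.
Proof.
by apply: smf_eq => x Dx; rewrite !smf_resE//; exact: s12.
Qed.

Definition res_mx m n (D D' : open_domain R 3) (s : D `<=` D') (M : 'M[smf D']_(m, n)) :
  'M[smf D]_(m, n) := map_mx (smf_res s) M.

Section IdempotentWithFixedVector.
Variables (D : open_domain R 3) (M : 'M[smf D]_3).
Hypothesis Msym : M^T = M.
Hypothesis MM : M *m M = M.
Hypothesis trM : \tr M = 1.
Hypothesis M2 : delta_mx 0 o2 *m M = delta_mx 0 o2 :> 'rV_3.

(** The diagonal entries of a symmetric idempotent are the sums of squares of its rows. The first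
    two are nonnegative with sum 0, so those rows vanish. *)
Lemma idempotent_diag : M = diag3 0 0 1.
Proof.
have M2j j : M o2 j = (o2 == j)%:R.
  have /rowP/(_ j) := M2; rewrite -rowE !mxE eqxx /= => ->.
  by rewrite eq_sym.
have MS i j : M i j = M j i by rewrite -{1}Msym mxE.
have Mii i : M i i = \sum_k M i k ^+ 2.
  by rewrite -{1}MM mxE; apply: eq_bigr => k _; rewrite (MS k i) expr2.
have M01 : M o0 o0 + M o1 o1 = 0.
  by move: trM; rewrite /mxtrace sum3 M2j eqxx => e; apply: (addIr 1); rewrite e add0r.
have M0 i : i != o2 -> forall j, M i j = 0.
  move=> i2 j; apply: smf_eq => x Dx; rewrite smf_val0.
  have pos k : 0 <= M k k x by rewrite Mii smf_val_sum sumr_ge0// => l _; rewrite smf_valX// sqr_ge0.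
  have Mii0 : M i i x = 0.
    have := congr1 (fun h : smf D => h x) M01; rewrite smf_valD smf_val0 => e.
    have [p0 p1] := (pos o0, pos o1).
    by move: i i2; apply: ord3P => // _; lra.
  move: Mii0; rewrite Mii smf_val_sum => /eqP; rewrite psumr_eq0.
    by move/allP/(_ j); rewrite mem_index_enum smf_valX// sqrf_eq0 => /(_ isT)/eqP.
  by move=> k _; rewrite smf_valX// sqr_ge0.
have [d0 d1 d2 doff] := @diag3E (smf D) 0 0 1.
apply/matrixP => i j; have [<-|ij] := eqVneq i j.
  by move: i; apply: ord3P; [rewrite d0 M0|rewrite d1 M0|rewrite d2 M2j eqxx].
rewrite doff//; have [i2|i2] := eqVneq i o2; last exact: M0.
by rewrite i2 M2j -i2 (negbTE ij).
Qed.

End IdempotentWithFixedVector.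

Section Existence.
Variables (D : open_domain R 3) (G Ric : 'M[smf D]_3) (f w : smf D) (mu : R).
Variable x0 : 'rV[R]_3.
Hypothesis Dx0 : D x0.
Hypothesis Gsym : G^T = G.
Hypothesis Gpos : forall x (Dx : D x) (v : 'rV[R]_3), v != 0 ->
  0 < (v *m eval_mx Dx G *m v^T) 0 0.
Hypothesis Ricsym : Ric^T = Ric.
Hypothesis fw : w * (f + smf_cst D mu) = 1.
Hypothesis charRic : forall x (Dx : D x),
  char_poly (eval_mx Dx Ric *m invmx (eval_mx Dx G))
  = \prod_(l <- [:: - mu; f x; f x]) ('X - l%:P).

(* In an orthonormal frame, with S the matrix of Ric, w (f - S) is the projection
   onto the eigenline; a nonzero row of it gives T, and a reflection exchanging T
   with the last frame vector adapts the frame. *)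
Lemma adapted_frame_exists : exists (D' : open_domain R 3) (s : D' `<=` D), D' x0 /\
  exists E : 'M[smf D']_3, E *m res_mx s G *m E^T = 1%:M /\
    E *m res_mx s Ric *m E^T = diag3 (smf_res s f) (smf_res s f) (smf_cst D' (- mu)).
Proof.
have [E0 E0G] := orthonormal_frame_exists Gsym Gpos.
pose S := E0 *m Ric *m E0^T.
have Ssym : S^T = S by rewrite /S !trmx_mul trmxK Ricsym mulmxA.
have Sx x (Dx : D x) : (eval_mx Dx S - (f x)%:M) *m (eval_mx Dx S + mu%:M) = 0
    /\ \tr (eval_mx Dx S) = 2 * f x - mu.
  apply: char_poly_double_root; first by rewrite -eval_mx_tr Ssym.
  have exG : eval_mx Dx E0 *m (eval_mx Dx G *m (eval_mx Dx E0)^T) = 1%:M.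
    by rewrite mulmxA -eval_mx_tr -!eval_mxM E0G eval_mx_scalar smf_val1.
  have Gu : eval_mx Dx G \in unitmx.
    have := mulmx1_unit exG => -[_]; rewrite unitmx_mul => /andP[]//.
  rewrite -(charRic Dx) -[RHS](char_poly_conj _ exG); congr char_poly.
  by rewrite /S !eval_mxM eval_mx_tr !mulmxA mulmxKV.
have S2 : (S - f%:M) *m (S + (smf_cst D mu)%:M) = 0.
  apply: mx_smfP => x Dx; rewrite eval_mxM /eval_mx map_mxB map_mxD !map_scalar_mx.
  rewrite /= /smf_eval smf_cstE// (Sx _ Dx).1.
  by apply/matrixP => k l; rewrite !mxE; exact/esym/smf_val0.
have trS : \tr S = 2%:R * f - smf_cst D mu.
  apply: smf_eq => x Dx; rewrite -[LHS]/(smf_eval Dx _) -trace_map_mx (Sx _ Dx).2.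
  rewrite smf_valB smf_valM smf_cstE//; congr (_ * _ - _).
  by rewrite -[RHS]/(smf_eval Dx _) rmorph_nat.
pose h := f + smf_cst D mu.
pose M := w *: (f%:M - S).
have hM : h *: M = f%:M - S by rewrite /M scalerA mulrC fw scale1r.
have Msym : M^T = M.
  by rewrite /M linearZ /= linearB /= tr_scalar_mx Ssym.
have MM : M *m M = M.
  have e : (f%:M - S) *m (f%:M - S) = h *: (f%:M - S).
    have S2T : (S + (smf_cst D mu)%:M) *m (f%:M - S) = 0.
      have e := congr1 trmx S2; rewrite trmx_mul trmx0 in e.
      have eS : (S - f%:M)^T = S - f%:M by rewrite linearB /= tr_scalar_mx Ssym.
      have eT : (S + (smf_cst D mu)%:M)^T = S + (smf_cst D mu)%:M.
        by rewrite linearD /= tr_scalar_mx Ssym.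
      by rewrite -[f%:M - S]opprB mulmxN; move: e; rewrite eS eT => ->; rewrite oppr0.
    have hE : (h%:M : 'M[smf D]_3) = f%:M + (smf_cst D mu)%:M.
      by apply/matrixP => k l; rewrite /h !mxE mulrnDl.
    transitivity ((h%:M - (S + (smf_cst D mu)%:M)) *m (f%:M - S)).
      congr (_ *m _); rewrite hE opprD addrACA.
      by rewrite [X in _ = _ + X]subrr addr0.
    by rewrite mulmxBl S2T subr0 mul_scalar_mx.
  rewrite {1 2}/M -scalemxAl -scalemxAr e !scalerA -mulrA.
  by rewrite fw mulr1.
have trM : \tr M = 1.
  rewrite /M mxtraceZ raddfB /= mxtrace_scalar trS; apply: etrans fw; ring.
(* As the trace is 1, some diagonal entry is positive at [x0]. It is the squared length of its row,
   which therefore spans the eigenline near [x0]. *)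
have [i Mi] : exists i, 0 < M i i x0.
  have [/existsP[i Mi]|] := boolP [exists i, 0 < M i i x0]; first by exists i.
  rewrite negb_exists => /forallP Mn.
  have := congr1 (fun h : smf D => h x0) trM; rewrite /mxtrace smf_val_sum smf_val1// => e.
  have : (1 : R) <= 0 by rewrite -e sumr_le0// => i _; rewrite leNgt Mn.
  by rewrite ler10.
pose D1 := positive_domain (M i i).
have s1 : D1 `<=` D := @positive_domain_sub _ _.
have [u uM _] : exists2 u : smf D1, u ^+ 2 * smf_res s1 (M i i) = 1 & forall x, D1 x -> 0 < u x.
  by apply: smf_inverse_sqrt => x [Dx Mx]; rewrite smf_resE.
pose M1 := res_mx s1 M.
have [T [TT TM Tx0]] : exists T : 'rV[smf D1]_3,
    [/\ T *m T^T = 1%:M, T *m M1 = T & 0 < (1 - T 0 o2) x0].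
  pose T := u *: row i M1.
  have M1M1 : M1 *m M1 = M1 by rewrite /M1 /res_mx -map_mxM MM.
  have TT : T *m T^T = 1%:M.
    rewrite /T linearZ /= -scalemxAl -scalemxAr scalerA tr_row.
    have -> : M1^T = M1 by rewrite /M1 /res_mx map_trmx Msym.
    have -> : row i M1 *m col i M1 = (M1 i i)%:M.
      apply/matrixP => k l; rewrite !ord1 [RHS]mxE mulr1n -[in RHS]M1M1 !mxE.
      by apply: eq_bigr => m _; rewrite [in LHS]mxE [X in _ * X]mxE.
    by rewrite scale_scalar_mx -expr2 -uM [X in _ * X]mxE.
  have TM : T *m M1 = T by rewrite /T -scalemxAl -row_mul M1M1.
  have Dx : D1 x0 by [].
  (* The sign of T is chosen so that 1 - T_2 >= 1 at [x0], which makes the reflection available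
     nearby. *)
  have [T0|T0] := lerP (T 0 o2 x0) 0; [exists T|exists (- T)]; split => //.
  - rewrite smf_valB smf_val1//; lra.
  - by rewrite linearN /= mulmxN mulNmx opprK.
  - by rewrite mulNmx TM.
  - rewrite mxE smf_valB smf_valN smf_val1//; lra.
pose D2 := positive_domain (1 - T 0 o2).
have s2 : D2 `<=` D1 := @positive_domain_sub _ _.
have s3 : D2 `<=` D := subset_trans s2 s1.
exists D2, s3; split; first by split.
pose T2 := res_mx s2 T.
have [a aT] : exists a : smf D2, smf_res s2 (1 - T 0 o2) * a = 1.
  apply: smf_inverse => x Dx; have [D1x Tx] := Dx; rewrite smf_resE//.
  exact: lt0r_neq0.
have res_res (N : 'M[smf D]_3) : res_mx s2 (res_mx s1 N) = res_mx s3 N.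
  by apply/matrixP => k l; rewrite !mxE (smf_res_comp _ _ s3).
have TT2 : T2 *m T2^T = 1%:M.
  by rewrite /T2 /res_mx map_trmx -map_mxM TT map_scalar_mx rmorph1.
have aT2 : a * (1 - T2 0 o2) = 1.
  by rewrite mulrC; apply: etrans aT; rewrite mxE rmorphB rmorph1.
have TM2 : T2 *m res_mx s3 M = T2 by rewrite -res_res /T2 /res_mx -map_mxM TM.
pose H := reflection o2 T2 a.
have HT : H^T = H := reflection_sym _ _ _.
have HH : H *m H = 1%:M := reflection_involutive TT2 aT2.
pose E := H *m res_mx s3 E0.
have ENE (N : 'M[smf D]_3) : E *m res_mx s3 N *m E^T = H *m res_mx s3 (E0 *m N *m E0^T) *m H.
  by rewrite /E trmx_mul HT /res_mx !map_mxM map_trmx !mulmxA.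
exists E; split; first by rewrite ENE E0G /res_mx map_scalar_mx rmorph1 mulmx1.
rewrite ENE -/S.
have ME : H *m res_mx s3 M *m H = diag3 0 0 1.
  apply: idempotent_diag.
  - by rewrite !trmx_mul HT /res_mx map_trmx Msym mulmxA.
  - have NN : res_mx s3 M *m res_mx s3 M = res_mx s3 M by rewrite /res_mx -map_mxM MM.
    move: (res_mx s3 M) NN => N NN.
    by rewrite !mulmxA -(mulmxA _ H H) HH mulmx1 -(mulmxA H N N) NN.
  - by rewrite mxtrace_mulC mulmxA HH mul1mx /res_mx trace_map_mx trM rmorph1.
  - rewrite !mulmxA (mul_delta_reflection aT2) TM2.
    exact: mul_reflection.
have SE : S = f%:M - h *: M by rewrite hM opprB addrC subrK.
have -> : res_mx s3 S = (smf_res s3 f)%:M - smf_res s3 h *: res_mx s3 M.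
  by rewrite SE /res_mx map_mxB map_mxZ map_scalar_mx.
have conjH (N : 'M[smf D2]_3) b c : H *m (b%:M - c *: N) *m H = b%:M - c *: (H *m N *m H).
  move: (H) (HH) => X XX; rewrite mulmxBr mulmxBl mul_mx_scalar -scalemxAl XX scalemx1.
  by rewrite -scalemxAr -scalemxAl.
rewrite conjH ME.
have [d0 d1 d2 doff] := @diag3E (smf D2) 0 0 1.
have [e0 e1 e2 eoff] := diag3E (smf_res s3 f) (smf_res s3 f) (smf_cst D2 (- mu)).
apply/matrixP => k l; have [<-|kl] := eqVneq k l; last first.
  by rewrite eoff// !mxE (negbTE kl) !mulr0n; ring.
rewrite [LHS]mxE [X in X + _]mxE [X in _ + X]mxE [X in - X]mxE eqxx mulr1n.
move: k; apply: ord3P.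
- by rewrite d0 e0 mulr0 subr0.
- by rewrite d1 e1 mulr0 subr0.
- rewrite d2 e2 mulr1; apply: smf_eq => x Dx; rewrite smf_valB !smf_resE// smf_valD.
  by rewrite !smf_cstE//; [ring|exact: (subset_trans s2 s1 Dx)].
Qed.

End Existence.
End AdaptedFrame.

(** * Geometry in a chart *)

Section ChartRicci.
Variables (R : realType) (n : nat) (D : open_domain R n).
Variable G : 'rV[R]_n -> 'M[R]_n.
Variables (g gi : 'M[smf D]_n).
Hypothesis gG : forall x, D x -> forall i j, g i j x = G x i j.
Hypothesis gig : gi *m g = 1%:M.

Variable C : 'I_n -> 'M[smf D]_n.
Hypothesis CE : forall i, C i = christoffel_mx (@smf_partial R n D) g gi (smf_cst D 2^-1) i.

Let giG x : D x -> forall i j, gi i j x = invmx (G x) i j.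
Proof.
move=> Dx i j; have e : map_mx (smf_eval Dx) gi *m G x = 1%:M.
  have -> : G x = map_mx (smf_eval Dx) g by apply/matrixP => k l; rewrite mxE -gG.
  by rewrite -map_mxM gig map_scalar_mx rmorph1.
have [_ Gu] := mulmx1_unit e.
have -> : invmx (G x) = map_mx (smf_eval Dx) gi.
  by rewrite -[RHS](mulmxK Gu) e mul1mx.
by rewrite mxE.
Qed.

Lemma christoffelE x k i j : D x -> christoffel G k i j x = C i j k x.
Proof.
move=> Dx; have pE a b c : partial a (fun y => G y b c) x = smf_partial a (g b c) x.
  apply/esym; apply: (@smf_partial_eq _ _ _ a (g b c) (fun y => G y b c) x _ Dx).
  by move=> y Dy; rewrite gG.
rewrite CE mxE smf_valM smf_cstE// smf_val_sum; congr (_ * _); apply: eq_bigr => l _.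
by rewrite smf_valM smf_valB smf_valD !pE giG.
Qed.

Local Notation cf := (@coord_field R n).

Let coordE i x a : cf i x 0 a = (a == i)%:R.
Proof. by rewrite mxE eqxx. Qed.

Let sum_coord i (F : 'I_n -> R) x : \sum_a cf i x 0 a * F a = F i.
Proof.
rewrite (bigD1 i)//= coordE eqxx mul1r big1 ?addr0// => a ai.
by rewrite coordE (negbTE ai) mul0r.
Qed.

Let nabla_coord Y i x k : nabla G (cf i) Y x 0 k =
  partial i (fun y => Y y 0 k) x + \sum_m christoffel G k i m x * Y x 0 m.
Proof.
rewrite mxE sum_coord; congr (_ + _).
under eq_bigr => a _ do under eq_bigr => b _ do rewrite -mulrA mulrCA.
under eq_bigr => a _ do rewrite -mulr_sumr.
by rewrite sum_coord.
Qed.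

Let partial_cst (i : 'I_n) (c : R) x : partial i (fun=> c) x = 0.
Proof. exact: derive_cst. Qed.

Let nabla_coord_coord i j x k :
  nabla G (cf i) (cf j) x 0 k = christoffel G k i j x.
Proof.
rewrite nabla_coord (_ : (fun y => _) = fun=> (k == j)%:R); last first.
  by apply/funext => y; rewrite coordE.
rewrite partial_cst add0r (bigD1 j)//= coordE eqxx mulr1 big1 ?addr0// => m mj.
by rewrite coordE (negbTE mj) mulr0.
Qed.

Let bracket_coord i j : lie_bracket (cf i) (cf j) = fun=> 0.
Proof.
apply/funext => x; apply/rowP => k; rewrite mxE big1 => [|a _]; first by rewrite mxE.
have e l : partial a (fun y => cf l y 0 k) x = 0.
  rewrite (_ : (fun y => _) = fun=> (k == l)%:R) ?partial_cst//.
  by apply/funext => y; rewrite coordE.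
by rewrite !e !mulr0 subr0.
Qed.

Let nabla0 Z x : nabla G (fun=> 0) Z x = 0.
Proof.
apply/rowP => k; rewrite !mxE big1 ?add0r; last by move=> a _; rewrite mxE mul0r.
by rewrite big1// => a _; rewrite big1// => b _; rewrite mxE mulr0 mul0r.
Qed.

Let nabla2 x (Dx : D x) i j k l : nabla G (cf i) (nabla G (cf j) (cf k)) x 0 l
  = smf_partial i (C j k l) x + \sum_m C i m l x * C j k m x.
Proof.
have e : partial i (fun y => nabla G (cf j) (cf k) y 0 l) x = smf_partial i (C j k l) x.
  apply/esym; apply: (@smf_partial_eq _ _ _ i (C j k l)
    (fun y => nabla G (cf j) (cf k) y 0 l) x) Dx => y Dy.
  by rewrite nabla_coord_coord christoffelE.
rewrite nabla_coord e; congr (_ + _); apply: eq_bigr => m _.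
by rewrite nabla_coord_coord !christoffelE.
Qed.

(** Coordinate fields have zero bracket, and [C i j k] is Gamma^k_ij, so their second covariant
    derivatives are a derivative of a symbol plus a sum of products of two, as in [curvature]. *)
Lemma ricciE x (Dx : D x) :
  ricci G x = map_mx (smf_eval Dx) (ricci_of (@smf_partial R n D) C).
Proof.
apply: (@matrixP _ _ _ (ricci G x) _).1 => j k.
rewrite /ricci [LHS]mxE.
rewrite [RHS]mxE.
rewrite /ricci_of.
rewrite [X in smf_eval _ X]mxE.
rewrite /smf_eval.
rewrite smf_val_sum.
apply: eq_bigr => i _.
rewrite /riemann bracket_coord nabla0 subr0 [LHS]mxE [X in _ + X]mxE (nabla2 Dx) (nabla2 Dx).
rewrite curvatureE !(smf_valD, smf_valN, smf_val_sum) .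
have S a b : \sum_m (C a k m * C b m i) x = \sum_m C b m i x * C a k m x.
  by apply: eq_bigr => m _; rewrite smf_valM mulrC.
rewrite (S i j) (S j i).
by rewrite opprD addrACA addrA.
Qed.

End ChartRicci.

(** * Geometric data on an open set *)

Section LocalGeometry.
Variables (R : realType) (mu : R).

(** The symbols are specified by torsion-freeness and metric compatibility, which determine them and
    are stable under restriction. The condition on Ric is kept apart and enters through
    [adapted_frame]. *)
Record local_geometry (D : open_domain R 3) := LocalGeometry {
  lg_metric : 'M[smf D]_3;
  lg_inverse : 'M[smf D]_3;
  lg_christoffel : 'I_3 -> 'M[smf D]_3;
  lg_f : smf D;
  lg_w : smf D;
  lg_sym : lg_metric^T = lg_metric;
  lg_inverseP : lg_inverse *m lg_metric = 1%:M;
  lg_torsion_free : forall i j k, lg_christoffel i j k = lg_christoffel j i k;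
  lg_metric_compat : forall i, mx_partial (@smf_partial R 3 D) i lg_metric
    = lg_christoffel i *m lg_metric + lg_metric *m (lg_christoffel i)^T;
  lg_fw : lg_w * (lg_f + smf_cst D mu) = 1
}.

Section Tensors.
Variables (D : open_domain R 3) (L : local_geometry D).

Definition lg_ricci := ricci_of (@smf_partial R 3 D) (lg_christoffel L).

(* T (x) T, for the unit eigenvector T of the simple eigenvalue - mu.  Unlike T it
   is globally defined: g^-1 f - Ric^# = (f + mu) T (x) T. *)
Definition lg_axis : 'M[smf D]_3 :=
  lg_w L *: (lg_f L *: lg_inverse L - lg_inverse L *m lg_ricci *m lg_inverse L).

Definition axis_derivative_sq h : smf D := gradient_form (@smf_partial R 3 D) lg_axis h.
Definition gradient_norm_sq h : smf D := gradient_form (@smf_partial R 3 D) (lg_inverse L) h.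
Definition axis_energy : smf D := covariant_energy (@smf_partial R 3 D) (lg_christoffel L)
  (lg_metric L) (lg_inverse L) lg_axis.
End Tensors.

Section Restriction.
Variables (D' D : open_domain R 3) (s : D' `<=` D) (L : local_geometry D).

Let res_partial i (b : smf D) :
  smf_partial i (smf_res s b) = smf_res s (smf_partial i b).
Proof. exact: smf_partial_res. Qed.

Lemma res_mxM m n p (X : 'M[smf D]_(m, n)) (Y : 'M[smf D]_(n, p)) :
  res_mx s (X *m Y) = res_mx s X *m res_mx s Y.
Proof. exact: map_mxM. Qed.

Fact restrict_geometry_exists : {L' : local_geometry D' |
  [/\ lg_metric L' = res_mx s (lg_metric L), lg_inverse L' = res_mx s (lg_inverse L),
      (forall i, lg_christoffel L' i = res_mx s (lg_christoffel L i)),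
      lg_f L' = smf_res s (lg_f L) & lg_w L' = smf_res s (lg_w L)]}.
Proof.
have sym : (res_mx s (lg_metric L))^T = res_mx s (lg_metric L).
  by rewrite /res_mx map_trmx lg_sym.
have inv : res_mx s (lg_inverse L) *m res_mx s (lg_metric L) = 1%:M.
  by rewrite -res_mxM lg_inverseP /res_mx map_scalar_mx rmorph1.
have tor i j k : res_mx s (lg_christoffel L i) j k = res_mx s (lg_christoffel L j) i k.
  by rewrite [LHS]mxE [RHS]mxE lg_torsion_free.
have met i : mx_partial (@smf_partial R 3 D') i (res_mx s (lg_metric L))
    = res_mx s (lg_christoffel L i) *m res_mx s (lg_metric L)
      + res_mx s (lg_metric L) *m (res_mx s (lg_christoffel L i))^T.
  rewrite -[LHS](@map_mx_partial _ _ _ _ _ (smf_res s) res_partial).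
  by rewrite (lg_metric_compat L i) map_mxD !map_mxM /res_mx map_trmx.
have fw : smf_res s (lg_w L) * (smf_res s (lg_f L) + smf_cst D' mu) = 1.
  by rewrite -(smf_res_cst s) -rmorphD -rmorphM lg_fw rmorph1.
by exists (LocalGeometry sym inv tor met fw); split.
Qed.

Definition restrict_geometry := sval restrict_geometry_exists.
Let L' := restrict_geometry.

Lemma restrict_geometryP : [/\ lg_metric L' = res_mx s (lg_metric L),
      lg_inverse L' = res_mx s (lg_inverse L),
      (forall i, lg_christoffel L' i = res_mx s (lg_christoffel L i)),
      lg_f L' = smf_res s (lg_f L) & lg_w L' = smf_res s (lg_w L)].
Proof. exact: (svalP restrict_geometry_exists). Qed.

Lemma res_ricci : lg_ricci L' = res_mx s (lg_ricci L).
Proof.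
have [_ _ EC _ _] := restrict_geometryP.
rewrite /res_mx (@map_ricci_of _ _ _ _ _ (smf_res s) res_partial) /lg_ricci.
by congr ricci_of; apply/funext.
Qed.

Lemma res_axis : lg_axis L' = res_mx s (lg_axis L).
Proof.
have [_ Ei _ Ef Ew] := restrict_geometryP.
by rewrite /lg_axis Ef Ew Ei res_ricci /res_mx map_mxZ map_mxB map_mxZ !map_mxM.
Qed.

Lemma res_axis_derivative_sq h :
  axis_derivative_sq L' (smf_res s h) = smf_res s (axis_derivative_sq L h).
Proof.
rewrite /axis_derivative_sq (@map_gradient_form _ _ _ _ _ (smf_res s) res_partial).
by rewrite res_axis.
Qed.

Lemma res_gradient_norm_sq h :
  gradient_norm_sq L' (smf_res s h) = smf_res s (gradient_norm_sq L h).
Proof.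
have [_ Ei _ _ _] := restrict_geometryP.
rewrite /gradient_norm_sq (@map_gradient_form _ _ _ _ _ (smf_res s) res_partial).
by rewrite Ei.
Qed.

Lemma res_axis_energy : axis_energy L' = smf_res s (axis_energy L).
Proof.
have [Em Ei EC _ _] := restrict_geometryP.
have eC : (fun i => res_mx s (lg_christoffel L i)) = lg_christoffel L' by apply/funext.
apply: etrans (esym (@map_covariant_energy _ _ _ _ _ (smf_res s) res_partial _ _ _ _)).
by rewrite -!/(res_mx s _) -Em -Ei -res_axis eC.
Qed.

End Restriction.

Section Frame.
Variables (D : open_domain R 3) (L : local_geometry D) (E : 'M[smf D]_3).

Definition adapted_frame := E *m lg_metric L *m E^T = 1%:M /\
  E *m lg_ricci L *m E^T = diag3 (lg_f L) (lg_f L) (smf_cst D (- mu)).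

Hypothesis adE : adapted_frame.
Let EGE := adE.1.
Let K := smf_cst D (mu / 2).
Let Dv a : {additive smf D -> smf D} := frame_partial (@smf_partial R 3 D) E a.

Let half2 : smf_cst D 2^-1 + smf_cst D 2^-1 = 1.
Proof. by rewrite -rmorphD -div1r -splitr rmorph1. Qed.

Let KK : K + K = smf_cst D mu.
Proof. by rewrite /K -rmorphD /= -splitr. Qed.

Let dK i : smf_partial i K = 0. Proof. exact: smf_partial_cst. Qed.

Let RicE : E *m ricci_of (@smf_partial R 3 D) (lg_christoffel L) *m E^T
  = diag3 (lg_f L) (lg_f L) (- (K + K)).
Proof. by rewrite KK -rmorphN; exact: adE.2. Qed.

Let fw : (lg_f L + K + K) * lg_w L = 1.
Proof. by rewrite -addrA KK mulrC lg_fw. Qed.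

Lemma axis_frame : lg_axis L = E^T *m diag3 0 0 1 *m E.
Proof.
have iE := inverse_metric_frame EGE (lg_inverseP L).
have -> : lg_axis L = E^T *m (lg_w L *: ((lg_f L)%:M - E *m lg_ricci L *m E^T)) *m E.
  rewrite /lg_axis -scalemxAr -scalemxAl; congr (_ *: _).
  rewrite mulmxBr mulmxBl mul_mx_scalar -scalemxAl -iE; congr (_ - _).
  by rewrite iE !mulmxA.
congr (_ *m _ *m _); rewrite adE.2.
have [d0 d1 d2 doff] := @diag3E (smf D) 0 0 1.
have [e0 e1 e2 eoff] := diag3E (lg_f L) (lg_f L) (smf_cst D (- mu)).
apply/matrixP => k l; rewrite [LHS]mxE [X in _ * X]mxE [X in _ * (X + _)]mxE [X in _ * (_ + X)]mxE.
have [<-|kl] := eqVneq k l; last by rewrite eoff// doff// mulr0n subr0 mulr0.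
rewrite mulr1n; move: k; apply: ord3P.
- by rewrite d0 e0 subrr mulr0.
- by rewrite d1 e1 subrr mulr0.
- by rewrite d2 e2 rmorphN opprK lg_fw.
Qed.

Lemma axis_derivative_sq_frame h : axis_derivative_sq L h = Dv o2 h ^+ 2.
Proof. by rewrite /axis_derivative_sq axis_frame gradient_formE. Qed.

Lemma gradient_norm_sq_frame h :
  gradient_norm_sq L h = Dv o0 h ^+ 2 + Dv o1 h ^+ 2 + Dv o2 h ^+ 2.
Proof. exact: (gradient_norm_frame _ (lg_inverseP L) EGE). Qed.

Let B := frame_connection (@smf_partial R 3 D) (lg_metric L) (lg_christoffel L) E.

Lemma axis_energy_frame : axis_energy L = 2%:R * (B o0 o2 o0 ^+ 2 + B o1 o2 o0 ^+ 2
  + B o2 o2 o0 ^+ 2 + B o0 o2 o1 ^+ 2 + B o1 o2 o1 ^+ 2 + B o2 o2 o1 ^+ 2).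
Proof.
rewrite /axis_energy axis_frame.
exact: (covariant_energyE (@smf_partialM R 3 D) half2 (lg_metric_compat L) (lg_inverseP L) EGE).
Qed.

Lemma gradient_norm_sq_ge0 h x : 0 <= gradient_norm_sq L h x.
Proof.
have [Dx|Dx] := pselect (D x); last by rewrite smf_out.
rewrite gradient_norm_sq_frame !smf_valD !smf_valX//.
by rewrite !addr_ge0// sqr_ge0.
Qed.

Lemma axis_derivative_sq_ge0 h x : 0 <= axis_derivative_sq L h x.
Proof.
have [Dx|Dx] := pselect (D x); last by rewrite smf_out.
by rewrite axis_derivative_sq_frame smf_valX// sqr_ge0.
Qed.

Lemma gradient_norm_sq_eq0 h : gradient_norm_sq L h = 0 -> forall a, Dv a h = 0.
Proof.
rewrite gradient_norm_sq_frame => e a; apply: smf_eq => x Dx; rewrite smf_val0.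
have := congr1 (fun u : smf D => u x) e; rewrite !smf_valD !smf_valX// smf_val0.
move: (sqr_ge0 (Dv o0 h x)) (sqr_ge0 (Dv o1 h x)) (sqr_ge0 (Dv o2 h x)) => h0 h1 h2 e'.
by apply/eqP; rewrite -sqrf_eq0; apply/eqP; move: a; apply: ord3P; lra.
Qed.

Lemma smf_nat k x : D x -> (k%:R : smf D) x = k%:R.
Proof. by move=> Dx; exact: (rmorph_nat (smf_eval Dx)). Qed.

Hypothesis mu_gt0 : 0 < mu.

Let in_frame0 := hessian_frame_w (@smf_partialM R 3 D) (@smf_partialC R 3 D) half2
  (lg_torsion_free L) (lg_metric_compat L) EGE dK RicE fw.

Lemma axis_derivative_sq_convex x : D x ->
  4 * mu * axis_derivative_sq L (lg_w L) x
  <= Dv o2 (Dv o2 (axis_derivative_sq L (lg_w L))) x.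
Proof.
move=> Dx; rewrite axis_derivative_sq_frame [in leRHS]in_frame0.
move: (Dv o2 (lg_w L)) (Dv o2 (Dv o2 (lg_w L))) => u v.
rewrite smf_valD (smf_valM 2%:R) (smf_valM (8%:R * K)) (smf_valM 8%:R) !smf_valX//.
rewrite !smf_nat// smf_cstE//.
by have := sqr_ge0 (v x); lra.
Qed.

Hypothesis Dw0 : axis_derivative_sq L (lg_w L) = 0.

Let D3w : Dv o2 (lg_w L) = 0.
Proof. by apply: smf_reduced; rewrite -axis_derivative_sq_frame. Qed.

Lemma axis_energy_invariant : Dv o2 (axis_energy L) = 0.
Proof.
rewrite /axis_energy axis_frame.
exact: (covariant_energy_flow_invariant (@smf_partialM R 3 D) (@smf_partialC R 3 D) half2
  (lg_torsion_free L) (lg_metric_compat L) (lg_inverseP L) EGE dK RicE fw D3w).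
Qed.

Lemma gradient_norm_sq_convex h x : Dv o2 h = 0 -> D x ->
  mu * gradient_norm_sq L h x <= Dv o2 (Dv o2 (gradient_norm_sq L h)) x.
Proof.
move=> Dh Dx.
have [y [z e]] := hessian_frame_norm (@smf_partialM R 3 D) (@smf_partialC R 3 D) half2
  (lg_torsion_free L) (lg_metric_compat L) (lg_inverseP L) EGE dK RicE fw D3w Dh.
rewrite [leRHS](congr1 (fun u : smf D => u x) e) (smf_valM 2%:R) smf_nat//.
rewrite smf_valD smf_valD (smf_valM K) !smf_valX// smf_cstE// -/(gradient_norm_sq L h).
have := sqr_ge0 (y x); have := sqr_ge0 (z x).
move: (gradient_norm_sq L h x) => u; lra.
Qed.

Lemma geometry_f_eq0 : (forall a, Dv a (axis_energy L) = 0) -> lg_f L = 0.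
Proof.
move=> De.
(* Invertible because 4 K = 2 mu > 0; up to a factor it is the squared length of the trace-free part
   of the shape operator. *)
have [mi mK] : exists mi, (4%:R * K + (B o0 o2 o1 - B o1 o2 o0) ^+ 2) * mi = 1.
  move: (B o0 o2 o1 - B o1 o2 o0) => u; apply: smf_inverse => x Dx.
  rewrite smf_valD (smf_valM 4%:R) smf_valX// smf_nat// smf_cstE//.
  have h := sqr_ge0 (u x); have mu0 := mu_gt0; apply: lt0r_neq0; lra.
apply: (scalar_curvature_eq0 (@smf_partialM R 3 D) (@smf_partialC R 3 D) half2
  (lg_torsion_free L) (lg_metric_compat L) (lg_inverseP L) EGE dK RicE fw
  (@smf_reduced R 3 D) D3w mK) => a.
by have := De a; rewrite /axis_energy axis_frame.
Qed.

End Frame.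
End LocalGeometry.

(** * Invariance of the axis tensors *)

Section ChangeOfCoordinates.
Variables (R : realType) (mu : R) (D D' : open_domain R 3) (phi : smooth_map D D').
Variables (L : local_geometry mu D) (L' : local_geometry mu D').

Definition jacobian : 'M[smf D]_3 := \matrix_(i, j) smf_partial i (smap_coord phi j).

Hypothesis metricE : lg_metric L
  = jacobian *m map_mx (pullback phi) (lg_metric L') *m jacobian^T.
Hypothesis fE : lg_f L = pullback phi (lg_f L').
Variable E' : 'M[smf D']_3.
Hypothesis adE' : adapted_frame L' E'.

Lemma pullback_cst c : pullback phi (smf_cst D' c) = smf_cst D c.
Proof.
apply: smf_eq => x Dx; rewrite pullbackE// !smf_cstE//; exact: smap_maps.
Qed.

Let phi_d i (b : smf D') : smf_partial i (pullback phi b)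
  = \sum_j jacobian i j * pullback phi (smf_partial j b).
Proof.
by rewrite smf_partial_pullback; apply: eq_bigr => j _; rewrite mxE.
Qed.

Let J_closed i j k : smf_partial i (jacobian j k) = smf_partial j (jacobian i k).
Proof. by rewrite !mxE smf_partialC. Qed.

Let half2 : smf_cst D 2^-1 + smf_cst D 2^-1 = 1.
Proof. by rewrite -rmorphD -div1r -splitr rmorph1. Qed.

(** Each invariant below has one formula valid in every adapted frame, so it suffices to carry over
    a single such frame with its derivations and connection coefficients. *)
Lemma pushed_frame_exists : exists E, [/\ adapted_frame L E,
  forall a h, frame_partial (@smf_partial R 3 D) E a (pullback phi h)
    = pullback phi (frame_partial (@smf_partial R 3 D') E' a h)
  & forall a, frame_connection (@smf_partial R 3 D) (lg_metric L) (lg_christoffel L) E a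
    = map_mx (pullback phi) (frame_connection (@smf_partial R 3 D') (lg_metric L')
        (lg_christoffel L') E' a)].
Proof.
(* The inverse of the Jacobian is read off the inverse metric, through G = J G' J^T. *)
have [Ji JiJ] : exists Ji, Ji *m jacobian = 1%:M.
  have e := lg_inverseP L; rewrite metricE mulmxA in e.
  exists (lg_inverse L *m (jacobian *m map_mx (pullback phi) (lg_metric L')))^T.
  by rewrite -[jacobian]trmxK -trmx_mul trmxK (mulmx1C e) trmx1.
have EGE := adE'.1.
have EA := push_frame_orthonormal JiJ EGE metricE.
exists (push_frame (pullback phi) Ji E'); split.
- split; first exact: EA.
  have := @push_frame_ricci _ _ _ _ _ (@smf_partialM R 3 D) (@smf_partialM R 3 D')
    (@smf_partialC R 3 D) (@smf_partialC R 3 D') _ half2 _ _ _ phi_d J_closed JiJ _ _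
    (lg_torsion_free L) (lg_metric_compat L) _ _ _ (lg_torsion_free L')
    (lg_metric_compat L') EGE metricE.
  rewrite -!/(lg_ricci _) adE'.2 => ->; rewrite fE.
  rewrite -(pullback_cst (- mu)).
  move: (lg_f L') (smf_cst D' (-mu)) => a b.
  have [d0 d1 d2 doff] := diag3E a a b.
  have [e0 e1 e2 eoff] := diag3E (pullback phi a) (pullback phi a) (pullback phi b).
  apply/matrixP => i j; rewrite mxE.
  have [<-|ij] := eqVneq i j; last by rewrite doff// eoff// rmorph0.
  by move: i; apply: ord3P; rewrite ?d0 ?d1 ?d2 ?e0 ?e1 ?e2.
- move=> a h; exact: (push_frame_partial phi_d JiJ).
- move=> a; exact: (@push_frame_connection _ _ _ _ _ (@smf_partialM R 3 D)
    (@smf_partialM R 3 D') _ half2 _ _ _ phi_d J_closed JiJ _ _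
    (lg_torsion_free L) (lg_metric_compat L) _ _ _ (lg_torsion_free L')
    (lg_metric_compat L') EGE metricE).
Qed.

Lemma pullback_w : lg_w L = pullback phi (lg_w L').
Proof.
have e : pullback phi (lg_w L') * (lg_f L + smf_cst D mu) = 1.
  by rewrite fE -pullback_cst -rmorphD -rmorphM lg_fw rmorph1.
by rewrite -[LHS]mul1r -e -mulrA [X in _ * X]mulrC lg_fw mulr1.
Qed.

Lemma pullback_axis_derivative_sq h :
  axis_derivative_sq L (pullback phi h) = pullback phi (axis_derivative_sq L' h).
Proof.
have [E [adE dE _]] := pushed_frame_exists.
by rewrite (axis_derivative_sq_frame adE) (axis_derivative_sq_frame adE') rmorphXn; congr (_ ^+ _); exact: dE.
Qed.

Lemma pullback_gradient_norm_sq h :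
  gradient_norm_sq L (pullback phi h) = pullback phi (gradient_norm_sq L' h).
Proof.
have [E [adE dE _]] := pushed_frame_exists.
rewrite (gradient_norm_sq_frame adE) (gradient_norm_sq_frame adE').
by rewrite !rmorphD !rmorphXn; congr (_ ^+ _ + _ ^+ _ + _ ^+ _); exact: dE.
Qed.

Lemma pullback_axis_energy : axis_energy L = pullback phi (axis_energy L').
Proof.
have [E [adE _ cE]] := pushed_frame_exists.
rewrite (axis_energy_frame adE) (axis_energy_frame adE') rmorphM rmorph_nat; congr (_ * _).
have e i j k : frame_connection (@smf_partial R 3 D) (lg_metric L) (lg_christoffel L) E i j k
    = pullback phi (frame_connection (@smf_partial R 3 D') (lg_metric L')
        (lg_christoffel L') E' i j k) by rewrite cE mxE.
by rewrite !e !rmorphD !rmorphXn.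
Qed.

End ChangeOfCoordinates.

(** * Geometry on the manifold *)

Section ManifoldGeometry.
Variables (R : realType) (M : smooth_manifold R 3) (mu : R).
Implicit Types (c d : chart_index M) (p : M).

Definition chart_domain c : open_domain R 3 := OpenDomain (@chart_image_open _ _ M c).

Lemma chart_domainP c x : chart_domain c x -> dom c (chart_inv c x) /\ chart c (chart_inv c x) = x.
Proof. by case=> p cp <-; rewrite chartK. Qed.

Lemma chart_domain_chart c p : dom c p -> chart_domain c (chart c p).
Proof. by move=> cp; exists p. Qed.

Definition overlap c d : set 'rV[R]_3 := chart c @` (dom c `&` dom d).

Lemma overlapP c d x : chart_domain c x -> dom d (chart_inv c x) -> overlap c d x.
Proof. by move=> /chart_domainP[cx e] dx; exists (chart_inv c x). Qed.

Lemma overlap_chart_domain c d x : overlap c d x -> chart_domain c x.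
Proof. by move=> [p [cp dp] <-]; exact: chart_domain_chart. Qed.

Lemma overlap_dom c d x : overlap c d x -> dom d (chart_inv c x).
Proof. by move=> [p [cp dp] <-]; rewrite chartK. Qed.

Lemma overlap_open c d : open (overlap c d).
Proof.
have -> : overlap c d = chart_domain c `&` chart_inv c @^-1` dom d.
  apply/seteqP; split=> x => [ox|[cx dx]]; last exact: overlapP.
  by split; [exact: overlap_chart_domain ox|exact: overlap_dom ox].
rewrite openE => x [cx dx]; have := @chart_inv_continuous _ _ M c.
rewrite continuous_open_subspace; last exact: chart_image_open.
move=> /(_ x (mem_set cx)) cc.
apply: filterI; first exact: open_nbhs_nbhs (conj (@domain_open _ _ (chart_domain c)) cx).
apply: cc; exact: open_nbhs_nbhs (conj (@dom_open _ _ M d) dx).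
Qed.

Section Transition.
Variables (c d : chart_index M) (D' : open_domain R 3).

Let transition_open : open [set x | overlap c d x /\ D' (transition c d x)].
Proof.
rewrite openE => x [ox D'x].
have ct := @smooth_components_continuous _ _ _ (@overlap_open c d) _ x
  (@transition_smooth _ _ M c d) ox.
have n1 : nbhs x (overlap c d) by exact: open_nbhs_nbhs (conj (@overlap_open c d) ox).
have n2 : nbhs x [set y | D' (transition c d y)].
  apply: ct; exact: open_nbhs_nbhs (conj (@domain_open _ _ D') D'x).
by apply: filterS (filterI n1 n2).
Qed.

(** The set [D'] will be the domain of an adapted frame in the chart d. *)
Definition transition_domain : open_domain R 3 := OpenDomain transition_open.

Lemma transition_domain_overlap : transition_domain `<=` overlap c d.
Proof. by move=> x []. Qed.

Definition transition_map : smooth_map transition_domain D' :=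
  @SmoothMap _ _ _ _ (transition c d)
    (fun j => @smooth_on_sub _ _ transition_domain
      (OpenDomain (@overlap_open c d)) transition_domain_overlap _
      (@transition_smooth _ _ M c d j))
    (fun x Wx => Wx.2).

End Transition.

Variable L : forall c, local_geometry mu (chart_domain c).
Hypothesis metric_pos : forall c x (Dx : chart_domain c x) (v : 'rV[R]_3), v != 0 ->
  0 < (v *m eval_mx Dx (lg_metric (L c)) *m v^T) 0 0.
Hypothesis ricci_char : forall c x (Dx : chart_domain c x),
  char_poly (eval_mx Dx (lg_ricci (L c)) *m invmx (eval_mx Dx (lg_metric (L c))))
  = \prod_(l <- [:: - mu; lg_f (L c) x; lg_f (L c) x]) ('X - l%:P).
Hypothesis metric_transition : forall c d x, overlap c d x -> forall i j,
  lg_metric (L c) i j x = \sum_k \sum_l jac (transition c d) x i k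
    * lg_metric (L d) k l (transition c d x) * jac (transition c d) x j l.

(** Such a family is a smooth function on M, given by its expressions in the charts. *)
Definition chart_independent (u : forall c, smf (chart_domain c)) := forall c d x,
  overlap c d x -> u c x = u d (transition c d x).

Hypothesis f_independent : chart_independent (fun c => lg_f (L c)).

Lemma lg_ricci_sym c : (lg_ricci (L c))^T = lg_ricci (L c).
Proof.
have half2 : smf_cst (chart_domain c) 2^-1 + smf_cst (chart_domain c) 2^-1 = 1.
  by rewrite -rmorphD -div1r -splitr rmorph1.
have [E EGE] := orthonormal_frame_exists (lg_sym (L c)) (metric_pos (c := c)).
exact: (ricci_of_sym (@smf_partialM R 3 (chart_domain c)) (@smf_partialC R 3 (chart_domain c))
  half2 (lg_torsion_free (L c)) (lg_metric_compat (L c)) EGE).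
Qed.

Lemma adapted_frame_at c x : chart_domain c x ->
  exists (D' : open_domain R 3) (s : D' `<=` chart_domain c),
    D' x /\ exists E, adapted_frame (restrict_geometry s (L c)) E.
Proof.
move=> cx; have [D' [s [D'x [E [EG ER]]]]] := adapted_frame_exists cx (lg_sym (L c))
  (metric_pos (c := c)) (lg_ricci_sym c) (lg_fw (L c)) (ricci_char (c := c)).
exists D', s; split=> //; exists E.
have [Em _ _ Ef _] := restrict_geometryP s (L c).
by split; rewrite ?Em ?res_ricci ?Ef.
Qed.

Section Independent.
Variables (c d : chart_index M) (D' : open_domain R 3) (s : D' `<=` chart_domain d).

Let W := transition_domain c d D'.
Let phi := transition_map c d D'.

Let sW : W `<=` chart_domain c.
Proof. by move=> x [/overlap_chart_domain]. Qed.

Lemma chart_independent_pullback u : chart_independent u ->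
  smf_res sW (u c) = pullback phi (smf_res s (u d)).
Proof.
move=> uI; apply: smf_eq => x Wx; rewrite smf_resE// pullbackE//.
by rewrite smf_resE; [exact: uI Wx.1|exact: Wx.2].
Qed.

Let L1 := restrict_geometry sW (L c).
Let L2 := restrict_geometry s (L d).

Lemma transition_f : lg_f L1 = pullback phi (lg_f L2).
Proof.
have [_ _ _ -> _] := restrict_geometryP sW (L c).
have [_ _ _ -> _] := restrict_geometryP s (L d).
exact: (chart_independent_pullback f_independent).
Qed.

Lemma transition_metric :
  lg_metric L1 = jacobian phi *m map_mx (pullback phi) (lg_metric L2) *m (jacobian phi)^T.
Proof.
have [-> _ _ _ _] := restrict_geometryP sW (L c).
have [-> _ _ _ _] := restrict_geometryP s (L d).
apply/matrixP => i j; rewrite [LHS]mxE; apply: smf_eq => x Wx.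
have jE k l : jacobian phi k l x = jac (transition c d) x k l.
  by rewrite [jacobian phi k l]mxE [RHS]mxE; exact: smap_partialE.
rewrite smf_resE// (metric_transition Wx.1) [X in _ = smf_val X _]mxE smf_val_sum exchange_big /=.
apply: eq_bigr => l _; rewrite smf_valM [X in _ = smf_val X x * _]mxE smf_val_sum mulr_suml.
apply: eq_bigr => k _; rewrite smf_valM [X in _ = _ * smf_val X x]mxE !jE; congr (_ * _ * _).
rewrite [X in _ = smf_val X _]mxE [X in pullback _ X]mxE pullbackE// smf_resE//; exact: Wx.2.
Qed.

End Independent.

(** A point of an overlap has a neighbourhood carrying an adapted frame of the second chart. There
    the two expressions are compared by restricting both and pulling one back. *)
Lemma independent_of_frames u (T : forall D, local_geometry mu D -> smf D -> smf D) :
  (forall (D' D : open_domain R 3) (s : D' `<=` D) (K : local_geometry mu D) h,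
    T D' (restrict_geometry s K) (smf_res s h) = smf_res s (T D K h)) ->
  (forall D D' (phi : smooth_map D D') (K : local_geometry mu D) (K' : local_geometry mu D'),
    lg_metric K = jacobian phi *m map_mx (pullback phi) (lg_metric K') *m (jacobian phi)^T ->
    lg_f K = pullback phi (lg_f K') ->
    forall E', adapted_frame K' E' ->
    forall h, T D K (pullback phi h) = pullback phi (T D' K' h)) ->
  chart_independent u -> chart_independent (fun c => T _ (L c) (u c)).
Proof.
move=> Tres Tpull uI c d x ox.
have dx : chart_domain d (transition c d x).
  exact: chart_domain_chart (overlap_dom ox).
have [D' [s [D'x [E' adE']]]] := adapted_frame_at dx.
have Wx : transition_domain c d D' x by split.
have sW : transition_domain c d D' `<=` chart_domain c.
  by move=> y [/overlap_chart_domain].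
have := Tpull _ _ _ _ _ (transition_metric c s) (transition_f c s) _ adE' (smf_res s (u d)).
rewrite -(chart_independent_pullback c s uI) !Tres.
move/(congr1 (fun h : smf _ => h x)); rewrite smf_resE// pullbackE// smf_resE//.
Qed.

Lemma axis_derivative_sq_independent u : chart_independent u ->
  chart_independent (fun c => axis_derivative_sq (L c) (u c)).
Proof.
apply: (@independent_of_frames u (fun D K h => axis_derivative_sq K h)).
  by move=> *; exact: res_axis_derivative_sq.
by move=> D D' phi K K' eG ef E' adE' h; exact: (pullback_axis_derivative_sq eG ef adE').
Qed.

Lemma gradient_norm_sq_independent u : chart_independent u ->
  chart_independent (fun c => gradient_norm_sq (L c) (u c)).
Proof.
apply: (@independent_of_frames u (fun D K h => gradient_norm_sq K h)).
  by move=> *; exact: res_gradient_norm_sq.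
by move=> D D' phi K K' eG ef E' adE' h; exact: (pullback_gradient_norm_sq eG ef adE').
Qed.

Lemma axis_energy_independent : chart_independent (fun c => axis_energy (L c)).
Proof.
apply: (@independent_of_frames _ (fun D K h => axis_energy K)) f_independent.
  by move=> *; exact: res_axis_energy.
by move=> D D' phi K K' eG ef E' adE' h; exact: (pullback_axis_energy eG ef adE').
Qed.

Lemma lg_w_independent : chart_independent (fun c => lg_w (L c)).
Proof.
apply: (@independent_of_frames _ (fun D K h => lg_w K)) f_independent.
  by move=> D' D s K h; case: (restrict_geometryP s K).
by move=> D D' phi K K' eG ef E' adE' h; exact: (pullback_w ef).
Qed.

Hypothesis M_compact : compact [set: M].

(** Compactness is applied to the function [F] on M that the family defines; near each point [F] is
    [u d] composed with one fixed chart, hence continuous. *)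
Lemma chart_independent_max u : chart_independent u ->
  exists c x, chart_domain c x /\ forall d y, chart_domain d y -> u d y <= u c x.
Proof.
move=> uI.
pose cp (p : M) : chart_index M := sval (cid (dom_cover p)).
have cpP p : dom (cp p) p := svalP (cid (dom_cover p)).
pose F (p : M) : R := u (cp p) (chart (cp p) p).
have FE d p : dom d p -> F p = u d (chart d p).
  move=> dp; rewrite /F (uI (cp p) d); first by rewrite /transition chartK.
  by exists p.
have cF : {within [set: M], continuous F}.
  apply/continuous_subspaceT => p; have dp := cpP p; move: (cp p) dp => d dp.
  have n : nbhs p (dom d) by exact: open_nbhs_nbhs (conj (@dom_open _ _ M d) dp).
  have cd : {for p, continuous (chart d)}.
    have := @chart_continuous _ _ M d; rewrite continuous_open_subspace; last exact: dom_open.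
    by apply; exact: mem_set.
  have cu : {for chart d p, continuous (u d)}.
    apply: smooth_on_continuous (smf_smooth (u d)) (chart_domain_chart dp).
    exact: domain_open.
  rewrite /continuous_at (FE d p dp); apply: cvg_trans (continuous_comp cd cu).
  apply: near_eq_cvg; apply: filterS n => q dq /=.
  by rewrite (FE d q dq).
have [p _ pmax] := @compact_EVT_max M R F _ (manifold_nonempty M) M_compact cF.
exists (cp p), (chart (cp p) p); split; first exact: chart_domain_chart.
move=> d y dy; have [dq e] := chart_domainP dy.
have := pmax (chart_inv d y); rewrite in_setT => /(_ isT).
by rewrite (FE d) // e.
Qed.

(* At a maximum point the first derivatives of u vanish, so T (T u) is the second
   derivative of u in the direction T, which is nonpositive. *)
Lemma max_principle u (k : R) : chart_independent u -> 0 < k ->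
  (forall c x, 0 <= u c x) ->
  (forall c (D' : open_domain R 3) (s : D' `<=` chart_domain c) E,
    adapted_frame (restrict_geometry s (L c)) E -> forall x, D' x ->
    k * smf_res s (u c) x <=
    frame_partial (@smf_partial R 3 D') E o2
      (frame_partial (@smf_partial R 3 D') E o2 (smf_res s (u c))) x) ->
  forall c, u c = 0.
Proof.
move=> uI k0 u0 uconvex.
have [c [x [cx xmax]]] := chart_independent_max uI.
suff ux : u c x <= 0.
  move=> d; apply: smf_eq => y dy; rewrite smf_val0; apply/eqP; rewrite eq_le u0 andbT.
  exact: le_trans (xmax d y dy) ux.
have [D' [s [D'x [E adE]]]] := adapted_frame_at cx.
have := uconvex _ _ _ _ adE _ D'x; set h := smf_res s (u c).
have hx : h x = u c x by rewrite smf_resE.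
have hmax y : D' y -> h y <= h x.
  by move=> D'y; rewrite hx smf_resE//; exact: xmax (s y D'y).
have Do := @domain_open _ _ D'.
have dh0 i : smf_partial i h x = 0.
  by rewrite smf_partialE//; exact: (partial_at_max Do (smf_smooth h) D'x hmax i).
have hess := hessian_at_max Do (smf_smooth h) D'x hmax (\row_i E o2 i x).
suff -> : frame_partial (@smf_partial R 3 D') E o2 (frame_partial (@smf_partial R 3 D') E o2 h) x
   = \sum_i \sum_j (\row_i E o2 i x) 0 i * (\row_i E o2 i x) 0 j * partial i (partial j h) x.
  by move=> H; have := le_trans H hess; rewrite hx pmulr_rle0.
rewrite [X in smf_val X]/frame_partial smf_val_sum; apply: eq_bigr => i _.
rewrite smf_valM /frame_partial raddf_sum smf_val_sum mulr_sumr; apply: eq_bigr => j _.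
rewrite /= smf_partialM smf_valD !smf_valM dh0 mulr0 add0r !mxE mulrA; congr (_ * _).
exact: (@smf_partial_eq _ _ _ i _ (partial j h) x (@smf_partialE _ _ _ j h)).
Qed.

Hypothesis mu_gt0 : 0 < mu.

(** First use of the maximum principle, for (T w)^2, with constant 4 mu; in a local frame this
    function is visibly a square, hence nonnegative. *)
Lemma axis_derivative_sq_w0 c : axis_derivative_sq (L c) (lg_w (L c)) = 0.
Proof.
pose u d := axis_derivative_sq (L d) (lg_w (L d)).
have uI : chart_independent u := axis_derivative_sq_independent lg_w_independent.
have res d (D' : open_domain R 3) (s : D' `<=` chart_domain d) : smf_res s (u d)
    = axis_derivative_sq (restrict_geometry s (L d)) (lg_w (restrict_geometry s (L d))).
  by have [_ _ _ _ ->] := restrict_geometryP s (L d); rewrite res_axis_derivative_sq.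
apply: (max_principle (u := u) (k := 4 * mu) uI) => [|d x|d D' s E adE x D'x].
- by rewrite mulr_gt0.
- have [dx|dx] := pselect (chart_domain d x); last by rewrite smf_out.
  have [D' [s [D'x [E adE]]]] := adapted_frame_at dx.
  by rewrite -(smf_resE s _ D'x) res; exact: (axis_derivative_sq_ge0 adE).
- by rewrite res; exact: (axis_derivative_sq_convex adE).
Qed.

(** Second use of the maximum principle, with constant mu. The invariance of [axis_energy] along T
    and the convexity both rest on T w = 0. *)
Lemma gradient_axis_energy0 c : gradient_norm_sq (L c) (axis_energy (L c)) = 0.
Proof.
pose u d := gradient_norm_sq (L d) (axis_energy (L d)).
have uI : chart_independent u := gradient_norm_sq_independent axis_energy_independent.
have res d (D' : open_domain R 3) (s : D' `<=` chart_domain d) : smf_res s (u d)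
    = gradient_norm_sq (restrict_geometry s (L d)) (axis_energy (restrict_geometry s (L d))).
  by rewrite res_axis_energy res_gradient_norm_sq.
apply: (max_principle (u := u) (k := mu) uI) => [//|d x|d D' s E adE x D'x].
- have [dx|dx] := pselect (chart_domain d x); last by rewrite smf_out.
  have [D' [s [D'x [E adE]]]] := adapted_frame_at dx.
  by rewrite -(smf_resE s _ D'x) res; exact: (gradient_norm_sq_ge0 adE).
- have Dw0 : axis_derivative_sq (restrict_geometry s (L d))
      (lg_w (restrict_geometry s (L d))) = 0.
    have [_ _ _ _ ->] := restrict_geometryP s (L d).
    by rewrite res_axis_derivative_sq axis_derivative_sq_w0 rmorph0.
  rewrite res; apply: (gradient_norm_sq_convex adE Dw0) => //.
  exact: (axis_energy_invariant adE Dw0).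
Qed.

Lemma manifold_f_eq0 c x : chart_domain c x -> lg_f (L c) x = 0.
Proof.
move=> cx; have [D' [s [D'x [E adE]]]] := adapted_frame_at cx.
have [_ _ _ ef ew] := restrict_geometryP s (L c).
have Dw0 : axis_derivative_sq (restrict_geometry s (L c))
    (lg_w (restrict_geometry s (L c))) = 0.
  by rewrite ew res_axis_derivative_sq axis_derivative_sq_w0 rmorph0.
have De := gradient_norm_sq_eq0 adE (h := axis_energy (restrict_geometry s (L c))).
have /De{}De : gradient_norm_sq (restrict_geometry s (L c))
    (axis_energy (restrict_geometry s (L c))) = 0.
  by rewrite res_axis_energy res_gradient_norm_sq gradient_axis_energy0 rmorph0.
have := geometry_f_eq0 adE mu_gt0 Dw0 De.
by rewrite ef => /(congr1 (fun h : smf _ => h x)); rewrite smf_resE// smf_val0.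
Qed.

End ManifoldGeometry.

Section MetricGeometry.
Variables (R : realType) (M : smooth_manifold R 3) (mu : R) (mu_gt0 : 0 < mu).
Variables (f : M -> R) (f_smooth : smooth_function f) (f_gt0 : forall p, 0 < f p).
Variable g : riemannian_metric M.

Lemma chart_geometry_exists c : exists L : local_geometry mu (chart_domain c),
  [/\ forall x, chart_domain c x -> forall i j, lg_metric L i j x = metric_coef g c x i j,
      forall x, chart_domain c x -> lg_f L x = f (chart_inv c x)
    & forall x (Dx : chart_domain c x), eval_mx Dx (lg_ricci L) = ricci (metric_coef g c) x].
Proof.
set D := chart_domain c.
pose G : 'M[smf D]_3 := \matrix_(i, j) mk_smf (metric_smooth g c i j : smooth_on D _).
have GE x : D x -> forall i j, G i j x = metric_coef g c x i j.
  by move=> Dx i j; rewrite [X in smf_val X]mxE; exact: mk_smfE.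
have Gev x (Dx : D x) : eval_mx Dx G = metric_coef g c x.
  by apply/matrixP => i j; rewrite [LHS]mxE; exact: GE.
have Gsym : G^T = G.
  apply/matrixP => i j; rewrite [LHS]mxE; apply: smf_eq => x Dx.
  by rewrite !GE// -[in RHS](Defs.metric_sym g Dx) mxE.
have Gpos x (Dx : D x) (v : 'rV[R]_3) : v != 0 -> 0 < (v *m eval_mx Dx G *m v^T) 0 0.
  by rewrite Gev; exact: metric_posdef.
have [E EGE] := orthonormal_frame_exists Gsym Gpos.
have [Gi GiG] : exists Gi, Gi *m G = 1%:M.
  by exists (E^T *m E); rewrite -mulmxA; exact: (mulmx1C EGE).
have half2 : smf_cst D 2^-1 + smf_cst D 2^-1 = 1.
  by rewrite -rmorphD -div1r -splitr rmorph1.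
(* The symbols are known only through the equation [CE], which keeps their formula from being
   unfolded. *)
have [C CE] : exists C : 'I_3 -> 'M[smf D]_3,
    forall i, C i = christoffel_mx (@smf_partial R 3 D) G Gi (smf_cst D 2^-1) i by eexists.
pose F : smf D := mk_smf (f_smooth c : smooth_on D _).
have FE x : D x -> F x = f (chart_inv c x) by exact: mk_smfE.
have [w wF] : exists w : smf D, (F + smf_cst D mu) * w = 1.
  apply: smf_inverse => x Dx; rewrite smf_valD smf_cstE// FE//.
  by rewrite gt_eqF// addr_gt0.
have tor i j k : C i j k = C j i k.
  by rewrite !CE; exact: christoffel_torsion_free.
have comp i : mx_partial (@smf_partial R 3 D) i G = C i *m G + G *m (C i)^T.
  by rewrite CE; exact: christoffel_metric.
have Fw : w * (F + smf_cst D mu) = 1 by rewrite mulrC.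
exists (LocalGeometry Gsym GiG tor comp Fw); split=> //= x Dx.
by rewrite (ricciE GE GiG CE).
Qed.
End MetricGeometry.

Theorem theorem1 (R : realType) (M : smooth_manifold R 3)
    (M_closed : closed_manifold M)
    (mu : R) (mu_gt0 : 0 < mu)
    (f : M -> R) (f_smooth : smooth_function f) (f_gt0 : forall p, 0 < f p) :
  ~ exists g : riemannian_metric M,
      forall p : M, principal_ricci_curvatures g p [:: - mu; f p; f p].
Proof.
case=> g curv.
pose geo := chart_geometry_exists mu_gt0 f_smooth f_gt0 g.
pose L c := sval (cid (geo c)).
have GE c x : chart_domain c x -> forall i j, lg_metric (L c) i j x = metric_coef g c x i j.
  by move=> Dx; have [h _ _] := svalP (cid (geo c)); exact: h.
have FE c x : chart_domain c x -> lg_f (L c) x = f (chart_inv c x).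
  by move=> Dx; have [_ h _] := svalP (cid (geo c)); exact: h.
have RE c x (Dx : chart_domain c x) : eval_mx Dx (lg_ricci (L c)) = ricci (metric_coef g c) x.
  by have [_ _ h] := svalP (cid (geo c)); exact: h.
clearbody L.
have Gev c x (Dx : chart_domain c x) : eval_mx Dx (lg_metric (L c)) = metric_coef g c x.
  by apply/matrixP => i j; rewrite [LHS]mxE; exact: GE.
have metric_pos c x (Dx : chart_domain c x) (v : 'rV[R]_3) : v != 0 ->
    0 < (v *m eval_mx Dx (lg_metric (L c)) *m v^T) 0 0.
  by rewrite Gev; exact: metric_posdef.
have ricci_char c x (Dx : chart_domain c x) :
    char_poly (eval_mx Dx (lg_ricci (L c)) *m invmx (eval_mx Dx (lg_metric (L c))))
    = \prod_(l <- [:: - mu; lg_f (L c) x; lg_f (L c) x]) ('X - l%:P).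
  rewrite Gev RE FE//; have [cx e] := chart_domainP Dx.
  by have := curv _ c cx; rewrite /ricci_endo e.
have metric_transition c d x : overlap c d x -> forall i j, lg_metric (L c) i j x
    = \sum_k \sum_l jac (transition c d) x i k
        * lg_metric (L d) k l (transition c d x) * jac (transition c d) x j l.
  move=> ox i j; rewrite GE; last exact: overlap_chart_domain ox.
  rewrite (metric_change g ox) mxE exchange_big; apply: eq_bigr => l _ /=.
  rewrite [X in X * _]mxE [X in _ * X]mxE mulr_suml; apply: eq_bigr => k _.
  by rewrite GE//; exact: chart_domain_chart (overlap_dom ox).
have f_independent : chart_independent (fun c => lg_f (L c)).
  move=> c d x ox; have dx := overlap_dom ox.
  rewrite !FE; [by rewrite /transition chartK| exact: chart_domain_chart|].
  exact: overlap_chart_domain ox.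
(* Since M is nonempty, there is a point at which f = 0 contradicts f > 0. *)
have [p _] := manifold_nonempty M; have [c cp] := dom_cover p.
have cx := chart_domain_chart cp.
have := manifold_f_eq0 metric_pos ricci_char metric_transition f_independent M_closed mu_gt0 cx.
by rewrite FE// chartK// => fp0; have := f_gt0 p; rewrite fp0 ltxx.
Qed.
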